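(* Let $\{\Gamma_a\}_{a\in A}$ be a family of hypersurfaces in $\mathbb{R}^n$ of one of the types (i)–(iii) described in the context. Let $E\subseteq\mathbb{R}^n$ be a Lebesgue measurable set that contains, for each $a\in A$, a translated copy of $\Gamma_a$. Then for every $\delta\in(0,1/2)$, $$|E(\delta)|\ge c\,|\log\delta|^{-1},$$ where $c>0$ depends only on $|A|$ and the data of the corresponding type. In particular, $E$ has Minkowski dimension $n$.
   Context: $A\subseteq\mathbb{R}$ is a compact interval of positive length $|A|$. Subscripts denote partial derivatives of $g(a,t)$. For $g$ on $A\times I$: $\|g\|_\infty=\sup|g|$, $\|g\|_{\mathrm{Lip}}=\sup_{(\bar a,\bar t)\neq(a,t)}\frac{|g(\bar a,\bar t)-g(a,t)|}{|\bar a-a|+|\bar t-t|}$, $\|g\|_{\mathrm{reg}}=\|g_t\|_\infty+\|g_t\|_{\mathrm{Lip}}+\|g_{tt}\|_{\mathrm{Lip}}$ (finiteness includes existence of $g_t,g_{tt}$). For $E\subseteq\mathbb{R}^n$, $E(\delta)=\{x+y:x\in E,|y|<\delta\}$; $|E|$ is Lebesgue measure. Having (full) Minkowski dimension $n$ is understood in the sense that for every sufficiently small $\eta>0$ there is $c_\eta>0$ with $|E(\delta)|\ge c_\eta\delta^\eta$ for all sufficiently small $\delta>0$. Nondegenerate away from the origin ($I\subseteq[1,2]$ a compact interval): $\|g\|_{\mathrm{reg}}<\infty$, $g_t\ne0$ on $A\times I$, and $\lambda_1:=\inf_{t\in I}\inf_{\bar a\ne a\in A}\frac{|g_t(\bar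 a,t)-g_t(a,t)|}{|\bar a-a|}>0$. Nondegenerate near the origin ($I=[0,b]$, $0<b\le1$): $\|g\|_{\mathrm{reg}}<\infty$; there is $L>0$ with $|(g_{tt}(\bar a,\bar t)-g_{tt}(a,\bar t))-(g_{tt}(\bar a,t)-g_{tt}(a,t))|\le L|\bar a-a||\bar t-t|$ for all $(a,t),(\bar a,\bar t)\in A\times I$; $g_t(a,0)=0$ for all $a$; $g_{tt}\neq0$ on $A\times I$; and $\lambda_2:=\inf_{t\in I}\inf_{\bar a\ne a\in A}\left|\frac{g_{tt}(\bar a,t)-g_{tt}(a,t)}{\bar a-a}\right|>0$. Elliptic cinematic curvature condition: $\kappa:=\inf_{(\bar a,\bar t)\ne(a,t)\in A\times I}\frac{|g_t(\bar a,\bar t)-g_t(a,t)|+|g_{tt}(\bar a,\bar t)-g_{tt}(a,t)|}{|\bar a-a|+|\bar t-t|}>0$, and for all $\bar a\ne a$ in $A$ and $\bar t>t$ in $I$, $D\cdot(g_t(\bar a,t)-g_t(a,t))\cdot g_t(a,t)>0$, where $D=\det\begin{pmatrix}g_t(\bar a,\bar t)-g_t(\bar a,t)&g_t(\bar a,t)-g_t(a,t)\\ g_{tt}(\bar a,\bar t)-g_{tt}(\bar a,t)&g_{tt}(\bar a,t)-g_{tt}(a,t)\end{pmatrix}$. Types of families: (i) $n\ge4$, $g:A\times I\to\mathbb{R}$ nondegenerate away from the origin, $\Gamma_a=\{(X,g(a,|X|))\in\mathbb{R}^{n-1}\times\mathbb{R}:|X|\in I'\}$, where $I'$ is the compact interval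 with the same right endpoint as $I$ and length $|I|/2$. Data: $n,|I|,\|g\|_{\mathrm{reg}},\inf|g_t|,\lambda_1$. (ii) $n=3$, $g$ nondegenerate away from the origin satisfying the elliptic cinematic curvature condition, $\Gamma_a$ as in (i). Data: as in (i), and $\kappa$. (iii) $n\ge3$, $g:A\times[0,b]\to\mathbb{R}$ nondegenerate near the origin, and $\Gamma_a=\Gamma_{a,\varepsilon}$, where $\Gamma_{a,s}:=\{(X,g(a,|X|)):X\in\mathbb{R}^{n-1},|X|\le s\}$ and $\varepsilon\in(0,b]$, together with a constant $C_0$, is such that $\varepsilon^{-1}$ and $C_0$ are bounded in terms of the data and $\sup_{\tau\in\mathbb{R}^n}|(\Gamma_{a,b}(\delta)+\tau)\cap\Gamma_{\bar a,\varepsilon}(\delta)|\le C_0\frac{\delta^2}{\delta+|\bar a-a|}$ for all $a,\bar a\in A$, $\delta\in(0,1)$ (such $\varepsilon,C_0$ exist). Data: $n,b,\|g\|_{\mathrm{reg}},L,\inf|g_{tt}|,\lambda_2$. *)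

(* Defs.v *)
From HB Require Import structures.
From mathcomp Require Import all_boot all_order all_algebra.
From mathcomp Require Import all_classical all_reals all_analysis.

Set Implicit Arguments.
Unset Strict Implicit.
Unset Printing Implicit Defensive.

Import Order.TTheory GRing.Theory Num.Theory.
Import numFieldNormedType.Exports.

Local Open Scope classical_set_scope.
Local Open Scope ring_scope.

Section EuclideanSpace.
Context {R : realType} {n : nat}.
Implicit Types (x y a b tau : 'rV[R]_n) (E S : set 'rV[R]_n).

(* The library's norm on 'rV[R]_n is the sup norm. *)
Definition enorm x : R := Num.sqrt (\sum_(i < n) x 0 i ^+ 2).

Definition neighborhood E (delta : R) : set 'rV[R]_n :=
  [set x + y | x in E & y in [set y | enorm y < delta]].

Definition translate S tau : set 'rV[R]_n := [set x + tau | x in S].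

Definition box a b : set 'rV[R]_n := [set x | forall i, a 0 i <= x 0 i <= b 0 i].

(* If b 0 i < a 0 i for some i, then the box is empty and its volume is 0. *)
Definition box_volume a b : R := \prod_(i < n) Num.max 0 (b 0 i - a 0 i).

(* n-dimensional Lebesgue outer measure; on Lebesgue measurable sets (those
   satisfying Caratheodory's criterion) it is Lebesgue measure. *)
Definition lebesgue_rV E : \bar R :=
  ereal_inf [set (\sum_(k <oo) (box_volume (B k).1 (B k).2)%:E)%E
            | B in [set B : nat -> 'rV[R]_n * 'rV[R]_n
                   | E `<=` \bigcup_k box (B k).1 (B k).2]].

Definition lebesgue_measurable E : Prop := lebesgue_rV.-caratheodory E.

Definition full_minkowski_dimension E : Prop :=
  \forall eta \near (0 : R)^'+, exists2 c : R, 0 < c &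
    \forall delta \near (0 : R)^'+,
      ((c * delta `^ eta)%:E <= lebesgue_rV (neighborhood E delta))%E.

End EuclideanSpace.

Section DerivativesAndNorms.
Context {R : realType}.
Implicit Types (A I : set R) (g h : R -> R -> R).

(* Derivatives relative to I: one-sided at the endpoints when I is a compact
   interval; the values of f outside I play no role at points of I. *)
Definition diff_quotient (f : R -> R) (t s : R) : R := (f s - f t) / (s - t).

Definition derivable_within I (f : R -> R) (t : R) : Prop :=
  cvg (diff_quotient f t @ within I t^').

Definition derive_within I (f : R -> R) (t : R) : R :=
  lim (diff_quotient f t @ within I t^').

Definition dt I g : R -> R -> R := fun a t => derive_within I (g a) t.

Definition sup_norm A I h : \bar R :=
  ereal_sup [set (`|h a t|)%:E | a in A & t in I].

Definition lip_seminorm A I h : \bar R :=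
  ereal_sup [set q | exists a a' t t',
    [/\ A a /\ I t, A a' /\ I t', (a', t') <> (a, t)
      & q = (`|h a' t' - h a t| / (`|a' - a| + `|t' - t|))%:E]].

Definition reg_norm A I g : \bar R :=
  (sup_norm A I (dt I g) + lip_seminorm A I (dt I g)
   + lip_seminorm A I (dt I (dt I g)))%E.

Definition finite_reg A I g : Prop :=
  [/\ (forall a t, A a -> I t -> derivable_within I (g a) t),
      (forall a t, A a -> I t -> derivable_within I (dt I g a) t)
    & (reg_norm A I g < +oo)%E].

Definition inf_abs A I h : R := inf [set `|h a t| | a in A & t in I].

Definition inf_slope A I h : R :=
  inf [set inf [set r | exists a a',
                  [/\ A a, A a', a' <> a & r = `|h a' t - h a t| / `|a' - a|]]
      | t in I].

Definition nondegenerate_away A I g : Prop :=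
  [/\ finite_reg A I g,
      (forall a t, A a -> I t -> dt I g a t != 0)
    & 0 < inf_slope A I (dt I g)].

Definition mixed_lipschitz A I g (L : R) : Prop :=
  let gtt := dt I (dt I g) in
  forall a a' t t', A a -> A a' -> I t -> I t' ->
    `|(gtt a' t' - gtt a t') - (gtt a' t - gtt a t)|
      <= L * `|a' - a| * `|t' - t|.

Definition nondegenerate_near A I g (L : R) : Prop :=
  [/\ finite_reg A I g /\ (0 < L /\ mixed_lipschitz A I g L),
      (forall a, A a -> dt I g a 0 = 0),
      (forall a t, A a -> I t -> dt I (dt I g) a t != 0)
    & 0 < inf_slope A I (dt I (dt I g))].

Definition cinematic_curvature A I g : R :=
  let gt := dt I g in let gtt := dt I (dt I g) in
  inf [set r | exists a a' t t',
    [/\ A a /\ I t, A a' /\ I t', (a', t') <> (a, t)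
      & r = (`|gt a' t' - gt a t| + `|gtt a' t' - gtt a t|)
            / (`|a' - a| + `|t' - t|)]].

Definition det2 (p q r s : R) : R := p * s - q * r.

Definition elliptic_cinematic A I g : Prop :=
  let gt := dt I g in let gtt := dt I (dt I g) in
  0 < cinematic_curvature A I g /\
  forall a a' t t', A a -> A a' -> a' <> a -> I t -> I t' -> t < t' ->
    0 < det2 (gt a' t' - gt a' t) (gt a' t - gt a t)
             (gtt a' t' - gtt a' t) (gtt a' t - gtt a t)
        * (gt a' t - gt a t) * gt a t.

End DerivativesAndNorms.

(* The last coordinate of R^(m+1) is the value, the first m are X. *)
Definition radial_graph {R : realType} (m : nat) (h : R -> R) (J : set R) :
    set 'rV[R]_(m + 1) :=
  [set row_mx X (h (enorm X))%:M | X in [set X : 'rV[R]_m | J (enorm X)]].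

(* The quantities on which the constant may depend, besides |A|; here n is the
   dimension of the ambient space. *)
Inductive family_data (R : realType) : Type :=
| DataI (n : nat) (length_I reg inf_gt lambda1 : R)
| DataII (n : nat) (length_I reg inf_gt lambda1 kappa : R)
| DataIII (n : nat) (b reg L inf_gtt lambda2 : R).

Definition data_away {R : realType} (n : nat) (A : set R) (t0 t1 : R)
    (g : R -> R -> R) : family_data R :=
  let I : set R := `[t0, t1]%classic in
  DataI n (t1 - t0) (fine (reg_norm A I g)) (inf_abs A I (dt I g))
    (inf_slope A I (dt I g)).

Definition data_elliptic {R : realType} (n : nat) (A : set R) (t0 t1 : R)
    (g : R -> R -> R) : family_data R :=
  let I : set R := `[t0, t1]%classic in
  DataII n (t1 - t0) (fine (reg_norm A I g)) (inf_abs A I (dt I g))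
    (inf_slope A I (dt I g)) (cinematic_curvature A I g).

Definition data_near {R : realType} (n : nat) (A : set R) (b L : R)
    (g : R -> R -> R) : family_data R :=
  let I : set R := `[0, b]%classic in
  DataIII n b (fine (reg_norm A I g)) L (inf_abs A I (dt I (dt I g)))
    (inf_slope A I (dt I (dt I g))).

Definition graph_cap {R : realType} (m : nat) (g : R -> R -> R) (s a : R) :
    set 'rV[R]_(m + 1) :=
  radial_graph (g a) [set r | r <= s].

Definition right_half {R : realType} (t0 t1 : R) : set R :=
  `[t1 - (t1 - t0) / 2, t1]%classic.

Definition intersection_bound {R : realType} (m : nat) (A : set R)
    (g : R -> R -> R) (b eps C0 : R) : Prop :=
  forall a a' delta, A a -> A a' -> 0 < delta < 1 ->
    (ereal_sup [set lebesgue_rV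
                  (translate (neighborhood (graph_cap g b a) delta) tau
                   `&` neighborhood (graph_cap g eps a') delta)
               | tau in [set: 'rV[R]_(m + 1)]]
     <= (C0 * (delta ^+ 2 / (delta + `|a' - a|)))%:E)%E.

(* [hypersurface_family K A Gamma d]: Gamma is of one of the three types, with
   data d.  The function K expresses that, in the third type, eps^-1 and C0 are
   bounded in terms of the data. *)
Inductive hypersurface_family (R : realType) (K : family_data R -> R) (m : nat)
    (A : set R) : (R -> set 'rV[R]_(m + 1)) -> family_data R -> Prop :=
| FamilyI (g : R -> R -> R) (t0 t1 : R) :
    (4 <= m + 1)%N -> 1 <= t0 -> t0 < t1 -> t1 <= 2 ->
    nondegenerate_away A `[t0, t1]%classic g ->
    hypersurface_family K A
      (fun a => radial_graph (g a) (right_half t0 t1))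
      (data_away (m + 1) A t0 t1 g)
| FamilyII (g : R -> R -> R) (t0 t1 : R) :
    (m + 1 = 3)%N -> 1 <= t0 -> t0 < t1 -> t1 <= 2 ->
    nondegenerate_away A `[t0, t1]%classic g ->
    elliptic_cinematic A `[t0, t1]%classic g ->
    hypersurface_family K A
      (fun a => radial_graph (g a) (right_half t0 t1))
      (data_elliptic (m + 1) A t0 t1 g)
| FamilyIII (g : R -> R -> R) (b L eps C0 : R) :
    (3 <= m + 1)%N -> 0 < b -> b <= 1 ->
    nondegenerate_near A `[0, b]%classic g L ->
    0 < eps -> eps <= b ->
    eps^-1 <= K (data_near (m + 1) A b L g) ->
    C0 <= K (data_near (m + 1) A b L g) ->
    intersection_bound m A g b eps C0 ->
    hypersurface_family K A
      (fun a => graph_cap g eps a)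
      (data_near (m + 1) A b L g).

(* Main.v *)
(** Discretise at scale [h], comparable to [delta]: choose about [1/h] equally spaced
    parameters [a], and for each of them the lattice points [X] of [h Z^m] lying over a
    small fixed piece of the translate of [Gamma a], together with the [h]-cell containing
    the height over [X].  If two parameters at distance [d] share at most
    [O (h^(1-m) / d)] cells, the Cauchy-Schwarz inequality shows that all the cells
    together number at least a multiple of [h^(-m-1) / |ln h|]; they are disjoint and
    lie in the [delta]-neighborhood of [E].

    In type (iii) the bound on shared cells is the hypothesis on intersections.  In types
    (i) and (ii) the piece is a small cube around a point of the first axis, and with
    [xi], [xi'] the two translations one counts the lattice points [X] where the gap
    [g a |X - xi| - g a' |X - xi'| + const] is at most [h].  Put [rho = max_i |xi'_i - xi_i|].
    If [rho] is small compared to [d], the gap has derivative at least [c d] along the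
    axis, because the slopes [g_t] differ by [lambda d].  If some [xi'_i - xi_i] off the
    axis is comparable to [rho], the gap has derivative at least [c rho] in the direction
    [i].  Otherwise either the radial slopes differ by [c rho], which gives a derivative
    along the axis, or they nearly agree, and then the tangential second derivatives of
    the gap are of size [rho] and of one sign.  This makes the gap strongly convex or
    concave on planes transverse to the axis when [m >= 3], and on the whole plane when
    [m = 2] by the elliptic condition.  Lattice points in a thin sublevel shell of a
    strongly convex function of two variables are counted directly, without
    logarithmic loss. *)

Require Import Defs.
From HB Require Import structures.
From mathcomp Require Import all_boot all_order all_algebra.
From mathcomp Require Import all_classical all_reals all_analysis.
From mathcomp Require Import measurable_realfun ring lra zify.
Import Order.TTheory GRing.Theory Num.Theory.
Set Implicit Arguments.
Unset Strict Implicit.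
Unset Printing Implicit Defensive.
Import numFieldNormedType.Exports.
Local Open Scope classical_set_scope.
Local Open Scope ring_scope.

(** * Counting lattice points *)

(** The logarithm of the theorem is the harmonic sum of [1 / |j - k|] over pairs of parameters, so
    no pair count may lose another one. This is delicate only for convex gaps. On the integer grid
    of side [p], a gap with second derivatives of order [rho] has convexity constant [c] of order
    [rho / p], and its shell may hold [O(p / rho)] points of a plane. Row by row this bound
    survives: a row where the gap falls to depth [mu] meets the shell in [O(1 + 1 / sqrt (c mu))]
    points, between two deep rows [u] and [w] the depth grows like [c (v - u) (w - v)], and the
    integral of [1 / sqrt (x (1 - x))] converges.

    The translations are arbitrary, so [rho] and [d] are unrelated at the outset. Once the case of
    small [rho] is settled by the slopes, [d] is at most a multiple of [rho], and all later errors
    are measured in units of [rho]. The thresholds for the slope gap and for the convexity come from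
    the data, the threshold for off-axis shifts from these, and the size [r0] of the cube is fixed
    last: on so small a cube the radial direction is almost the axis and the slope gap almost
    constant. *)

Definition update {m p : nat} (s : {ffun 'I_m -> 'I_p}) (i : 'I_m) (v : 'I_p) :
  {ffun 'I_m -> 'I_p} := [ffun k => if k == i then v else s k].

(** Exchanging coordinate [i] of [s] with [v] is an involution on the pairs [(s, v)], so every grid
    point is hit [p] times. Counts along lines can thus be averaged over all grid points, without
    splitting off a coordinate. *)
Lemma sum_update (m p : nat) (V : nmodType) (f : {ffun 'I_m -> 'I_p} -> V)
    (i : 'I_m) :
  \sum_s \sum_v f (update s i v) = (\sum_s f s) *+ p.
Proof.
rewrite pair_bigA /=.
pose swap (q : {ffun 'I_m -> 'I_p} * 'I_p) := (update q.1 i q.2, q.1 i).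
have swapK : cancel swap swap.
  move=> [s v]; rewrite /swap /=; congr (_, _).
    by apply/ffunP => k; rewrite !ffunE; case: eqP => [->|//].
  by rewrite ffunE eqxx.
rewrite (reindex_inj (can_inj swapK)) /=.
under eq_bigr => q _.
  have -> : update (update q.1 i q.2) i (q.1 i) = q.1.
    by apply/ffunP => k; rewrite !ffunE; case: eqP => [->|].
  over.
rewrite -(pair_bigA _ (fun s _ => f s)) /= -sumrMnl.
by apply: eq_bigr => s _; rewrite sumr_const card_ord.
Qed.

Lemma card_lines (R : realType) (m p : nat) (P : pred {ffun 'I_m -> 'I_p})
    (i : 'I_m) (B : R) :
  (forall s, #|[pred v | P (update s i v)]|%:R <= B) ->
  #|P|%:R * p%:R <= B * p%:R ^+ m.
Proof.
move=> HB; rewrite mulr_natr -sum1_card natr_sum big_mkcond /=.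
rewrite -(@sum_update m p R (fun s => if P s then 1 else 0) i).
apply: (@le_trans _ _ (\sum_(s : {ffun 'I_m -> 'I_p}) B)).
  apply: ler_sum => s _; apply: le_trans (HB s).
  by rewrite -sum1_card natr_sum [leRHS]big_mkcond.
by rewrite sumr_const card_ffun !card_ord -natrX mulr_natr.
Qed.

Lemma card_planes (R : realType) (m p : nat) (P : pred {ffun 'I_m -> 'I_p})
    (i j : 'I_m) (B : R) :
  (forall s, \sum_v #|[pred w | P (update (update s i v) j w)]|%:R <= B) ->
  #|P|%:R * p%:R ^+ 2 <= B * p%:R ^+ m.
Proof.
move=> HB; rewrite expr2 mulrA !mulr_natr -sum1_card natr_sum big_mkcond /=.
rewrite -(@sum_update m p R (fun s => if P s then 1 else 0) j).
rewrite -(@sum_update m p R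
  (fun s => \sum_v (if P (update s j v) then 1 else 0)) i).
apply: (@le_trans _ _ (\sum_(s : {ffun 'I_m -> 'I_p}) B)).
  apply: ler_sum => s _; apply: le_trans (HB s).
  apply: ler_sum => v _.
  by rewrite -sum1_card natr_sum [leRHS]big_mkcond.
by rewrite sumr_const card_ffun !card_ord -natrX mulr_natr.
Qed.

Lemma card_between (p u k : nat) (V : {pred 'I_p}) :
  {in V, forall v : 'I_p, (u <= v <= u + k)%N} -> (#|V| <= k.+1)%N.
Proof.
move=> HV; rewrite -(size_iota u k.+1) cardE -(size_map val).
apply: uniq_leq_size; first by rewrite map_inj_uniq ?enum_uniq //; exact: val_inj.
move=> x /mapP[v]; rewrite mem_enum => /HV /andP[h1 h2] ->.
by rewrite mem_iota h1 addnS ltnS h2.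
Qed.

Lemma card_gaps (R : realType) (p : nat) (V : {pred 'I_p}) (D : R) : 0 <= D ->
  {in V &, forall v w : 'I_p, (v <= w)%N -> w%:R - v%:R <= D} ->
  #|V|%:R <= 1 + D.
Proof.
move=> D0 HV; case: (pickP (mem V)) => [v0 Vv0|V0]; last first.
  by rewrite (eq_card0 V0) addr_ge0.
have [u /= Vu umin] := @arg_minnP _ v0 (mem V) (fun v => val v) Vv0.
have [tD1 tD2] := andP (truncn_itv D0).
have H : {in V, forall v : 'I_p, (u <= v <= u + Num.truncn D)%N}.
  move=> v Vv; have uv := umin v Vv; rewrite uv /=.
  have := HV _ _ Vu Vv uv; rewrite -natrB // -leq_subLR => H.
  by rewrite -truncn_ge_nat // in H *.
have := card_between H; rewrite -(ler_nat R) => /le_trans; apply.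
by rewrite -natr1 addrC lerD2l.
Qed.

(* Beyond the extreme elements [u], [w] of [V], either [w - u <= 2 b] or every
   element is within [b] of one of them. *)
Lemma card_triples (R : realType) (p : nat) (V : {pred 'I_p}) (b : R) : 0 <= b ->
  {in V & &, forall u v w : 'I_p, (u < v)%N -> (v < w)%N ->
    (v%:R - u%:R) * (w%:R - v%:R) <= b ^+ 2} ->
  #|V|%:R <= 2 * b + 2.
Proof.
move=> b0 HV; case: (pickP (mem V)) => [v0 Vv0|V0]; last first.
  by rewrite (eq_card0 V0); lra.
have [u /= Vu umin] := @arg_minnP _ v0 (mem V) (fun v => val v) Vv0.
have [w /= Vw wmax] := @arg_maxnP _ v0 (mem V) (fun v => val v) Vv0.
have [wu|wu] := leP (w%:R - u%:R : R) (2 * b).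
  suff : #|V|%:R <= 1 + 2 * b by lra.
  apply: card_gaps; first by lra.
  move=> x y Vx Vy xy.
  have : u%:R <= x%:R :> R by rewrite ler_nat umin.
  have : y%:R <= w%:R :> R by rewrite ler_nat; exact: wmax.
  lra.
pose V1 := [pred v in V | (v%:R - u%:R <= b :> R)].
pose V2 := [pred v in V | (w%:R - v%:R <= b :> R)].
have V12 : (#|V| <= #|V1| + #|V2|)%N.
  rewrite -cardUI; apply: (leq_trans _ (leq_addr _ _)).
  apply: subset_leq_card; apply/fintype.subsetP => v Vv; rewrite !inE.
  have uv := umin v Vv; have vw := wmax v Vv.
  have [//|vu] := leP (v%:R - u%:R : R) b; first by rewrite Vv ?orbT.
  have [//|wv] := leP (w%:R - v%:R : R) b; first by rewrite Vv ?orbT.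
  have uv' : (u < v)%N by rewrite -(ltr_nat R); lra.
  have vw' : (v < w)%N by rewrite -(ltr_nat R); lra.
  have := HV u v w Vu Vv Vw uv' vw'; nra.
have c1 : #|V1|%:R <= 1 + b.
  apply: card_gaps => // x y /andP[Vx _] /andP[_ xy] _.
  have : u%:R <= x%:R :> R by rewrite ler_nat umin.
  by move: xy => /=; lra.
have c2 : #|V2|%:R <= 1 + b.
  apply: card_gaps => // x y /andP[_ xy] /andP[Vy _] _.
  have : y%:R <= w%:R :> R by rewrite ler_nat; exact: wmax.
  by move: xy => /=; lra.
by move: V12; rewrite -(ler_nat R) natrD; lra.
Qed.

(** Convexity of the domain [Q] is part of the notion. The constant is normalised so that it
    corresponds to a second derivative of at least [2 * c]. *)
Definition strongly_convex1 (R : realType) (c : R) (Q : R -> Prop) (f : R -> R) :=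
  forall x x' t, Q x -> Q x' -> 0 <= t <= 1 ->
    Q (x + t * (x' - x)) /\
    f (x + t * (x' - x)) <=
      (1 - t) * f x + t * f x' - c * (t * (1 - t)) * (x' - x) ^+ 2.

Definition strongly_convex2 (R : realType) (c : R) (Q : R -> R -> Prop)
    (f : R -> R -> R) :=
  forall x y x' y' t, Q x y -> Q x' y' -> 0 <= t <= 1 ->
    Q (x + t * (x' - x)) (y + t * (y' - y)) /\
    f (x + t * (x' - x)) (y + t * (y' - y)) <=
      (1 - t) * f x y + t * f x' y'
      - c * (t * (1 - t)) * ((x' - x) ^+ 2 + (y' - y) ^+ 2).

(** The defining inequality at [t = (v - u) / (w - u)], cleared of denominators: at [v] the graph
    lies [c (v - u) (w - v)] below the chord. *)
Lemma strongly_convex1_triple (R : realType) (c : R) (Q : R -> Prop) (f : R -> R)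
    (u v w : R) :
  strongly_convex1 c Q f -> Q u -> Q w -> 0 <= v - u -> 0 < w - v ->
  (w - u) * f v <= (w - v) * f u + (v - u) * f w
                   - c * ((v - u) * (w - v)) * (w - u).
Proof.
move=> scf Qu Qw uv vw.
have uw : 0 < w - u by lra.
have t01 : 0 <= (v - u) / (w - u) <= 1.
  by rewrite divr_ge0 ?(ltW uw)//= ler_pdivrMr//; lra.
have [_] := scf u w _ Qu Qw t01.
have -> : u + (v - u) / (w - u) * (w - u) = v by field; lra.
have -> : (1 - (v - u) / (w - u)) * f u + (v - u) / (w - u) * f w
   - c * ((v - u) / (w - u) * (1 - (v - u) / (w - u))) * (w - u) ^+ 2
  = ((w - v) * f u + (v - u) * f w - c * ((v - u) * (w - v)) * (w - u)) / (w - u).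
  by field; lra.
by rewrite ler_pdivlMr// mulrC.
Qed.

Section RowCounts.
Context {R : realType} (p : nat) (c : R) (Q : R -> Prop) (f : R -> R).
Hypotheses (c0 : 0 < c) (scf : strongly_convex1 c Q f).

Let V := [pred v : 'I_p | `[< Q v%:R /\ `|f v%:R| <= 1 >]].

(** For three points of the shell the chord is at most 1 and [f v] at least -1, so
    [c (v - u) (w - v)] is at most 2. *)
Lemma row_count : #|V|%:R <= 2 * Num.sqrt (2 / c) + 2.
Proof.
have c20 : 0 <= 2 / c by rewrite divr_ge0// ltW.
apply: card_triples; first exact: sqrtr_ge0.
move=> u v w /asboolP[Qu fu] /asboolP[Qv fv] /asboolP[Qw fw].
move=> uv' vw'; have uv : u%:R < v%:R :> R by rewrite ltr_nat.
have vw : v%:R < w%:R :> R by rewrite ltr_nat.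
rewrite sqr_sqrtr// ler_pdivlMr//.
have := strongly_convex1_triple scf Qu Qw (v := v%:R).
move=> /(_ ltac:(lra) ltac:(lra)).
move: fu fv fw; rewrite !ler_norml => /andP[_ fu] /andP[fv _] /andP[_ fw] H.
set a := v%:R - u%:R in H *; set b := w%:R - v%:R in H *.
have ab : w%:R - u%:R = a + b :> R by rewrite /a/b; ring.
have a0 : 0 < a by rewrite /a; lra.
have b0 : 0 < b by rewrite /b; lra.
rewrite {}ab in H.
have H1 : b * f u%:R + a * f w%:R <= b + a by nra.
have H2 : - (a + b) <= (a + b) * f v%:R by nra.
have : c * (a * b) * (a + b) <= 2 * (a + b) by lra.
by rewrite ler_pM2r; [lra|lra].
Qed.

(* [f] drops by [mu] between [V] and [z]; convexity makes the slope of [f] at a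
   distance [a] from [z] at least [mu / a], strong convexity at least [c a]. *)
Lemma row_count_deep (z mu : R) : Q z -> 2 <= mu -> f z <= - mu ->
  #|V|%:R <= 2 + 2 * Num.sqrt (2 / (c * mu)).
Proof.
move=> Qz mu2 fz.
have cmu : 0 < c * mu by rewrite mulr_gt0//; lra.
(* Two shell points on the same side of [z]: [a] is the distance from [z] to the nearer one, [b] the
   gap between them, [x] and [y] the values of [f] at the nearer and the farther one. *)
have key (a b x y : R) : 0 < a -> 0 < b -> -1 <= x -> y <= 1 ->
    (a + b) * x <= b * f z + a * y - c * (a * b) * (a + b) ->
    b <= Num.sqrt (2 / (c * mu)).
  move=> a0 b0 x1 y1 H.
  set q := Num.sqrt _.
  have q0 : 0 < q by rewrite sqrtr_gt0 divr_gt0.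
  have qq : c * mu * q ^+ 2 = 2.
    by rewrite sqr_sqrtr ?divr_ge0 ?ltW//; field; rewrite !gt_eqF//; nra.
  have h1 : b * (mu / 2 + c * a ^+ 2) <= 2 * a.
    have : b * (mu / 2) <= b * (x - f z) by rewrite ler_pM2l//; lra.
    have : a * (y - x) <= a * 2 by rewrite ler_pM2l//; lra.
    have : 0 <= c * a * b ^+ 2 by rewrite !mulr_ge0 ?sqr_ge0 ?ltW.
    by rewrite !mulrDr; lra.
  (* Arithmetic-geometric mean inequality; [q] is normalised so that the product on the right is
     [1 + (c a q) ^ 2]. *)
  have h2 : 2 * (c * a * q) <= (mu / 2 + c * a ^+ 2) * (c * q ^+ 2).
    have -> : (mu / 2 + c * a ^+ 2) * (c * q ^+ 2)
      = c * mu * q ^+ 2 / 2 + (c * a * q) ^+ 2 by field.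
    by rewrite qq; have := sqr_ge0 (c * a * q - 1); lra.
  have cq : 0 < c * q by rewrite mulr_gt0.
  have h3 : b * (2 * (c * a * q)) <= 2 * a * (c * q ^+ 2).
    apply: (@le_trans _ _ (b * ((mu / 2 + c * a ^+ 2) * (c * q ^+ 2)))).
      by rewrite ler_pM2l.
    by rewrite mulrA ler_pM2r// mulr_gt0// exprn_gt0.
  have caq : 0 < 2 * (c * a * q) by rewrite !mulr_gt0.
  by rewrite -(ler_pM2r caq); lra.
pose V1 := [pred v in V | z < (v : 'I_p)%:R].
pose V2 := [pred v in V | (v : 'I_p)%:R < z].
have s0 := sqrtr_ge0 (2 / (c * mu)).
have V12 : (#|V| <= #|V1| + #|V2|)%N.
  rewrite -cardUI; apply: (leq_trans _ (leq_addr _ _)).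
  apply: subset_leq_card; apply/fintype.subsetP => v Vv; apply/orP.
  have /asboolP[_ fv] := Vv.
  case: (ltgtP z v%:R) => vz; [left|right|]; try by apply/andP; split.
  by move: fv; rewrite -vz ler_norml; lra.
have c1 : #|V1|%:R <= 1 + Num.sqrt (2 / (c * mu)).
  apply: card_gaps => // v w /andP[/asboolP[Qv fv] zv].
  move=> /andP[/asboolP[Qw fw] zw] ; rewrite leq_eqVlt => /orP[/eqP->|].
    by rewrite subrr.
  rewrite -(ltr_nat R) => vw.
  have := strongly_convex1_triple scf Qz Qw (v := v%:R).
  move=> /(_ ltac:(lra) ltac:(lra)) H.
  move: fv fw; rewrite !ler_norml => /andP[fv _] /andP[_ fw].
  apply: (key (v%:R - z) _ (f v%:R) (f w%:R)); try lra.
have c2 : #|V2|%:R <= 1 + Num.sqrt (2 / (c * mu)).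
  apply: card_gaps => // v w /andP[/asboolP[Qv fv] zv].
  move=> /andP[/asboolP[Qw fw] zw] ; rewrite leq_eqVlt => /orP[/eqP->|].
    by rewrite subrr.
  rewrite -(ltr_nat R) => vw.
  have := strongly_convex1_triple scf Qv Qz (v := w%:R).
  move=> /(_ ltac:(lra) ltac:(lra)) H.
  move: fv fw; rewrite !ler_norml => /andP[_ fv] /andP[fw _].
  apply: (key (z - w%:R) _ (f w%:R) (f v%:R)); try lra.
by move: V12; rewrite -(ler_nat R) natrD; lra.
Qed.

End RowCounts.

Lemma sum_inv_sqrt (R : realType) (n : nat) :
  \sum_(0 <= k < n) (Num.sqrt (k.+1%:R : R))^-1 <= 2 * Num.sqrt n%:R.
Proof.
elim: n => [|n IH]; first by rewrite big_nil mulr_ge0.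
rewrite big_nat_recr//=.
set s := Num.sqrt n%:R in IH *; set t := Num.sqrt _.
have t0 : 0 < t by rewrite sqrtr_gt0.
have s0 : 0 <= s by rewrite sqrtr_ge0.
have tt : t ^+ 2 = s ^+ 2 + 1 by rewrite !sqr_sqrtr// natr1.
suff : t^-1 <= 2 * t - 2 * s by lra.
by rewrite -div1r ler_pdivrMr//; nra.
Qed.

(** A discrete form of the integral of [1 / sqrt (x (1 - x))], bounded uniformly in [n]. With
    [x ^ 2 + y ^ 2 = s ^ 2] one has [s <= x + y], so [1 / (x y)] is at most a multiple of
    [(1 / x + 1 / y) / s], and each of the two resulting sums is at most [2 s]. *)
Lemma sum_inv_sqrt_sym (R : realType) (n : nat) :
  \sum_(0 <= k < n) (Num.sqrt (k.+1%:R * (n - k)%:R : R))^-1 <= 6.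
Proof.
case: n => [|n]; first by rewrite big_nil.
set s : R := Num.sqrt n.+2%:R.
have s0 : 0 < s by rewrite sqrtr_gt0.
have ss : s ^+ 2 = n.+2%:R by rewrite sqr_sqrtr.
apply: (@le_trans _ _ (\sum_(0 <= k < n.+1)
   ((3 / 2 / s) * ((Num.sqrt (k.+1%:R : R))^-1 + (Num.sqrt (n.+1 - k)%:R)^-1)))).
  apply: ler_sum_nat => k /andP[_ kn].
  rewrite sqrtrM//; set x := Num.sqrt _; set y := Num.sqrt _.
  have x0 : 0 < x by rewrite sqrtr_gt0.
  have y0 : 0 < y by rewrite sqrtr_gt0 ltr0n subn_gt0.
  have xy : s ^+ 2 = x ^+ 2 + y ^+ 2.
    by rewrite !sqr_sqrtr// -natrD; congr _%:R; lia.
  have sxy : s <= x + y by nra.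
  have -> : (x * y)^-1 = (3 / 2 / s * (x^-1 + y^-1)) * ((2 * s) / (3 * (x + y))).
    by field; rewrite !gt_eqF// addr_gt0.
  apply: ler_piMr; last by rewrite ler_pdivrMr; lra.
  by rewrite ltW// !mulr_gt0 ?addr_gt0 ?invr_gt0.
rewrite -mulr_sumr big_split/=.
rewrite [X in _ + X](_ : _ = \sum_(0 <= k < n.+1) (Num.sqrt (k.+1%:R : R))^-1).
  have := @sum_inv_sqrt R n.+1; set S := \sum_(_ <= _ < _) _ => HS.
  set r := Num.sqrt n.+1%:R in HS.
  have rs : r <= s by rewrite ler_sqrt// ler_nat.
  have SS : S + S <= 4 * s by lra.
  apply: (@le_trans _ _ (3 / 2 / s * (4 * s))); last first.
    by rewrite le_eqVlt; apply/orP; left; apply/eqP; field; rewrite gt_eqF.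
  by apply: ler_wpM2l => //; rewrite ltW// !mulr_gt0 ?invr_gt0.
rewrite big_nat_rev/=; apply: eq_big_nat => k /andP[_ kn].
by rewrite add0n; congr (Num.sqrt _%:R)^-1; lia.
Qed.

Lemma sum_inv_sqrt_between (R : realType) (p : nat) (u w : 'I_p) :
  \sum_(v < p | (u < v < w)%N) (Num.sqrt ((v%:R - u%:R) * (w%:R - v%:R) : R))^-1
    <= 6.
Proof.
have [uw|wu] := ltnP u w; last first.
  by rewrite big_pred0// => v; apply/negP => /andP[]; lia.
rewrite -(big_mkord (fun v : nat => (u < v < w)%N)
  (fun v => (Num.sqrt ((v%:R - u%:R) * (w%:R - v%:R) : R))^-1)).
have -> : \sum_(0 <= v < p | (u < v < w)%N)
     (Num.sqrt ((v%:R - u%:R) * (w%:R - v%:R) : R))^-1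
  = \sum_(u.+1 <= v < w) (Num.sqrt ((v%:R - u%:R) * (w%:R - v%:R) : R))^-1.
  rewrite (@big_cat_nat _ _ _ u.+1)//= ?(leq_ltn_trans (leq0n u) (ltn_ord _))//.
  rewrite (@big_cat_nat _ _ _ w u.+1 p)//= ?(ltnW (ltn_ord w))//.
  rewrite [X in X + _]big1_seq ?add0r; last first.
    by move=> i; rewrite mem_index_iota => /andP[/andP[]]; lia.
  rewrite [X in _ + X]big1_seq ?addr0; last first.
    by move=> i; rewrite mem_index_iota => /andP[/andP[]]; lia.
  rewrite big_nat_cond [RHS]big_nat_cond; apply: eq_bigl => i.
  by case: (ltnP u i); case: (ltnP i w).
rewrite -{1}[u.+1]add0n big_addn.
apply: le_trans (@sum_inv_sqrt_sym R (w - u.+1)).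
rewrite le_eqVlt; apply/orP; left; apply/eqP; apply: eq_big_nat => k /andP[_ kn].
rewrite -!natrB; [|lia|lia].
by congr (Num.sqrt (_%:R * _%:R))^-1; lia.
Qed.

(** The point of row [v] is taken on the segment joining the two given points, whose squared length
    is at least [(w - u) ^ 2]. *)
Lemma strongly_convex2_triple (R : realType) (c : R) (Q : R -> R -> Prop)
    (f : R -> R -> R) (u v w y1 y2 M : R) :
  0 <= c -> strongly_convex2 c Q f -> u < v -> v < w ->
  Q u y1 -> f u y1 <= M -> Q w y2 -> f w y2 <= M ->
  exists2 y, Q v y & f v y <= M - c * ((v - u) * (w - v)).
Proof.
move=> c0 scf uv vw Q1 f1 Q2 f2.
set a := v - u; set b := w - v.
have a0 : 0 < a by rewrite /a; lra.
have b0 : 0 < b by rewrite /b; lra.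
have ab : w - u = a + b by rewrite /a /b; ring.
have [t0 t1] : 0 <= a / (a + b) /\ 0 <= 1 - a / (a + b).
  split; first by rewrite divr_ge0//; lra.
  by rewrite subr_ge0 ler_pdivrMr; lra.
have t01 : 0 <= a / (a + b) <= 1 by rewrite t0 -subr_ge0.
have [] := scf _ _ _ _ _ Q1 Q2 t01.
have -> : u + a / (a + b) * (w - u) = v by rewrite ab /a; field; lra.
set y := _ + _ * (_ - _) => Qy fy; exists y => //; apply: (le_trans fy).
have tt : c * (a / (a + b) * (1 - a / (a + b))) * ((w - u) ^+ 2 + (y2 - y1) ^+ 2)
    >= c * (a * b).
  have -> : c * (a * b)
      = c * (a / (a + b) * (1 - a / (a + b))) * ((w - u) ^+ 2).
    by rewrite ab; field; lra.
  rewrite ler_wpM2l ?lerDl ?sqr_ge0//.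
  by apply: mulr_ge0 => //; apply: mulr_ge0.
move: tt t0 t1; set t := a / (a + b) => tt t0 t1.
have : (1 - t) * f u y1 <= (1 - t) * M by rewrite ler_wpM2l.
have : t * f w y2 <= t * M by rewrite ler_wpM2l.
lra.
Qed.

Section ConvexCount.
Context {R : realType} (p : nat) (c : R) (Q : R -> R -> Prop) (f : R -> R -> R).
Hypotheses (c0 : 0 < c) (scf : strongly_convex2 c Q f).

Let row (v : 'I_p) :=
  [pred w : 'I_p | `[< Q v%:R w%:R /\ `|f v%:R w%:R| <= 1 >]].
(** Depth is tested at real [y], because a segment between two rows crosses an intermediate row off
    the grid. The level -2 leaves a margin of 1 below the shell. *)
Let deep := [pred v : 'I_p | `[< exists y, Q v%:R y /\ f v%:R y <= - 2 >]].
Let shallow := [pred v : 'I_p | (v \notin deep) && (#|row v| != 0%N)].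
Let A := 2 * Num.sqrt (2 / c) + 2.

Let strongly_convex_row (x : R) : strongly_convex1 c (Q x) (f x).
Proof.
move=> y y' t Qy Qy' t01; have := scf Qy Qy' t01.
by rewrite !subrr !mulr0 !addr0 expr0n add0r.
Qed.

Let rowA (v : 'I_p) : #|row v|%:R <= A.
Proof. exact: (@row_count R p c (Q v%:R) (f v%:R) c0 (@strongly_convex_row _)). Qed.

(** If [(v - u) (w - v) >= 3 / c] for rows [u], [w] that meet the shell, then row [v] carries a
    value at most [1 - 3 = -2], so it is deep. *)
Let card_shallow : #|shallow|%:R <= 2 * Num.sqrt (3 / c) + 2.
Proof.
apply: card_triples; first exact: sqrtr_ge0.
move=> u v w /andP[_ ru] /andP[dv _] /andP[_ rw] uv' vw'.
have uv : u%:R < v%:R :> R by rewrite ltr_nat.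
have vw : v%:R < w%:R :> R by rewrite ltr_nat.
rewrite sqr_sqrtr; last by rewrite divr_ge0// ltW.
apply: ltW.
have [y1 /asboolP[Q1 f1]] : exists y, y \in row u.
  by apply/card_gt0P; rewrite lt0n.
have [y2 /asboolP[Q2 f2]] : exists y, y \in row w.
  by apply/card_gt0P; rewrite lt0n.
have [f1' f2'] : f u%:R y1%:R <= 1 /\ f w%:R y2%:R <= 1.
  by move: f1 f2; rewrite !ler_norml => /andP[_ ?] /andP[_ ?].
have [y Qy fy] := strongly_convex2_triple (ltW c0) scf uv vw Q1 f1' Q2 f2'.
rewrite ltr_pdivlMr//; apply/contraT; rewrite -leNgt => h.
by case/negP: dv; apply/asboolP; exists y; split => //; lra.
Qed.

(** Between the extreme deep rows [u] and [w] the depth is at least [2 + c (v - u) (w - v)], which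
    bounds a row by 2 plus a multiple of [1 / sqrt ((v - u) (w - v))]. The rows [u] and [w]
    themselves get the general bound [A]. *)
Let sum_deep :
  \sum_(v | v \in deep) #|row v|%:R <= 2 * A + 2 * p%:R + 18 / c.
Proof.
have c1 : 0 <= 18 / c by rewrite divr_ge0// ltW.
have A0 : 0 <= A by rewrite addr_ge0// mulr_ge0// sqrtr_ge0.
case: (pickP (mem deep)) => [v0 Dv0|D0]; last first.
  rewrite big_pred0; last by move=> v; exact: D0.
  by rewrite !addr_ge0// mulr_ge0.
have [u /= Du umin] := @arg_minnP _ v0 (mem deep) (fun v => val v) Dv0.
have [w /= Dw wmax] := @arg_maxnP _ v0 (mem deep) (fun v => val v) Dv0.
pose B (v : 'I_p) : R :=
  2 + 3 / c * (Num.sqrt ((v%:R - u%:R) * (w%:R - v%:R)))^-1.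
have rowB (v : 'I_p) : (u < v < w)%N -> #|row v|%:R <= B v.
  move=> /andP[uv' vw'].
  have uv : u%:R < v%:R :> R by rewrite ltr_nat.
  have vw : v%:R < w%:R :> R by rewrite ltr_nat.
  move: Du Dw => /asboolP[y1 [Q1 f1]] /asboolP[y2 [Q2 f2]].
  rewrite /B.
  set a := v%:R - u%:R : R; set b := w%:R - v%:R : R.
  have a0 : 0 < a by rewrite /a; lra.
  have b0 : 0 < b by rewrite /b; lra.
  have [y Qy] := strongly_convex2_triple (ltW c0) scf uv vw Q1 f1 Q2 f2.
  rewrite -/a -/b -opprD => fy.
  have cab : 0 < c * (a * b) by rewrite !mulr_gt0.
  have mu2 : 2 <= 2 + c * (a * b) by lra.
  apply: le_trans (@row_count_deep R p c _ _ c0 (@strongly_convex_row _) _ _ Qy mu2 fy) _.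
  rewrite lerD2l.
  have s0 : 0 < Num.sqrt (a * b) by rewrite sqrtr_gt0 mulr_gt0.
  have -> : 3 / c * (Num.sqrt (a * b))^-1
      = 2 * (3 / 2 / c / Num.sqrt (a * b)).
    by field; rewrite !gt_eqF.
  rewrite ler_pM2l//.
  have q0 : 0 <= 3 / 2 / c / Num.sqrt (a * b).
    by rewrite !mulr_ge0 ?invr_ge0 ?ltW.
  rewrite -[leRHS]ger0_norm// -sqrtr_sqr ler_wsqrtr//.
  rewrite expr_div_n sqr_sqrtr ?mulr_ge0 ?ltW//.
  have -> : (3 / 2 / c) ^+ 2 / (a * b) = (9 / 4) / (c * (c * (a * b))).
    by field; rewrite !gt_eqF.
  set X := c * (a * b) in cab *.
  have cX : 0 < c * X by rewrite mulr_gt0.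
  rewrite ltr_pdivlMr// (_ : 2 / _ * _ = 2 * (X / (2 + X))); last first.
    by field; rewrite !gt_eqF//; lra.
  have : X / (2 + X) < 1 by rewrite ltr_pdivrMr; lra.
  lra.
have split_deep (v : 'I_p) : v \in deep -> #|row v|%:R <=
    (if (v == u) || (v == w) then A else 0) + (if (u < v < w)%N then B v else 0).
  move=> Dv; have uv := umin v Dv; have vw : (v <= w)%N := wmax v Dv.
  case: (altP (v =P u)) => [->|vu] /=; first by rewrite ltnn addr0.
  case: (altP (v =P w)) => [->|vw'] /=; first by rewrite ltnn andbF addr0.
  rewrite add0r ifT; first by apply: rowB; rewrite !ltn_neqAle uv vw vw' eq_sym vu.
  by rewrite !ltn_neqAle uv vw vw' eq_sym vu.
apply: le_trans (ler_sum _ split_deep) _.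
have B0 (v : 'I_p) : 0 <= (if (u < v < w)%N then B v else 0).
  by case: ifP => // uv; apply: le_trans (rowB v uv).
have A0' (v : 'I_p) : 0 <= (if (v == u) || (v == w) then A else 0).
  by case: ifP.
apply: (@le_trans _ _ (\sum_(v : 'I_p) ((if (v == u) || (v == w) then A else 0)
     + (if (u < v < w)%N then B v else 0)))).
  by rewrite [leLHS]big_mkcond; apply: ler_sum => v _; case: ifP => // _; rewrite addr_ge0.
rewrite big_split/= -addrA lerD//.
  rewrite -big_mkcond/= sumr_const -[leLHS]mulr_natl ler_wpM2r// ler_nat.
  have := cardUI (pred1 u) (pred1 w); rewrite !card1 => UI.
  by rewrite (_ : 2%N = 1 + 1)%N// -UI leq_addr.
rewrite -big_mkcond/= big_split/= lerD//.
  rewrite sumr_const -[leLHS]mulr_natr ler_pM2l// ler_nat.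
  by rewrite -[leqRHS]card_ord max_card.
rewrite -mulr_sumr (_ : 18 / c = 3 / c * 6); last by field; rewrite gt_eqF.
by rewrite ler_pM2l ?divr_gt0//; exact: sum_inv_sqrt_between.
Qed.

(** The shallow rows contribute a product of two factors of order [1 + 1 / sqrt c], the number of
    rows and the size of a row; with the deep rows this stays linear in [p] and in [1 / c]. *)
Lemma convex_count :
  \sum_(v < p) #|[pred w : 'I_p | `[< Q v%:R w%:R /\ `|f v%:R w%:R| <= 1 >]]|%:R
    <= 2 * p%:R + 40 / c + 18.
Proof.
rewrite (bigID (mem deep))/=.
apply: (@le_trans _ _ ((2 * A + 2 * p%:R + 18 / c)
                       + (2 * Num.sqrt (3 / c) + 2) * A)).
  apply: lerD; first exact: sum_deep.
  apply: (@le_trans _ _ (\sum_(v | v \in shallow) A)).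
    rewrite big_mkcond [leRHS]big_mkcond; apply: ler_sum => v _.
    case: (boolP (v \in deep)) => dv /=.
      by case: ifP => // _; rewrite addr_ge0// mulr_ge0// sqrtr_ge0.
    rewrite unfold_in /= dv /=.
    by case: (#|row v| =P 0%N) => [->//|_]; exact: rowA.
  rewrite sumr_const -[leLHS]mulr_natl ler_wpM2r//.
  by rewrite addr_ge0// mulr_ge0// sqrtr_ge0.
rewrite /A; set x := Num.sqrt (2 / c); set y := Num.sqrt (3 / c).
have ci : 0 <= c^-1 by rewrite invr_ge0 ltW.
have x0 : 0 <= x by exact: sqrtr_ge0.
have y0 : 0 <= y by exact: sqrtr_ge0.
have xx : x ^+ 2 = 2 * c^-1 by rewrite sqr_sqrtr// mulr_ge0.
have yy : y ^+ 2 = 3 * c^-1 by rewrite sqr_sqrtr// mulr_ge0.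
have := sqr_ge0 (x - 1); have := sqr_ge0 (y - 2); have := sqr_ge0 (x - y).
lra.
Qed.

End ConvexCount.

(** * Cauchy-Schwarz and harmonic sums *)

Lemma sum_codom (R : realType) (T : eqType) (S : finType) (phi : S -> T)
    (U : seq T) (g : T -> R) :
  injective phi -> uniq U -> (forall s, phi s \in U) ->
  \sum_(u <- U) (u \in codom phi)%:R * g u = \sum_s g (phi s).
Proof.
move=> phi_inj Uuniq phiU.
rewrite -(big_enum _ _ predT)/= -(big_map phi predT g).
under eq_bigr do rewrite mulr_natl mulrb.
rewrite -big_mkcond/= -big_filter; apply: perm_big; apply: uniq_perm.
- exact: filter_uniq.
- by rewrite map_inj_uniq// enum_uniq.
move=> u; rewrite mem_filter -/(codom phi).
by case: codomP => [[s ->]|]//=; rewrite phiU.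
Qed.

Lemma cauchy_schwarz_seq (R : realType) (T : Type) (U : seq T) (n : T -> R) :
  (\sum_(u <- U) n u) ^+ 2 <= (size U)%:R * \sum_(u <- U) n u ^+ 2.
Proof.
set a := \sum_(u <- U) n u; set b := \sum_(u <- U) n u ^+ 2.
set N : R := (size U)%:R.
case: (posnP (size U)) => [/size0nil U0|U0].
  by rewrite /a /b /N U0 !big_nil expr0n mul0r.
have N0 : 0 < N by rewrite ltr0n.
have : 0 <= \sum_(u <- U) (N * n u - a) ^+ 2.
  by apply: sumr_ge0 => u _; exact: sqr_ge0.
have -> : \sum_(u <- U) (N * n u - a) ^+ 2 = N * (N * b - a ^+ 2).
  transitivity (\sum_(u <- U) (N ^+ 2 * n u ^+ 2 + (- (2 * N * a) * n u + a ^+ 2))).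
    by apply: eq_bigr => u _; ring.
  rewrite !big_split/= -!mulr_sumr -/a -/b big_const_seq count_predT iter_addr_0.
  by rewrite -mulr_natr -/N; ring.
by rewrite pmulr_rge0// subr_ge0.
Qed.

(** Cauchy-Schwarz for the multiplicity [n u], the number of indices [j] whose image contains [u].
    Its sum is [#|J| * #|S|], and the sum of its squares counts coincidences between pairs of
    images. *)
Lemma cauchy_schwarz_union (R : realType) (T : eqType) (J S : finType)
    (phi : J -> S -> T) :
  (forall j, injective (phi j)) ->
  exists U : seq T, [/\ uniq U, (forall u, u \in U -> exists j s, u = phi j s) &
    (#|J|%:R * #|S|%:R) ^+ 2 <= (size U)%:R *
      \sum_j \sum_k #|[pred s | phi j s \in codom (phi k)]|%:R :> R].
Proof.
move=> phi_inj.
pose U := undup [seq phi q.1 q.2 | q <- enum {: J * S}].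
have phiU j s : phi j s \in U.
  by rewrite mem_undup; apply/mapP; exists (j, s); rewrite ?mem_enum.
exists U; split; first exact: undup_uniq.
  by move=> u; rewrite mem_undup => /mapP[[j s] _ ->]; exists j, s.
pose n u : R := \sum_j (u \in codom (phi j))%:R.
have -> : #|J|%:R * #|S|%:R = \sum_(u <- U) n u.
  rewrite exchange_big/= (eq_bigr (fun _ => #|S|%:R)).
    by rewrite sumr_const -[RHS]mulr_natl.
  move=> j _; rewrite -(eq_bigr _ (fun u _ => mulr1 (u \in codom (phi j))%:R)).
  by rewrite sum_codom ?undup_uniq// sumr_const.
apply: le_trans (cauchy_schwarz_seq U n) _.
rewrite le_eqVlt; apply/orP; left; apply/eqP; congr (_ * _).
under eq_bigr do rewrite expr2 {1}/n mulr_suml.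
rewrite exchange_big/=; apply: eq_bigr => j _.
rewrite sum_codom ?undup_uniq// /n exchange_big/=; apply: eq_bigr => k _.
rewrite -sum1_card natr_sum [RHS]big_mkcond/=; apply: eq_bigr => s _.
by rewrite inE; case: (_ \in codom _).
Qed.

Lemma harmonic_le_ln (R : realType) (p : nat) : (0 < p)%N ->
  \sum_(0 <= k < p) (k.+1%:R : R)^-1 <= 1 + ln p%:R.
Proof.
elim: p => // -[_ _|p IH _]; first by rewrite big_nat1 invr1 ln1 addr0.
rewrite big_nat_recr//=; have {}IH := IH isT.
suff H : (p.+2%:R : R)^-1 <= ln p.+2%:R - ln p.+1%:R.
  by apply: le_trans (lerD IH (lexx _)) _; rewrite -addrA lerD2l -lerBrDl.
have p1 : 0 < p.+1%:R :> R by [].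
have p2 : 0 < p.+2%:R :> R by [].
have : ln (1 + - (p.+2%:R : R)^-1) <= - p.+2%:R^-1.
  by apply: le_ln1Dx; rewrite ltrN2 invf_lt1// ltr1n.
have -> : 1 + - (p.+2%:R : R)^-1 = p.+1%:R / p.+2%:R.
  rewrite -[X in X / _](addrK 1) natr1 mulrBl divff ?gt_eqF//; ring.
by rewrite lnM ?posrE ?invr_gt0// lnV ?posrE// -lerN2 opprB opprK.
Qed.

(** For fixed [j] the inner sum consists of two harmonic sums, one on each side of [j]. *)
Lemma sum_inv_dist (R : realType) (p : nat) : (0 < p)%N ->
  \sum_(j < p) \sum_(k < p | k != j) `|j%:R - k%:R : R|^-1
    <= 2 * p%:R * (1 + ln p%:R).
Proof.
move=> p0; set H := 1 + ln p%:R.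
have HpR : \sum_(0 <= k < p) (k.+1%:R : R)^-1 <= H by exact: harmonic_le_ln.
have Hle n : (n <= p)%N -> \sum_(0 <= k < n) (k.+1%:R : R)^-1 <= H.
  move=> np; apply: le_trans HpR; rewrite (@big_cat_nat _ _ _ n 0 p)//= lerDl.
  by apply: sumr_ge0 => i _; rewrite invr_ge0.
have rowH (j : 'I_p) : \sum_(k < p | k != j) `|j%:R - k%:R : R|^-1 <= 2 * H.
  rewrite -(big_mkord (fun k : nat => k != j) (fun k => `|j%:R - k%:R : R|^-1)).
  rewrite (@big_cat_nat _ _ _ j)//=; last exact: ltnW.
  rewrite [X in _ + X]big_mkcond (@big_ltn _ _ _ j)//= eqxx add0r -big_mkcond/=.
  have -> : \sum_(0 <= k < j | k != j) `|j%:R - k%:R : R|^-1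
      = \sum_(0 <= k < j) (k.+1%:R : R)^-1.
    rewrite [RHS]big_nat_rev/= big_mkcond; apply: eq_big_nat => k /andP[_ kj].
    rewrite (ltn_eqF kj)/= -natrB ?(ltnW kj)// normr_nat add0n.
    by congr (_%:R)^-1; lia.
  have -> : \sum_(j.+1 <= k < p | k != j) `|j%:R - k%:R : R|^-1
      = \sum_(0 <= k < p - j.+1) (k.+1%:R : R)^-1.
    rewrite -{1}[j.+1]add0n big_addn/= big_mkcond; apply: eq_big_nat => k _.
    rewrite gtn_eqF/=; last by lia.
    rewrite distrC -natrB; last by lia.
    by rewrite normr_nat; congr (_%:R)^-1; lia.
  have := Hle j (ltnW (ltn_ord j)); have := Hle (p - j.+1)%N (leq_subr _ _).
  lra.
apply: (le_trans (ler_sum _ (fun j _ => rowH j))).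
by rewrite sumr_const card_ord -[leLHS]mulr_natl; lra.
Qed.

(** * Lower bound for the Lebesgue measure of a union of cells *)

(** Half-open, so that cells with distinct indices are disjoint. *)
Definition cell {R : realType} {n : nat} (v : 'rV[R]_n) (h : R)
    (u : 'rV[int]_n) : set 'rV[R]_n :=
  [set x | forall i, v 0 i + h * (u 0 i)%:~R <= x 0 i
                       < v 0 i + h * (u 0 i)%:~R + h].

Section IteratedIntegral.
Context {R : realType} {n : nat}.
Local Notation mu := (@lebesgue_measure R).

(* Coordinates below [j] already integrated. *)
Let slice (w : 'I_n -> R) (F : 'I_n -> set R) (j : nat) (x : 'I_n -> R) : R :=
  \prod_(i < n) (if (i < j)%N then w i else \1_(F i) (x i)).

Let put (x : 'I_n -> R) (j : 'I_n) (t : R) : 'I_n -> R :=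
  fun i => if i == j then t else x i.

Let rest (w : 'I_n -> R) (F : 'I_n -> set R) (j : 'I_n) (x : 'I_n -> R) : R :=
  \prod_(i < n | i != j) (if (i < j)%N then w i else \1_(F i) (x i)).

Let slice_put w F (j : 'I_n) x t :
  slice w F j (put x j t) = rest w F j x * \1_(F j) t.
Proof.
rewrite /slice (bigD1 j)//= ltnn /put eqxx mulrC; congr (_ * _).
by apply: eq_bigr => i ij; rewrite (negbTE ij).
Qed.

Let sliceS w F (j : 'I_n) x : slice w F j.+1 x = rest w F j x * w j.
Proof.
rewrite /slice (bigD1 j)//= ltnS leqnn mulrC; congr (_ * _).
apply: eq_bigr => i ij; rewrite ltnS leq_eqVlt.
by rewrite (_ : (i == j :> nat) = false)//; exact/negbTE.
Qed.

Let rest_ge0 w F (j : 'I_n) x : (forall i, 0 <= w i) -> 0 <= rest w F j x.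
Proof. by move=> w0; apply: prodr_ge0 => i _; case: ifP. Qed.

Let slice_ge0 w F (j : nat) x : (forall i, 0 <= w i) -> 0 <= slice w F j x.
Proof. by move=> w0; apply: prodr_ge0 => i _; case: ifP. Qed.

Let measurable_slice (w : 'I_n -> R) (F : 'I_n -> set R) (j : 'I_n) x :
  (forall i, measurable (F i)) ->
  measurable_fun setT (EFin \o (fun t => slice w F j (put x j t))).
Proof.
move=> mF; rewrite (_ : (fun t => _) = (fun t => rest w F j x * \1_(F j) t)); last first.
  by apply/funext => t; exact: slice_put.
by apply/measurable_EFinP; exact: measurable_funM.
Qed.

Let integral_slice (w : 'I_n -> R) (F : 'I_n -> set R) (j : 'I_n) x : (forall i, 0 <= w i) ->
  (forall i, measurable (F i)) -> (forall i, mu (F i) = (w i)%:E) ->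
  (\int[mu]_t (slice w F j (put x j t))%:E = (slice w F j.+1 x)%:E)%E.
Proof.
move=> w0 mF muF; under eq_integral do rewrite slice_put EFinM.
rewrite ge0_integralZl_EFin//; last 2 first.
- by apply/measurable_EFinP; apply: measurable_indic; exact: mF.
- exact: rest_ge0.
rewrite integral_indic; [|by []|exact: mF].
by rewrite sliceS EFinM setIT; congr (_ * _)%E; exact: muF.
Qed.

(** The pointwise inequality is integrated one coordinate at a time; integrating coordinate [j]
    replaces its indicator by the length of the interval. Each step only exchanges a one-dimensional
    integral with a finite sum or a series of nonnegative functions. *)
Lemma le_sum_prod_of_indic (T : Type) (U : seq T)
    (F : T -> 'I_n -> set R) (wF : T -> 'I_n -> R)
    (G : nat -> 'I_n -> set R) (wG : nat -> 'I_n -> R) :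
  (forall u i, 0 <= wF u i) -> (forall k i, 0 <= wG k i) ->
  (forall u i, measurable (F u i)) -> (forall k i, measurable (G k i)) ->
  (forall u i, mu (F u i) = (wF u i)%:E) ->
  (forall k i, mu (G k i) = (wG k i)%:E) ->
  (forall x : 'I_n -> R, (\sum_(u <- U) (\prod_i (\1_(F u i) (x i) : R))%:E <=
     \sum_(k <oo) (\prod_i (\1_(G k i) (x i) : R))%:E)%E) ->
  (\sum_(u <- U) (\prod_i wF u i)%:E <= \sum_(k <oo) (\prod_i wG k i)%:E)%E.
Proof.
move=> wF0 wG0 mF mG muF muG FG.
have step j : (j <= n)%N -> forall x, (\sum_(u <- U) (slice (wF u) (F u) j x)%:E
    <= \sum_(k <oo) (slice (wG k) (G k) j x)%:E)%E.
  elim: j => [_ x|j IH jn x]; first exact: FG.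
  pose jo := Ordinal jn.
  have -> : (\sum_(u <- U) (slice (wF u) (F u) j.+1 x)%:E
      = \int[mu]_t \sum_(u <- U) (slice (wF u) (F u) jo (put x jo t))%:E)%E.
    rewrite ge0_integral_sum//; last 2 first.
    - by move=> u; exact: measurable_slice.
    - by move=> u t _; rewrite lee_fin slice_ge0.
    by apply: eq_bigr => u _; rewrite integral_slice.
  have -> : (\sum_(k <oo) (slice (wG k) (G k) j.+1 x)%:E
      = \int[mu]_t \sum_(k <oo) (slice (wG k) (G k) jo (put x jo t))%:E)%E.
    rewrite integral_nneseries//; last 2 first.
    - by move=> k; exact: measurable_slice.
    - by move=> k t _; rewrite lee_fin slice_ge0.
    by apply: eq_eseriesr => k _; rewrite integral_slice.
  apply: ge0_le_integral => //.
  - by move=> t _; apply: sume_ge0 => u _; rewrite lee_fin slice_ge0.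
  - by apply: emeasurable_sum => u; exact: measurable_slice.
  - apply: ge0_emeasurable_sum; last by move=> k _; exact: measurable_slice.
    by move=> k t _ _; rewrite lee_fin slice_ge0.
  - by move=> t _; apply: IH; exact: ltnW.
(* Every coordinate is now integrated, so the point of evaluation is arbitrary. *)
have := step n (leqnn n) (fun=> 0).
congr (_ <= _)%E.
  apply: eq_bigr => u _; congr (_%:E).
  by apply: eq_bigr => i _; rewrite ltn_ord.
apply: eq_eseriesr => k _; congr (_%:E).
by apply: eq_bigr => i _; rewrite ltn_ord.
Qed.

End IteratedIntegral.

Lemma prod_indic (R : realType) (n : nat) (F : 'I_n -> set R) (x : 'I_n -> R) :
  \prod_i (\1_(F i) (x i) : R) = (`[< forall i, F i (x i) >])%:R :> R.
Proof.
case: asboolP => [H|/existsNP[i H]].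
  by rewrite big1// => i _; rewrite indicE mem_set.
by rewrite (bigD1 i)//= indicE memNset// mul0r.
Qed.

Lemma cell_inj (R : realType) (n : nat) (v x : 'rV[R]_n) (h : R)
    (u u' : 'rV[int]_n) : 0 < h -> cell v h u x -> cell v h u' x -> u = u'.
Proof.
move=> h0 ux ux'; apply/rowP => i.
have key (a b : int) : v 0 i + h * a%:~R <= x 0 i ->
    x 0 i < v 0 i + h * b%:~R + h -> (a <= b)%R.
  move=> h1 h2; rewrite -ltzD1 -(ltr_int R) -(ltr_pM2l h0) rmorphD/= mulrDr mulr1.
  lra.
have /andP[a1 a2] := ux i; have /andP[b1 b2] := ux' i.
by apply/eqP; rewrite eq_le !key.
Qed.

(** The cells are disjoint and lie in [S], so for any cover of [S] by boxes the indicators of the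
    cells sum pointwise to at most the sum of the indicators of the boxes. Integration compares the
    volumes. *)
Lemma lebesgue_rV_cells (R : realType) (n : nat) (v : 'rV[R]_n) (h : R)
    (U : seq 'rV[int]_n) (S : set 'rV[R]_n) :
  0 < h -> uniq U -> (forall u, u \in U -> cell v h u `<=` S) ->
  (((size U)%:R * h ^+ n)%:E <= lebesgue_rV S)%E.
Proof.
move=> h0 Uuniq US; apply: le_ereal_inf_tmp => _ [B /= SB <-].
pose F (u : 'rV[int]_n) (i : 'I_n) : set R :=
  `[v 0 i + h * (u 0 i)%:~R, v 0 i + h * (u 0 i)%:~R + h[%classic.
pose G (k : nat) (i : 'I_n) : set R := `[(B k).1 0 i, (B k).2 0 i]%classic.
have := @le_sum_prod_of_indic R n 'rV[int]_n U F (fun _ _ => h) G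
  (fun k i => Num.max 0 ((B k).2 0 i - (B k).1 0 i)).
rewrite (_ : (\sum_(u <- U) (\prod_(i < n) h)%:E)%E = ((size U)%:R * h ^+ n)%:E);
  last first.
  rewrite sumEFin prodr_const card_ord big_const_seq count_predT iter_addr_0.
  by rewrite mulr_natl.
apply => //.
- by move=> *; exact: ltW.
- by move=> k i; rewrite le_max lexx.
- by move=> u i; exact: measurable_itv.
- by move=> k i; exact: measurable_itv.
- move=> u i; apply: (eq_trans (lebesgue_measure_itv _)); rewrite /= lte_fin ltrDl h0 -EFinB.
  by congr (_%:E); ring.
- move=> k i; apply: (eq_trans (lebesgue_measure_itv _)); rewrite /= lte_fin -EFinB.
  case: ltP => ab; first by rewrite max_r// subr_ge0 ltW.
  by rewrite max_l// subr_le0.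
move=> x; pose X : 'rV[R]_n := \row_i x i.
under eq_bigr do rewrite prod_indic.
under eq_eseriesr do rewrite prod_indic.
have cellE u : `[< forall i, F u i (x i) >] = `[< cell v h u X >].
  by apply: asbool_equiv_eq; split=> + i => /(_ i); rewrite /F/= in_itv/= !mxE.
case: (pselect (exists2 u, u \in U & cell v h u X)) => [[u uU uX]|noU]; last first.
  rewrite big1_seq; first by apply: nneseries_ge0 => k _ _; rewrite lee_fin.
  move=> u /andP[_ uU]; rewrite cellE asboolF// => uX.
  by apply: noU; exists u.
rewrite (bigD1_seq u)//= big1 ?adde0; last first.
  move=> u' u'u; rewrite cellE asboolF// => uX'.
  by rewrite (cell_inj h0 uX uX') eqxx in u'u.
have [k _ kX] := SB _ (US _ uU _ uX).
apply: (@le_trans _ _ (\sum_(0 <= i < k.+1) (`[< forall j, G i j (x j) >])%:R%:E)%E);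
  last by apply: nneseries_lim_ge => *; rewrite lee_fin.
have Gk : forall j, G k j (x j).
  by move=> j; have := kX j; rewrite /G/= in_itv/= !mxE.
rewrite big_nat_recr//= (asboolT Gk).
rewrite addeC; apply: (@le_trans _ _ 1%E).
  by rewrite lee_fin; case: asboolP.
by apply: leeDl; apply: sume_ge0 => i _; rewrite lee_fin.
Qed.

(** * From pair counts to the measure of the neighborhood *)

Definition cube {R : realType} {m : nat} (p0 : 'rV[R]_m) (r0 : R) : set 'rV[R]_m :=
  [set P | forall i, `|P 0 i - p0 0 i| <= r0].

Definition lattice {R : realType} {m : nat} (h : R) (u : 'rV[int]_m) : 'rV[R]_m :=
  \row_i (h * (u 0 i)%:~R).

Definition block {m p : nat} (z : 'rV[int]_m) (s : {ffun 'I_m -> 'I_p}) :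
  'rV[int]_m := \row_i (z 0 i + (s i)%:Z).

Lemma enorm_le_sum (R : realType) (n : nat) (x : 'rV[R]_n) :
  enorm x <= \sum_i `|x 0 i|.
Proof.
have sum0 (P : pred 'I_n) : 0 <= \sum_(i | P i) `|x 0 i| by exact: sumr_ge0.
rewrite -[leRHS]ger0_norm// -sqrtr_sqr; apply: ler_wsqrtr.
rewrite expr2 mulr_suml; apply: ler_sum => i _.
rewrite -real_normK ?num_real// expr2 ler_wpM2l// (bigD1 i)//= lerDl.
exact: sum0.
Qed.

Lemma enorm_le_sup (R : realType) (n : nat) (x : 'rV[R]_n) (h : R) :
  (forall i, `|x 0 i| <= h) -> enorm x <= n%:R * h.
Proof.
move=> xh; apply: (le_trans (enorm_le_sum x)).
apply: (@le_trans _ _ (\sum_(i < n) h)); first exact: ler_sum.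
by rewrite sumr_const card_ord mulr_natl.
Qed.

Lemma block_inj (m p : nat) (z : 'rV[int]_m) :
  injective (@block m p z).
Proof.
move=> s t /rowP st; apply/ffunP => i; have := st i; rewrite !mxE => /addrI.
by move=> [/val_inj].
Qed.

Lemma floor_div_eq (R : realType) (h x y : R) : 0 < h ->
  Num.floor (x / h) = Num.floor (y / h) -> `|x - y| <= h.
Proof.
move=> h0 xy; have := floor_itv (x / h); have := floor_itv (y / h).
rewrite xy; set f := Num.floor _; rewrite !ler_pdivlMr// !ltr_pdivrMr// rmorphD/=.
rewrite ler_norml mulrDl mul1r; lra.
Qed.

Lemma cell_floor (R : realType) (h x : R) : 0 < h ->
  h * (Num.floor (x / h))%:~R <= x < h * (Num.floor (x / h))%:~R + h.
Proof.
move=> h0; have := floor_itv (x / h); rewrite ler_pdivlMr// ltr_pdivrMr// rmorphD/=.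
by rewrite mulrDl mul1r ![_ * h]mulrC.
Qed.

Section Kakeya.
Context {R : realType} (m p : nat) (r0 h delta C : R) (p0 : 'rV[R]_m)
  (E : set 'rV[R]_(m + 1)) (xi : 'I_p -> 'rV[R]_m) (H : 'I_p -> 'rV[R]_m -> R).
Hypotheses (p_gt0 : (0 < p)%N) (r0_gt0 : 0 < r0) (hE : h = r0 / p%:R)
  (C_ge0 : 0 <= C) (h_delta : (m + 1)%:R * h < delta).
Hypothesis HE : forall j X, cube p0 r0 (X - xi j) -> E (row_mx X (H j X)%:M).
Hypothesis pair_count : forall j k z, j != k ->
  #|[pred s : {ffun 'I_m -> 'I_p} | let X := lattice h (block z s) in
      `[< [/\ cube p0 r0 (X - xi j), cube p0 r0 (X - xi k)
            & `|H j X - H k X| <= h] >]]|%:R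
    <= C * p%:R ^+ m * `|j%:R - k%:R : R|^-1.

Let h_gt0 : 0 < h. Proof. by rewrite hE divr_gt0// ltr0n. Qed.

(** The lower corner of the translated cube, rounded up to the lattice. Rounding costs less than [h]
    and a block of [p] points spans [r0 - h], while the cube has side [2 * r0], so the block
    fits. *)
Let origin (j : 'I_p) : 'rV[int]_m :=
  \row_i Num.ceil ((xi j 0 i + p0 0 i - r0) / h).

Let point (j : 'I_p) (s : {ffun 'I_m -> 'I_p}) : 'rV[R]_m :=
  lattice h (block (origin j) s).

Let point_cube j s : cube p0 r0 (point j s - xi j).
Proof.
move=> i; rewrite !mxE rmorphD/= mulrDr.
have := ceil_itv ((xi j 0 i + p0 0 i - r0) / h).
set z := Num.ceil _; rewrite rmorphB/= ltr_pdivlMr// ler_pdivrMr// => /andP[z1 z2].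
have si : (s i)%:R + 1 <= p%:R :> R by rewrite natr1 ler_nat ltn_ord.
have hp : h * p%:R = r0 by rewrite hE divfK// gt_eqF// ltr0n.
have hs : h * ((s i)%:R + 1) <= r0 by rewrite -hp ler_pM2l.
have hs0 : 0 <= h * (s i)%:R by rewrite mulr_ge0// ltW.
rewrite ler_norml -pmulrn; lra.
Qed.

(** The index of the cell of side [h] that contains a point of the graph. All parameters use the
    same lattice [h Z^m], so equal codes force equal [X] and heights within [h]. *)
Let code (j : 'I_p) (s : {ffun 'I_m -> 'I_p}) : 'rV[int]_(m + 1) :=
  row_mx (block (origin j) s) (Num.floor (H j (point j s) / h))%:M.

Let code_inj j : injective (code j).
Proof. by move=> s t /eq_row_mx[/block_inj]. Qed.

Let code_cell j s : cell 0 h (code j s) `<=` neighborhood E delta.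
Proof.
move=> x xc; set y := row_mx (point j s) (H j (point j s))%:M.
have Ey : E y by apply: HE; exact: point_cube.
exists y => //; exists (x - y); last by rewrite addrC subrK.
apply: le_lt_trans h_delta; apply: enorm_le_sup.
move=> i; have := xc i; rewrite !mxE add0r.
case: splitP => k _; rewrite ?mxE.
  by rewrite ler_norml; lra.
rewrite ord1 !eqxx !mulr1n.
have := cell_floor (H j (point j s)) h_gt0.
by rewrite ler_norml; lra.
Qed.

Let pair_code j k : j != k ->
  #|[pred s | code j s \in codom (code k)]|%:R
    <= C * p%:R ^+ m * `|j%:R - k%:R : R|^-1.
Proof.
move=> jk; apply: le_trans (pair_count (origin j) jk); rewrite ler_nat.
apply: subset_leq_card; apply/fintype.subsetP => s /codomP[t].
move=> /eq_row_mx[st Hst]; apply/asboolP; rewrite -/(point j s).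
have pE : point j s = point k t by rewrite /point st.
split; [exact: point_cube|rewrite pE; exact: point_cube|].
move/matrixP : Hst => /(_ 0 0); rewrite !mxE !mulr1n -pE.
exact: floor_div_eq.
Qed.

(** The diagonal pairs contribute at most [p ^ (m + 1)], the others [C p ^ m] times the sum of
    [1 / |j - k|]. As a cell has volume [(r0 / p) ^ (m + 1)], the powers of [p] cancel and only the
    logarithm is left. *)
Lemma kakeya_core :
  ((r0 ^+ (m + 1) / (1 + 2 * C * (1 + ln p%:R)))%:E
    <= lebesgue_rV (neighborhood E delta))%E.
Proof.
have [U [Uuniq Ucode CS]] := @cauchy_schwarz_union R _ _ _ code code_inj.
have HU : (((size U)%:R * h ^+ (m + 1))%:E
    <= lebesgue_rV (neighborhood E delta))%E.
  apply: (@lebesgue_rV_cells R _ 0) => // u /Ucode[j [s ->]].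
  exact: code_cell.
apply: le_trans HU; rewrite lee_fin.
have pR : 0 < p%:R :> R by rewrite ltr0n.
have lnp : 0 <= ln p%:R :> R by rewrite ln_ge0// ler1n.
set L := 1 + 2 * C * (1 + ln p%:R).
have L0 : 0 < L by rewrite ltr_pwDl// !mulr_ge0// addr_ge0.
have : \sum_j \sum_k #|[pred s | code j s \in codom (code k)]|%:R
    <= p%:R ^+ (m + 1) * L :> R.
  apply: (@le_trans _ _ (\sum_(j < p) (p%:R ^+ m
      + \sum_(k < p | k != j) C * p%:R ^+ m * `|j%:R - k%:R : R|^-1))).
    apply: ler_sum => j _; rewrite (bigD1 j)//= lerD//.
      rewrite -natrX ler_nat.
      by apply: (leq_trans (max_card _)); rewrite card_ffun !card_ord.
    by apply: ler_sum => k kj; apply: pair_code; rewrite eq_sym.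
  rewrite big_split/= sumr_const card_ord.
  under eq_bigr do rewrite -mulr_sumr.
  rewrite -mulr_sumr -[X in X + _]mulr_natl addn1 exprS /L mulrDr mulr1 lerD2l.
  have -> : p%:R * p%:R ^+ m * (2 * C * (1 + ln p%:R))
      = C * p%:R ^+ m * (2 * p%:R * (1 + ln p%:R)) :> R by ring.
  by apply: ler_wpM2l; [rewrite mulr_ge0|exact: sum_inv_dist].
move=> /(ler_wpM2l (ler0n _ (size U))) /(le_trans CS).
rewrite card_ffun !card_ord natrX -exprS -addn1.
set q : R := p%:R ^+ (m + 1).
have q0 : 0 < q by rewrite exprn_gt0.
rewrite mulrCA expr2 ler_pM2l// => qU.
rewrite ler_pdivrMr// hE expr_div_n -/q.
rewrite (_ : _ * L = r0 ^+ (m + 1) * ((size U)%:R * L / q)); last by ring.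
apply: ler_peMr; first by rewrite exprn_ge0// ltW.
by rewrite ler_pdivlMr// mul1r.
Qed.

End Kakeya.

(** Keeps [|ln delta|] away from 0, so that additive constants can be absorbed into multiples of
    it. *)
Lemma ln_le_mhalf (R : realType) (delta : R) : 0 < delta < 1 / 2 ->
  ln delta <= - (1 / 2).
Proof.
move=> /andP[d0 d1]; apply: (@le_trans _ _ (ln (1 + - (1 / 2)))).
  by rewrite ler_ln ?posrE//; lra.
by apply: le_ln1Dx; lra.
Qed.

(* The two conditions on [delta] make it comparable to the lattice spacing [r0 / p];
   only families of type (iii) use them. *)
Definition pair_bound {R : realType} (m : nat) (a0 a1 : R) (p0 : 'rV[R]_m)
    (r0 C delta : R) (phi : R -> 'rV[R]_m -> R) : Prop :=
  forall (p : nat) (a a' : R) (xi xi' : 'rV[R]_m) (s s' : R) (z : 'rV[int]_m),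
    (0 < p)%N -> a0 <= a <= a1 -> a0 <= a' <= a1 -> a != a' ->
    (m + 3)%:R * (r0 / p%:R) < delta ->
    delta <= ((m + 3)%:R + r0^-1) * (r0 / p%:R) ->
    #|[pred t : {ffun 'I_m -> 'I_p} |
        let X := lattice (r0 / p%:R) (block z t) in
        `[< [/\ cube p0 r0 (X - xi), cube p0 r0 (X - xi')
              & `|phi a (X - xi) + s - (phi a' (X - xi') + s')| <= r0 / p%:R] >]]|%:R
      * p%:R * `|a - a'| <= C * p%:R ^+ m.

(** The same [p] serves as number of parameters and as number of lattice points per side. The
    parameters are multiples of [(a1 - a0) / p] apart, which turns a bound in [1 / |a - a'|] into
    one in [1 / |j - k|]. *)
Lemma kakeya_log (R : realType) (m : nat) (a0 a1 r0 C delta : R) (p0 : 'rV[R]_m)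
    (phi : R -> 'rV[R]_m -> R) (E : set 'rV[R]_(m + 1)) :
  a0 < a1 -> 0 < r0 -> 0 <= C -> 0 < delta < 1 / 2 ->
  pair_bound a0 a1 p0 r0 C delta phi ->
  (forall a, a0 <= a <= a1 -> exists xi s, forall X, cube p0 r0 (X - xi) ->
    E (row_mx X (phi a (X - xi) + s)%:M)) ->
  ((r0 ^+ (m + 1) / (2 + 2 * (C / (a1 - a0)) * (2 * ((m + 5)%:R * (r0 + 1)) + 1))
    * `|ln delta|^-1)%:E <= lebesgue_rV (neighborhood E delta))%E.
Proof.
move=> a01 r0_gt0 C0 d01 pairs HE; have /andP[d0 d1] := d01.
(* The factor [m + 3] leaves room for an error [h] in each of the [m] horizontal coordinates and
   [2 * h] in the vertical one. *)
pose q := (m + 3)%:R * (r0 / delta).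
have q0 : 0 <= q by rewrite mulr_ge0// divr_ge0// ltW.
pose p := (Num.truncn q).+1.
have pR : 0 < p%:R :> R by rewrite ltr0n.
have /andP[qp pq] := truncn_itv q0.
pose h := r0 / p%:R.
have h0 : 0 < h by rewrite divr_gt0.
have h_delta : (m + 3)%:R * h < delta.
  by rewrite /h mulrA ltr_pdivrMr// [ltRHS]mulrC -ltr_pdivrMr// -mulrA.
have pq1 : p%:R <= q + 1 by rewrite -natr1 lerD2r.
have delta_h : delta <= ((m + 3)%:R + r0^-1) * h.
  rewrite /h mulrA ler_pdivlMr// mulrDl mulVf ?gt_eqF// mulrC.
  apply: (@le_trans _ _ ((q + 1) * delta)); first by rewrite ler_pM2r.
  by rewrite mulrDl mul1r /q -mulrA divfK ?gt_eqF// lerD2l; lra.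
set l := a1 - a0; have l0 : 0 < l by rewrite subr_gt0.
pose a (j : 'I_p) : R := a0 + l * (j%:R / p%:R).
have aA j : a0 <= a j <= a1.
  have jp : 0 <= (j%:R / p%:R : R) <= 1.
    apply/andP; split; first by rewrite divr_ge0.
    by rewrite ler_pdivrMr// mul1r ler_nat ltnW.
  have : 0 <= l * (j%:R / p%:R) <= l.
    move/andP: jp => [j0 j1]; apply/andP; split; first by rewrite mulr_ge0// ltW.
    by rewrite ler_piMr// ltW.
  by rewrite /a /l; lra.
have /choice[xs Hxs] : forall j, exists w : 'rV[R]_m * R, forall X,
    cube p0 r0 (X - w.1) -> E (row_mx X (phi (a j) (X - w.1) + w.2)%:M).
  by move=> j; have [xi [s Hs]] := HE _ (aA j); exists (xi, s).
pose xi j := (xs j).1.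
pose H j X := phi (a j) (X - xi j) + (xs j).2.
have core := @kakeya_core R m p r0 h delta (C / l) p0 E xi H isT r0_gt0 erefl.
have /core {}core : 0 <= C / l by rewrite divr_ge0// ltW.
have /core {}core : (m + 1)%:R * h < delta.
  by apply: le_lt_trans h_delta; rewrite ler_pM2r// ler_nat leq_add2l.
have {}core := core Hxs.
have ajk (j k : 'I_p) : a j - a k = l / p%:R * (j%:R - k%:R).
  by rewrite /a; field; rewrite gt_eqF.
apply: le_trans (core _); last first.
  move=> j k z jk.
  have jkR : 0 < `|j%:R - k%:R : R|.
    by rewrite normr_gt0 subr_eq0 eqr_nat.
  have aneq : a j != a k.
    rewrite -subr_eq0 ajk mulf_neq0//; last by rewrite -normr_gt0.
    by rewrite gt_eqF// divr_gt0.
  have := pairs p (a j) (a k) (xi j) (xi k) (xs j).2 (xs k).2 z isT (aA j) (aA k)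
    aneq h_delta delta_h.
  rewrite ajk normrM gtr0_norm ?divr_gt0// -/h /H.
  set N := #|_|%:R; set J := `|_|.
  rewrite (_ : N * p%:R * (l / p%:R * J) = N * J * l); last by field; rewrite gt_eqF.
  rewrite -ler_pdivlMr// -ler_pdivlMr// => /le_trans; apply.
  by rewrite le_eqVlt; apply/orP; left; apply/eqP; field; rewrite !gt_eqF.
rewrite lee_fin -mulrA ler_pM2l ?exprn_gt0//.
have lnd := ln_le_mhalf d01; rewrite ler0_norm; last by lra.
set D := C / l; have D0 : 0 <= D by rewrite divr_ge0// ltW.
have lnp0 : 0 <= ln p%:R :> R by rewrite ln_ge0// ler1n.
set M := (m + 5)%:R * (r0 + 1).
have M0 : 0 <= M by rewrite mulr_ge0// addr_ge0// ltW.
have lnp : 1 + ln p%:R <= M - ln delta.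
  have pM : p%:R <= ((m + 3)%:R * r0 + 1) / delta.
    apply: (le_trans pq1); rewrite ler_pdivlMr// mulrDl mul1r /q -mulrA divfK ?gt_eqF//.
    by rewrite lerD2l; lra.
  have K0 : 0 < (m + 3)%:R * r0 + 1 by rewrite ltr_wpDl// mulr_ge0// ltW.
  have : ln p%:R <= ln (((m + 3)%:R * r0 + 1) / delta) :> R.
    by rewrite ler_ln// posrE divr_gt0.
  rewrite lnM ?posrE ?invr_gt0// lnV ?posrE//.
  have := ln_sublinear K0.
  have : (m + 3)%:R * r0 + 2 <= M.
    rewrite /M (_ : (m + 5)%:R = (m + 3)%:R + 2 :> R); last by rewrite -natrD -addnA.
    have m0 : 0 <= (m + 3)%:R :> R by [].
    nra.
  lra.
move: (ln p%:R) lnp0 lnp => y y0 yM.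
have Dy0 : 0 <= D * (1 + y) by rewrite mulr_ge0//; lra.
have DM0 : 0 <= D * M by rewrite mulr_ge0.
have lnd0 : 0 < - ln delta by lra.
rewrite -invfM lef_pV2 ?posrE; last 2 first.
- by apply: mulr_gt0 => //; lra.
- by lra.
move: lnd lnd0 yM; rewrite -[ln delta]opprK; set x := - ln delta => lnd x0 yM.
have : D * (1 + y) <= D * (M + x) by rewrite ler_wpM2l//; lra.
have : D * M <= D * M * (2 * x) by rewrite ler_peMr//; lra.
have : 0 <= D * x by rewrite mulr_ge0//; lra.
rewrite opprK; lra.
Qed.

(** The inequality [ln y <= y] at [y = delta ^ (- eta)] gives
    [eta * |ln delta| <= delta ^ (- eta)]. *)
Lemma minkowski_of_log (R : realType) (n : nat) (E : set 'rV[R]_n) (c : R) :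
  0 < c ->
  (forall delta : R, 0 < delta < 1 / 2 ->
    ((c * `|ln delta|^-1)%:E <= lebesgue_rV (neighborhood E delta))%E) ->
  full_minkowski_dimension E.
Proof.
move=> c0 HE; rewrite /full_minkowski_dimension; near=> eta.
have eta0 : 0 < eta by near: eta; exact: nbhs_right_gt.
exists (c * eta); first by rewrite mulr_gt0.
near=> delta; have d0 : 0 < delta by near: delta; exact: nbhs_right_gt.
have d01 : 0 < delta < 1 / 2.
  by rewrite d0/=; near: delta; apply: nbhs_right_lt; lra.
apply: le_trans (HE _ d01); rewrite lee_fin -mulrA ler_pM2l//.
have lnd := ln_le_mhalf d01; rewrite ler0_norm; last by lra.
have y0 : 0 < delta `^ eta by rewrite powR_gt0.
have := @ln_sublinear R (delta `^ eta)^-1; rewrite invr_gt0 => /(_ y0).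
rewrite lnV ?posrE// ln_powR => h.
rewrite -[leRHS]div1r ler_pdivlMr; last by lra.
have : - (eta * ln delta) * delta `^ eta <= (delta `^ eta)^-1 * delta `^ eta.
  by rewrite ler_pM2r// ltW.
rewrite mulVf ?gt_eqF//; lra.
Unshelve. all: by end_near. Qed.

(** Each counted lattice point gives a cell of volume [h ^ (m + 1)] inside both neighborhoods, once
    the second graph is moved back to its untranslated position; the cells are disjoint. In the
    hypothesis [delta ^ 2] is then replaced by a multiple of [h ^ 2], and the denominator by
    [|a' - a|]. *)
Lemma pair_bound_of_intersection (R : realType) (m : nat) (a0 a1 b eps C0 K r0 delta : R)
    (g : R -> R -> R) :
  0 <= K -> C0 <= K -> eps <= b -> 0 < r0 -> m%:R * r0 <= eps -> 0 < delta < 1 ->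
  @intersection_bound R m `[a0, a1]%classic g b eps C0 ->
  @pair_bound R m a0 a1 0 r0 (K * ((m + 3)%:R + r0^-1) ^+ 2 * r0 ^+ 2 / r0 ^+ (m + 1)) delta
    (fun a (X : 'rV[R]_m) => g a (enorm X)).
Proof.
move=> K0 C0K epsb r0_gt0 mr0 d01 inter p a a' xi xi' s s' z p0 aA aA' aa' h_delta delta_h.
have d0 : 0 < delta by case/andP: d01.
set h := r0 / p%:R in h_delta delta_h *.
have pR : 0 < p%:R :> R by rewrite ltr0n.
have h0 : 0 < h by rewrite divr_gt0.
set P := [pred t | _]; set N := #|_|.
pose X t := lattice h (@block m p z t).
pose H t := g a (enorm (X t - xi)) + s.
pose code t : 'rV[int]_(m + 1) := row_mx (block z t) (Num.floor (H t / h))%:M.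
have code_inj : injective code by move=> t t' /eq_row_mx[/block_inj].
have cap (Y : 'rV[R]_m) : cube 0 r0 Y -> enorm Y <= eps.
  move=> Yr; apply: le_trans mr0; apply: enorm_le_sup => i.
  by have := Yr i; rewrite mxE subr0.
pose U := [seq code t | t <- enum P].
have Uuniq : uniq U by rewrite map_inj_uniq ?enum_uniq.
(* Shifting the grid by [v] undoes the translation of the second graph; [tau] is the translation of
   the first graph relative to it. *)
pose v : 'rV[R]_(m + 1) := - row_mx xi' s'%:M.
pose tau : 'rV[R]_(m + 1) := row_mx (xi - xi') (s - s')%:M.
(* The vertical tolerance is [2 * h] because the cell is chosen by the height of the first graph,
   and the second height may differ by a further [h]. *)
have near (x y : 'rV[R]_(m + 1)) :
    (forall i : 'I_m, `|x 0 (lshift 1 i) - y 0 (lshift 1 i)| <= h) ->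
    `|x 0 (rshift m 0) - y 0 (rshift m 0)| <= 2 * h -> enorm (x - y) < delta.
  move=> xy1 xy2; apply: le_lt_trans h_delta; apply: (le_trans (enorm_le_sum _)).
  rewrite big_split_ord/= big_ord1 !mxE natrD mulrDl lerD//.
    apply: (@le_trans _ _ (\sum_(i < m) h)).
      by apply: ler_sum => i _; rewrite !mxE.
    by rewrite sumr_const card_ord mulr_natl.
  by apply: (le_trans xy2); rewrite ler_pM2r// ler_nat.
have cells : forall u, u \in U -> cell v h u `<=`
    translate (neighborhood (graph_cap g b a) delta) tau
      `&` neighborhood (graph_cap g eps a') delta.
  move=> u /mapP[t]; rewrite mem_enum => /asboolP[/= c1 c2 c3] -> x xc.
  have x1 (i : 'I_m) : 0 <= x 0 (lshift 1 i) + xi' 0 i - X t 0 i <= h.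
    have := xc (lshift 1 i); rewrite !mxE.
    rewrite -[lshift 1 i]/(lshift 1 i) !(unsplitK (inl i)) !mxE.
    by rewrite rmorphD/=; lra.
  have x2 : 0 <= x 0 (rshift m 0) + s' - h * (Num.floor (H t / h))%:~R <= h.
    have := xc (rshift m 0); rewrite !mxE !(unsplitK (inr ord0)) !mxE eqxx !mulr1n.
    lra.
  have := cell_floor (H t) h0 => Hc.
  split.
    exists (x - tau); last by rewrite subrK.
    exists (row_mx (X t - xi) (g a (enorm (X t - xi)))%:M).
      by exists (X t - xi) => //=; apply: le_trans epsb; exact: cap.
    exists (x - tau - row_mx (X t - xi) (g a (enorm (X t - xi)))%:M); last first.
      by rewrite addrC subrK.
    apply: near => [i|].
      rewrite !mxE !(unsplitK (inl i)) !mxE; have := x1 i; rewrite !mxE ler_norml; lra.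
    rewrite !mxE !(unsplitK (inr ord0)) !mxE eqxx !mulr1n ler_norml.
    by move: Hc x2; rewrite /H; lra.
  exists (row_mx (X t - xi') (g a' (enorm (X t - xi')))%:M).
    by exists (X t - xi') => //=; exact: cap.
  exists (x - row_mx (X t - xi') (g a' (enorm (X t - xi')))%:M); last first.
    by rewrite addrC subrK.
  apply: near => [i|].
    rewrite !mxE !(unsplitK (inl i)) !mxE; have := x1 i; rewrite !mxE ler_norml; lra.
  rewrite !mxE !(unsplitK (inr ord0)) !mxE eqxx !mulr1n.
  move: c3; rewrite -/h -/(X t) -/(H t) !ler_norml => c3.
  by move: Hc x2; lra.
have := lebesgue_rV_cells h0 Uuniq cells.
have := inter a a' delta; rewrite /= !in_itv/= => /(_ aA aA' d01) isup HU.
have := le_trans HU (le_trans (ereal_sup_ubound _) isup).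
have /[swap] /[apply] : [set lebesgue_rV (translate (neighborhood (graph_cap g b a) delta) tau
   `&` neighborhood (graph_cap g eps a') delta) | tau in [set: 'rV[R]_(m + 1)]]
    (lebesgue_rV (translate (neighborhood (graph_cap g b a) delta) tau
   `&` neighborhood (graph_cap g eps a') delta)) by exists tau.
rewrite lee_fin size_map -cardE -/N.
set d := `|a' - a|; have dd : 0 < d by rewrite normr_gt0 subr_eq0 eq_sym.
rewrite distrC -/d mulrA ler_pdivlMr ?addr_gt0// => Nle.
set kappa := (m + 3)%:R + r0^-1 in delta_h *.
have Nle2 : N%:R * h ^+ (m + 1) * d <= K * (kappa * h) ^+ 2.
  apply: (@le_trans _ _ (C0 * delta ^+ 2)).
    by apply: le_trans Nle; rewrite ler_wpM2l ?mulr_ge0 ?exprn_ge0 ?(ltW h0)// lerDr ltW.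
  apply: (@le_trans _ _ (K * delta ^+ 2)); first by rewrite ler_wpM2r ?sqr_ge0.
  rewrite ler_wpM2l// ler_sqr ?nnegrE ?(ltW d0)//.
  exact: le_trans (ltW d0) delta_h.
have rm : 0 < r0 ^+ (m + 1) by rewrite exprn_gt0.
rewrite -(ler_pM2r rm).
have E1 : h ^+ (m + 1) * p%:R ^+ (m + 1) = r0 ^+ (m + 1).
  by rewrite -exprMn /h divfK ?gt_eqF.
have p1 : 0 < p%:R ^+ (m + 1) * p%:R :> R by rewrite mulr_gt0// exprn_gt0.
have := ler_wpM2r (ltW p1) Nle2.
congr (_ <= _); first by rewrite -E1; ring.
rewrite [RHS]mulrAC divfK ?gt_eqF// exprMn /h expr_div_n addn1 (exprS p%:R).
by field; rewrite gt_eqF.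
Qed.

(** * Derivatives of radial functions along lines *)

Definition dot {R : realType} {m : nat} (x y : 'rV[R]_m) : R :=
  \sum_i x 0 i * y 0 i.

Lemma enorm_ge0 (R : realType) (m : nat) (x : 'rV[R]_m) : 0 <= enorm x.
Proof. exact: sqrtr_ge0. Qed.

Lemma sqr_enorm (R : realType) (m : nat) (x : 'rV[R]_m) : enorm x ^+ 2 = dot x x.
Proof.
rewrite sqr_sqrtr; last by apply: sumr_ge0 => i _; exact: sqr_ge0.
by apply: eq_bigr => i _; rewrite expr2.
Qed.

Lemma dot_line (R : realType) (m : nat) (x w y : 'rV[R]_m) (t : R) :
  dot (x + t *: w) y = dot x y + t * dot w y.
Proof.
rewrite /dot mulr_sumr -big_split/=; apply: eq_bigr => i _.
by rewrite !mxE; ring.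
Qed.

Lemma dotC (R : realType) (m : nat) (x y : 'rV[R]_m) : dot x y = dot y x.
Proof. by apply: eq_bigr => i _; rewrite mulrC. Qed.

Lemma enorm_line (R : realType) (m : nat) (x w : 'rV[R]_m) (t : R) :
  enorm (x + t *: w) = Num.sqrt (dot x x + t * (2 * dot x w) + t ^+ 2 * dot w w).
Proof.
rewrite -[LHS]ger0_norm ?enorm_ge0// -sqrtr_sqr sqr_enorm dot_line.
by rewrite (dotC x (_ + _)) (dotC w (_ + _)) !dot_line (dotC w x); congr Num.sqrt; ring.
Qed.

Lemma dot_sqr_le (R : realType) (m : nat) (x y : 'rV[R]_m) : 0 < enorm x ->
  (dot x y / enorm x) ^+ 2 <= dot y y.
Proof.
move=> x0; rewrite expr_div_n ler_pdivrMr ?exprn_gt0// mulrC.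
set a := enorm x ^+ 2; set b := dot x y.
have a0 : 0 < a by rewrite exprn_gt0.
have : 0 <= \sum_i (a * y 0 i - b * x 0 i) ^+ 2 by apply: sumr_ge0 => i _; exact: sqr_ge0.
have expand (c : R) : \sum_i (a * y 0 i - c * x 0 i) ^+ 2
    = a ^+ 2 * dot y y - 2 * a * c * dot x y + c ^+ 2 * dot x x.
  rewrite /dot !mulr_sumr -sumrB -big_split/=; apply: eq_bigr => i _; ring.
have -> : \sum_i (a * y 0 i - b * x 0 i) ^+ 2 = a * (a * dot y y - b ^+ 2).
  by rewrite expand -(sqr_enorm x) -/a -/b; ring.
by rewrite pmulr_rge0// subr_ge0.
Qed.

Section LineDerivatives.
Context {R : realType} {m : nat} (x w : 'rV[R]_m).
Local Notation N t := (enorm (x + t *: w)).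
Local Notation n t := (dot (x + t *: w) w / N t).

Lemma is_derive_enorm_line (t : R) : 0 < N t ->
  is_derive t 1 (fun s : R => N s) (n t).
Proof.
move=> Nt.
pose q (s : R) := dot x x + s * (2 * dot x w) + s ^+ 2 * dot w w.
have -> : (fun s : R => N s) = Num.sqrt \o q.
  by apply/funext => s; exact: enorm_line.
have q0 : 0 < q t by move: Nt; rewrite enorm_line sqrtr_gt0.
have D1 : is_derive t 1 q (2 * dot x w + 2 * t * dot w w).
  by apply: is_derive_eq; rewrite /GRing.scale/=; ring.
have D2 := is_derive1_sqrt q0.
have D := @is_derive1_comp R _ q t _ _ D2 D1.
apply: is_derive_eq.
rewrite dot_line enorm_line -/(q t); field.
by rewrite gt_eqF// sqrtr_gt0.
Qed.

Lemma is_derive_radial (f : R -> R) (df t : R) : 0 < N t ->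
  is_derive (N t) 1 f df -> is_derive t 1 (fun s : R => f (N s)) (df * n t).
Proof.
move=> Nt Df; have D := @is_derive1_comp R f (fun s => N s) t _ _ Df (is_derive_enorm_line Nt).
exact: D.
Qed.

(** Here [n t] is the component of [w] along the radius: the second derivative of the profile acts
    on the radial part of [w], and its slope divided by the radius on the tangential part. *)
Lemma is_derive_radial2 (f1 : R -> R) (df t : R) : 0 < N t ->
  is_derive (N t) 1 f1 df ->
  is_derive t 1 (fun s : R => f1 (N s) * n s)
    (df * n t ^+ 2 + f1 (N t) * ((dot w w - n t ^+ 2) / N t)).
Proof.
move=> Nt Df.
have Dn := is_derive_enorm_line Nt.
have DV := @is_deriveV R (fun s => N s) t _ 1 (lt0r_neq0 Nt) Dn.
have Dd : is_derive t 1 (fun s : R => dot (x + s *: w) w) (dot w w).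
  have -> : (fun s : R => dot (x + s *: w) w) = (fun s => dot x w + s * dot w w).
    by apply/funext => s; exact: dot_line.
  by apply: is_derive_eq; rewrite /GRing.scale/=; ring.
have D := is_deriveM (is_derive_radial Nt Df) (is_deriveM Dd DV).
apply: (is_derive_eq D).
rewrite fctE /GRing.scale/=; field.
by rewrite gt_eqF.
Qed.

End LineDerivatives.

Section MeanValue.
Context {R : realType}.
Implicit Types (f df : R -> R).

Lemma is_derive_continuous_within f df (a b : R) :
  (forall t : R, a <= t <= b -> is_derive t 1 f (df t)) ->
  {within `[a, b], continuous f}.
Proof.
move=> Df; apply: derivable_within_continuous => t; rewrite in_itv/= => tab.
by have [] := Df t tab.
Qed.

Lemma mean_value f df (a b : R) : a <= b ->
  (forall t : R, a <= t <= b -> is_derive t 1 f (df t)) ->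
  exists2 c, a <= c <= b & f b - f a = df c * (b - a).
Proof.
move=> ab Df.
have [t|c] := @MVT_segment R f df a b ab _ (is_derive_continuous_within Df).
  by rewrite in_itv/= => /andP[at_ tb]; apply: Df; rewrite !ltW.
by rewrite in_itv/= => cab E; exists c.
Qed.

(** The derivative of [f s - c s ^ 2] is nondecreasing, so the mean slope of this function on
    [[0, t]] is at most that on [[t, 1]]. *)
Lemma strongly_convex_of_derive2 f (f1 f2 : R -> R) (c t : R) :
  (forall t : R, 0 <= t <= 1 -> is_derive t 1 f (f1 t)) ->
  (forall t : R, 0 <= t <= 1 -> is_derive t 1 f1 (f2 t)) ->
  (forall t : R, 0 <= t <= 1 -> 2 * c <= f2 t) -> 0 <= t <= 1 ->
  f t <= (1 - t) * f 0 + t * f 1 - c * (t * (1 - t)).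
Proof.
move=> D1 D2 f2c /andP[t0 t1].
pose g s := f s - c * s ^+ 2; pose g1 s := f1 s - 2 * c * s.
have Dg (s : R) : 0 <= s <= 1 -> is_derive s 1 g (g1 s).
  by move=> /D1 Ds; apply: is_derive_eq; rewrite /g1 /GRing.scale/=; ring.
have [u /andP[u0 ut] gu] : exists2 u, 0 <= u <= t & g t - g 0 = g1 u * (t - 0).
  by apply: mean_value => // s /andP[s0 st]; apply: Dg; rewrite s0 (le_trans st).
have [v /andP[tv v1] gv] : exists2 v, t <= v <= 1 & g 1 - g t = g1 v * (1 - t).
  by apply: mean_value => // s /andP[s0 st]; apply: Dg; rewrite st (le_trans t0).
have uv : u <= v by exact: le_trans ut tv.
have g1uv : g1 u <= g1 v.
  have [s /andP[us sv] E] : exists2 s, u <= s <= v & f1 v - f1 u = f2 s * (v - u).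
    apply: mean_value => // s /andP[us sv].
    by apply: D2; rewrite (le_trans u0 us) (le_trans sv v1).
  have : 2 * c * (v - u) <= f2 s * (v - u).
    by rewrite ler_wpM2r ?subr_ge0// f2c// (le_trans u0 us) (le_trans sv v1).
  by rewrite -E /g1; lra.
have : 0 <= t * (1 - t) * (g1 v - g1 u) by rewrite !mulr_ge0 ?subr_ge0.
have -> : t * (1 - t) * (g1 v - g1 u)
    = t * (g1 v * (1 - t)) - (1 - t) * (g1 u * (t - 0)) by ring.
by rewrite -gu -gv /g; lra.
Qed.

End MeanValue.

(** * Geometry near a point of the axis *)

Lemma coord_le_enorm (R : realType) (m : nat) (x : 'rV[R]_m) (i : 'I_m) :
  `|x 0 i| <= enorm x.
Proof.
rewrite -sqrtr_sqr; apply: ler_wsqrtr; rewrite (bigD1 i)//= lerDl.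
by apply: sumr_ge0 => j _; exact: sqr_ge0.
Qed.

(** Replaces a difference of square roots by a sum over coordinates, from which the axis term can be
    singled out. *)
Lemma enorm_sub_mul (R : realType) (m : nat) (x y : 'rV[R]_m) :
  (enorm x - enorm y) * (enorm x + enorm y)
    = \sum_i (x 0 i - y 0 i) * (x 0 i + y 0 i).
Proof.
transitivity (enorm x ^+ 2 - enorm y ^+ 2); first by ring.
rewrite !sqr_enorm /dot -sumrB; apply: eq_bigr => i _; ring.
Qed.

Lemma enorm_sub_le (R : realType) (m : nat) (x y : 'rV[R]_m) (rho : R) :
  0 < enorm y -> (forall i, `|x 0 i - y 0 i| <= rho) ->
  `|enorm x - enorm y| <= m%:R * rho.
Proof.
move=> y0 xy.
have s0 : 0 < enorm x + enorm y by rewrite ltr_wpDl ?enorm_ge0.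
rewrite -(ler_pM2r s0) -[X in _ * X <= _](gtr0_norm s0) -normrM enorm_sub_mul.
apply: (le_trans (ler_norm_sum _ _ _)).
apply: (@le_trans _ _ (\sum_(i < m) rho * (enorm x + enorm y))).
  apply: ler_sum => i _; rewrite normrM ler_pM//.
  by apply: (le_trans (ler_normD _ _)); rewrite lerD// coord_le_enorm.
by rewrite sumr_const card_ord -[leLHS]mulr_natl mulrA.
Qed.

Section Geometry.
Context {R : realType} {m : nat} (i1 : 'I_m) (tm r0 : R).

Definition axis_point : 'rV[R]_m := \row_i (if i == i1 then tm else 0).

(** [mu] measures how far the cube leaves the axis: it bounds the excess of the radius over the axis
    coordinate. *)
Local Notation mu := (m%:R * r0).
Hypotheses (r0_ge0 : 0 <= r0) (tm_r0 : 1 <= tm - r0).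

Section OnePoint.
Variable P : 'rV[R]_m.
Hypothesis HP : cube axis_point r0 P.

Lemma cube_axis : tm - r0 <= P 0 i1 <= tm + r0.
Proof. by have := HP i1; rewrite mxE eqxx ler_norml; lra. Qed.

Lemma cube_off_axis i : i != i1 -> `|P 0 i| <= r0.
Proof. by move=> ii1; have := HP i; rewrite mxE (negbTE ii1) subr0. Qed.

Lemma le_axis_enorm : P 0 i1 <= enorm P.
Proof. exact: le_trans (ler_norm _) (coord_le_enorm _ _). Qed.

Lemma cube_enorm_ge1 : 1 <= enorm P.
Proof.
have h1 := le_axis_enorm; have /andP[h2 h3] := cube_axis.
exact: le_trans tm_r0 (le_trans h2 h1).
Qed.

Lemma enorm_le_axis : enorm P <= P 0 i1 + mu.
Proof.
apply: (le_trans (enorm_le_sum _)); rewrite (bigD1 i1)//= ger0_norm; last first.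
  by have /andP[+ _] := cube_axis; have := tm_r0; lra.
rewrite lerD2l; apply: (@le_trans _ _ (\sum_(i < m | i != i1) r0)).
  by apply: ler_sum => i; exact: cube_off_axis.
apply: (@le_trans _ _ (\sum_(i < m) r0)).
  by rewrite [leRHS](bigD1 i1)//= lerDr.
by rewrite sumr_const card_ord mulr_natl.
Qed.

End OnePoint.

Section TwoPoints.
Variables (P P' : 'rV[R]_m) (rho : R).
Hypotheses (HP : cube axis_point r0 P) (HP' : cube axis_point r0 P').
Hypothesis Hrho : forall i, `|P 0 i - P' 0 i| <= rho.

Let enormP_ge1 : 1 <= enorm P. Proof. exact: cube_enorm_ge1. Qed.
Let enormP'_ge1 : 1 <= enorm P'. Proof. exact: cube_enorm_ge1. Qed.

Lemma enorm_diff_le : `|enorm P - enorm P'| <= m%:R * rho.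
Proof.
have [r1 r1'] := (enormP_ge1, enormP'_ge1); have r00 := r0_ge0.
by apply: enorm_sub_le => //; lra. Qed.

(** To first order the radius changes like the axis coordinate: in the factored difference of
    squares the off-axis coordinates are at most [r0], and each radius exceeds its axis coordinate
    by at most [mu]. *)
Lemma enorm_diff_axis :
  `|enorm P - enorm P' - (P 0 i1 - P' 0 i1)| <= 2 * mu * rho.
Proof.
have [r1 r1'] := (enormP_ge1, enormP'_ge1); have r00 := r0_ge0.
have rho0 : 0 <= rho := le_trans (normr_ge0 _) (Hrho i1).
have s2 : 2 <= enorm P + enorm P' by lra.
set x := P 0 i1 - P' 0 i1.
have -> : enorm P - enorm P' - x
  = (x * (P 0 i1 + P' 0 i1 - enorm P - enorm P')
    + \sum_(i | i != i1) (P 0 i - P' 0 i) * (P 0 i + P' 0 i))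
    / (enorm P + enorm P').
  have := enorm_sub_mul P P'; rewrite (bigD1 i1)//= -/x.
  set S := \sum_(i | _) _ => E.
  have -> : S = (enorm P - enorm P') * (enorm P + enorm P') - x * (P 0 i1 + P' 0 i1).
    by rewrite E; ring.
  by field; lra.
rewrite normrM normfV (ger0_norm (_ : 0 <= enorm P + enorm P')); last by lra.
rewrite ler_pdivrMr; last by lra.
have h1 : `|x * (P 0 i1 + P' 0 i1 - enorm P - enorm P')| <= rho * (2 * mu).
  rewrite normrM ler_pM//; first exact: Hrho.
  have := enorm_le_axis HP; have := enorm_le_axis HP'.
  have := le_axis_enorm P; have := le_axis_enorm P'.
  by rewrite ler_norml; lra.
have h2 : `|\sum_(i | i != i1) (P 0 i - P' 0 i) * (P 0 i + P' 0 i)| <= rho * (2 * mu).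
  apply: (le_trans (ler_norm_sum _ _ _)).
  apply: (@le_trans _ _ (\sum_(i < m) rho * (2 * r0))).
    rewrite [leRHS](bigID (fun i => i != i1))/=.
    rewrite -[leLHS]addr0 lerD//; last by apply: sumr_ge0 => i _; rewrite !mulr_ge0.
    apply: ler_sum => i ii1; rewrite normrM ler_pM//.
    have := ler_normD (P 0 i) (P' 0 i).
    have := cube_off_axis HP ii1; have := cube_off_axis HP' ii1; lra.
  rewrite sumr_const card_ord -[leLHS]mulr_natl le_eqVlt; apply/orP; left.
  by apply/eqP; ring.
apply: (le_trans (ler_normD _ _)); apply: (le_trans (lerD h1 h2)).
have mr : 0 <= mu * rho by rewrite !mulr_ge0.
have : mu * rho * 2 <= mu * rho * (enorm P + enorm P') by rewrite ler_wpM2l.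
lra.
Qed.

(** The cosine of the angle with the axis is stationary on the axis, hence the factor [mu]; the
    other direction cosines change to first order. *)
Lemma cos_axis_diff :
  `|P 0 i1 / enorm P - P' 0 i1 / enorm P'| <= 3 * mu * rho.
Proof.
have [r1 r1'] := (enormP_ge1, enormP'_ge1); have r00 := r0_ge0.
have rho0 : 0 <= rho := le_trans (normr_ge0 _) (Hrho i1).
have mu0 : 0 <= mu by rewrite mulr_ge0.
set r := enorm P; set r' := enorm P'; set x := P 0 i1 - P' 0 i1.
have -> : P 0 i1 / r - P' 0 i1 / r'
   = x * (r' - P' 0 i1) / (r * r') + - (P' 0 i1 / r') * (r - r' - x) / r.
  by rewrite /x; field; rewrite !gt_eqF//; rewrite /r /r'; lra.
have h1 : `|x * (r' - P' 0 i1) / (r * r')| <= rho * mu.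
  rewrite normrM normfV normrM.
  rewrite (ger0_norm (_ : 0 <= r * r')); last by rewrite mulr_ge0 ?enorm_ge0.
  rewrite ler_pdivrMr; last by rewrite mulr_gt0// /r /r'; lra.
  have a1 : `|x| * `|r' - P' 0 i1| <= rho * mu.
    rewrite ler_pM//; first exact: Hrho.
    have := enorm_le_axis HP'; have := le_axis_enorm P'.
    by rewrite ler_norml -/r'; lra.
  apply: (le_trans a1); rewrite ler_peMr ?mulr_ge0//.
  by rewrite -[leLHS]mulr1 ler_pM.
have h2 : `|- (P' 0 i1 / r') * (r - r' - x) / r| <= 2 * mu * rho.
  rewrite normrM normfV (ger0_norm (_ : 0 <= r)) ?enorm_ge0//.
  rewrite ler_pdivrMr; last by rewrite /r; lra.
  rewrite normrM normrN.
  have a1 : `|P' 0 i1 / r'| <= 1.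
    rewrite normrM normfV (ger0_norm (_ : 0 <= r')) ?enorm_ge0//.
    by rewrite ler_pdivrMr ?mul1r ?coord_le_enorm//; rewrite /r'; lra.
  apply: (@le_trans _ _ (1 * (2 * mu * rho))).
    by rewrite ler_pM//; exact: enorm_diff_axis.
  by rewrite mul1r ler_peMr// !mulr_ge0.
apply: (le_trans (ler_normD _ _)); apply: (le_trans (lerD h1 h2)); lra.
Qed.

Lemma cos_off_axis_diff i : i != i1 ->
  `|P 0 i / enorm P - P' 0 i / enorm P'| <= `|P 0 i - P' 0 i| + mu * rho.
Proof.
have [r1 r1'] := (enormP_ge1, enormP'_ge1); have r00 := r0_ge0.
move=> ii1.
have rho0 : 0 <= rho := le_trans (normr_ge0 _) (Hrho i1).
set r := enorm P; set r' := enorm P'.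
have rr' : 1 <= r * r' by rewrite -[leLHS]mulr1 ler_pM.
have -> : P 0 i / r - P' 0 i / r' = (P 0 i - P' 0 i) / r - P' 0 i * (r - r') / (r * r').
  by field; rewrite !gt_eqF//; rewrite /r /r'; lra.
apply: (le_trans (ler_normB _ _)); apply: lerD.
  rewrite normrM normfV (ger0_norm (_ : 0 <= r)) ?enorm_ge0//.
  by rewrite ler_pdivrMr ?ler_peMr//; rewrite /r; lra.
rewrite normrM normfV (ger0_norm (_ : 0 <= r * r')); last by lra.
rewrite ler_pdivrMr; last by lra.
apply: (@le_trans _ _ (r0 * (m%:R * rho))).
  by rewrite normrM ler_pM// ?cube_off_axis//; exact: enorm_diff_le.
rewrite mulrA (mulrC r0) ler_peMr// !mulr_ge0//.
Qed.

End TwoPoints.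

End Geometry.

(** * The gap between two translated graphs *)

(** The profiles [f] and [g] belong to two parameters at distance [d]. Derivatives are taken at
    interior radii only, where one-sided and ordinary derivatives agree; the cubes are placed so
    that all radii are interior. *)
Record pair_regular {R : realType} (t0 t1 K d : R) (f f1 f2 g g1 g2 : R -> R) :
    Prop := PairRegular {
  pair_Df : forall t, t0 < t < t1 -> is_derive t 1 f (f1 t);
  pair_Df1 : forall t, t0 < t < t1 -> is_derive t 1 f1 (f2 t);
  pair_Dg : forall t, t0 < t < t1 -> is_derive t 1 g (g1 t);
  pair_Dg1 : forall t, t0 < t < t1 -> is_derive t 1 g1 (g2 t);
  pair_g1 : forall t, t0 < t < t1 -> `|g1 t| <= K;
  pair_g2 : forall t, t0 < t < t1 -> `|g2 t| <= K;
  pair_g1_lip : forall t s, t0 < t < t1 -> t0 < s < t1 ->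
    `|g1 t - g1 s| <= K * `|t - s|;
  pair_fg1 : forall t s, t0 < t < t1 -> t0 < s < t1 ->
    `|f1 t - g1 s| <= K * (d + `|t - s|);
  pair_fg2 : forall t s, t0 < t < t1 -> t0 < s < t1 ->
    `|f2 t - g2 s| <= K * (d + `|t - s|) }.

Lemma dotZr (R : realType) (m : nat) (x y : 'rV[R]_m) (a : R) :
  dot x (a *: y) = a * dot x y.
Proof. by rewrite /dot mulr_sumr; apply: eq_bigr => i _; rewrite !mxE; ring. Qed.

Lemma dot_delta (R : realType) (m : nat) (x : 'rV[R]_m) (i : 'I_m) :
  dot x (delta_mx 0 i) = x 0 i.
Proof.
rewrite /dot (bigD1 i)//= big1 ?addr0 ?mxE ?eqxx ?mulr1// => j ji.
by rewrite mxE (negbTE ji) andbF mulr0.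
Qed.

Section Pair.
Context {R : realType} {m : nat} (i1 : 'I_m) (tm r0 t0 t1 K d : R)
  (f f1 f2 g g1 g2 : R -> R).
Hypotheses (r0_gt0 : 0 < r0) (tm_r0 : 1 <= tm - r0)
  (t0_tm : t0 < tm - r0) (tm_t1 : tm + r0 + m%:R * r0 < t1).
Hypothesis reg : pair_regular t0 t1 K d f f1 f2 g g1 g2.
Variables (xi xi' : 'rV[R]_m) (s s' : R).

Local Notation Cube := (cube (axis_point i1 tm) r0).

Definition both_cubes (X : 'rV[R]_m) : Prop := Cube (X - xi) /\ Cube (X - xi').

Definition height_gap (X : 'rV[R]_m) : R :=
  f (enorm (X - xi)) + s - (g (enorm (X - xi')) + s').

Definition gap_derive (X w : 'rV[R]_m) : R :=
  f1 (enorm (X - xi)) * (dot (X - xi) w / enorm (X - xi))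
  - g1 (enorm (X - xi')) * (dot (X - xi') w / enorm (X - xi')).

Definition radial_hess (h1 h2 : R -> R) (P w : 'rV[R]_m) : R :=
  h2 (enorm P) * (dot P w / enorm P) ^+ 2
  + h1 (enorm P) * ((dot w w - (dot P w / enorm P) ^+ 2) / enorm P).

Definition gap_derive2 (X w : 'rV[R]_m) : R :=
  radial_hess f1 f2 (X - xi) w - radial_hess g1 g2 (X - xi') w.

Lemma cube_radius (P : 'rV[R]_m) : Cube P -> t0 < enorm P < t1.
Proof.
move=> HP; have h1 := le_axis_enorm i1 P.
have h2 := enorm_le_axis (ltW r0_gt0) tm_r0 HP.
have /andP[h3 h4] := cube_axis HP.
by have := t0_tm; have := tm_t1; lra.
Qed.

Lemma cube_enorm_gt0 (P : 'rV[R]_m) : Cube P -> 0 < enorm P.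
Proof. by move=> HP; apply: lt_le_trans (cube_enorm_ge1 tm_r0 HP). Qed.

Lemma cube_convex (P P' : 'rV[R]_m) (t : R) : Cube P -> Cube P' -> 0 <= t <= 1 ->
  Cube (P + t *: (P' - P)).
Proof.
move=> HP HP' /andP[t0' t1'] i; have := HP i; have := HP' i.
rewrite !mxE !ler_norml; set a := P 0 i; set b := P' 0 i; set q := (if _ then _ else _).
move=> /andP[b1 b2] /andP[a1 a2].
have := ler_wpM2l t0' b1; have := ler_wpM2l t0' b2.
have t1'' : 0 <= 1 - t by lra.
have := ler_wpM2l t1'' a1; have := ler_wpM2l t1'' a2.
lra.
Qed.

Lemma both_cubes_convex (X Y : 'rV[R]_m) (t : R) : both_cubes X -> both_cubes Y ->
  0 <= t <= 1 -> both_cubes (X + t *: (Y - X)).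
Proof.
have E (c : 'rV[R]_m) : X - c + t *: (Y - c - (X - c)) = X + t *: (Y - X) - c.
  by apply/rowP => k; rewrite !mxE; ring.
by move=> [X1 X2] [Y1 Y2] t01; split; rewrite -E; exact: cube_convex.
Qed.

Lemma is_derive_gap (X w : 'rV[R]_m) (t : R) : both_cubes (X + t *: w) ->
  is_derive t 1 (fun u : R => height_gap (X + u *: w)) (gap_derive (X + t *: w) w).
Proof.
rewrite /both_cubes /height_gap /gap_derive => -[].
rewrite ![X + t *: w - _]addrAC => C1 C2.
have -> : (fun u : R => f (enorm (X + u *: w - xi)) + s - (g (enorm (X + u *: w - xi')) + s'))
    = (fun u : R => f (enorm (X - xi + u *: w)) + s - (g (enorm (X - xi' + u *: w)) + s')).
  by apply/funext => u; rewrite ![X + u *: w - _]addrAC.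
have D1 := is_derive_radial (cube_enorm_gt0 C1) (pair_Df reg (cube_radius C1)).
have D2 := is_derive_radial (cube_enorm_gt0 C2) (pair_Dg reg (cube_radius C2)).
have := is_deriveB (is_deriveD D1 (is_derive_cst s _ _))
                   (is_deriveD D2 (is_derive_cst s' _ _)).
by move/is_derive_eq; apply; rewrite !addr0.
Qed.

Lemma is_derive_gap2 (X w : 'rV[R]_m) (t : R) : both_cubes (X + t *: w) ->
  is_derive t 1 (fun u : R => gap_derive (X + u *: w) w) (gap_derive2 (X + t *: w) w).
Proof.
rewrite /both_cubes /gap_derive2 /gap_derive /radial_hess => -[].
rewrite ![X + t *: w - _]addrAC => C1 C2.
under eq_fun do rewrite ![X + _ *: w - _]addrAC.
exact: (is_deriveB (is_derive_radial2 (cube_enorm_gt0 C1) (pair_Df1 reg (cube_radius C1)))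
  (is_derive_radial2 (cube_enorm_gt0 C2) (pair_Dg1 reg (cube_radius C2)))).
Qed.

Lemma gap_line_ge (i : 'I_m) (D u : R) (X : 'rV[R]_m) :
  (forall Z, both_cubes Z -> D <= `|gap_derive Z (delta_mx 0 i)|) ->
  both_cubes X -> both_cubes (X + u *: delta_mx 0 i) ->
  D * `|u| <= `|height_gap (X + u *: delta_mx 0 i) - height_gap X|.
Proof.
move=> HD QX QY; set w := u *: delta_mx 0 i.
have Dt (t : R) : 0 <= t <= 1 -> both_cubes (X + t *: w).
  move=> t01; have := both_cubes_convex QX QY t01.
  by rewrite [X + u *: _ - X]addrC addKr.
have [t /Dt Qt] := mean_value ler01 (fun t t01 => is_derive_gap (Dt t t01)).
rewrite scale1r scale0r addr0 subr0 mulr1 => ->.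
rewrite /gap_derive !dotZr.
set a := f1 _; set b := g1 _; set x := dot _ _; set y := dot _ _.
set r := enorm _; set r' := enorm _.
have -> : a * (u * x / r) - b * (u * y / r') = (a * (x / r) - b * (y / r')) * u by ring.
by rewrite normrM ler_wpM2r// HD.
Qed.

Section Counts.
Context {p : nat} (h : R) (z : 'rV[int]_m).
Hypothesis h_gt0 : 0 < h.

Definition close_points : pred {ffun 'I_m -> 'I_p} := [pred t |
  let X := lattice h (block z t) in
  `[< [/\ Cube (X - xi), Cube (X - xi') & `|height_gap X| <= h] >]].

Lemma lattice_update (t : {ffun 'I_m -> 'I_p}) (i : 'I_m) (v w : 'I_p) :
  lattice h (block z (update t i w))
    = lattice h (block z (update t i v)) + (h * (w%:R - v%:R)) *: delta_mx 0 i :> 'rV[R]_m.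
Proof.
apply/rowP => k; rewrite !mxE !ffunE !rmorphD/= -!pmulrn.
by case: eqP => _ /=; ring.
Qed.

(** Two close points on a line in direction [i] have gaps that differ by at most [2 * h], so they
    are at most [2 / D] lattice steps apart. *)
Lemma count_line (i : 'I_m) (D : R) : 0 < D ->
  (forall Z, both_cubes Z -> D <= `|gap_derive Z (delta_mx 0 i)|) ->
  #|close_points|%:R * p%:R <= (1 + 2 / D) * p%:R ^+ m.
Proof.
move=> D0 HD; apply: card_lines => t; apply: card_gaps.
  by rewrite divr_ge0// ltW.
move=> v w /asboolP[Q1 Q2 Fv] /asboolP[Q1' Q2' Fw] vw.
have := @gap_line_ge i D (h * (w%:R - v%:R)) (lattice h (block z (update t i v))) HD.
rewrite -lattice_update => /(_ (conj Q1 Q2) (conj Q1' Q2')).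
have wv : 0 <= w%:R - v%:R :> R by rewrite subr_ge0 ler_nat.
have h0 := h_gt0.
rewrite normrM (gtr0_norm h0) (ger0_norm wv) ler_pdivlMr// => H.
have H2 := le_trans H (ler_normB _ _).
by rewrite -(ler_pM2l h0); lra.
Qed.

(** Coordinates [i] and [j] of the grid point are reset to the corner of the block, so that
    [in_plane] can put real numbers in their place. *)
Let base (i j : 'I_m) (t : {ffun 'I_m -> 'I_p}) : 'rV[R]_m :=
  \row_k (h * ((z 0 k)%:~R + (if (k == i) || (k == j) then 0 else (t k)%:R))).

Let in_plane (i j : 'I_m) t (x y : R) : 'rV[R]_m :=
  base i j t + (h * x) *: delta_mx 0 i + (h * y) *: delta_mx 0 j.

Let lattice_in_plane (i j : 'I_m) t (v w : 'I_p) : i != j ->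
  lattice h (block z (update (update t i v) j w)) = in_plane i j t v%:R w%:R.
Proof.
move=> ij; apply/rowP => k; rewrite !mxE !ffunE rmorphD/= -pmulrn.
case: (altP (k =P j)) => [->|kj].
  by rewrite eq_sym (negbTE ij)/=; ring.
by case: (altP (k =P i)) => [_|ki]/=; ring.
Qed.

Lemma count_plane (i j : 'I_m) (sigma c : R) : i != j -> `|sigma| = 1 -> 0 < c ->
  (forall (Z w : 'rV[R]_m), both_cubes Z -> (forall k, k != i -> k != j -> w 0 k = 0) ->
    2 * c * dot w w <= sigma * gap_derive2 Z w) ->
  #|close_points|%:R * p%:R ^+ 2 <= (2 * p%:R + 40 / (c * h) + 18) * p%:R ^+ m.
Proof.
move=> ij sigma1 c0 Hc; have h0 := h_gt0; apply: (@card_planes R m p _ i j) => t.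
pose Q x y := both_cubes (in_plane i j t x y).
(* After division by [h] the shell is [|G| <= 1]. In lattice units the convexity constant becomes
   [c * h ^ 2 / h = c * h]. *)
pose G x y := sigma * height_gap (in_plane i j t x y) / h.
have := @convex_count R p (c * h) Q G (mulr_gt0 c0 h0).
have scG : strongly_convex2 (c * h) Q G.
  move=> x y x' y' u Qxy Qxy' u01; rewrite /Q /G.
  pose Z := in_plane i j t x y; pose Z' := in_plane i j t x' y'.
  have ZE : in_plane i j t (x + u * (x' - x)) (y + u * (y' - y)) = Z + u *: (Z' - Z).
    by apply/rowP => k; rewrite !mxE; ring.
  rewrite ZE; split; first exact: both_cubes_convex.
  set w := Z' - Z.
  have wE : w = (h * (x' - x)) *: delta_mx 0 i + (h * (y' - y)) *: delta_mx 0 j.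
    by apply/rowP => k; rewrite !mxE; ring.
  have ww : dot w w = h ^+ 2 * ((x' - x) ^+ 2 + (y' - y) ^+ 2).
    rewrite wE /dot (bigD1 i)//= (bigD1 j) 1?eq_sym//= big1 => [|k /andP[ki kj]].
      by rewrite !mxE !eqxx (negbTE ij) eq_sym (negbTE ij)/=; ring.
    by rewrite !mxE (negbTE ki) (negbTE kj)/=; ring.
  have Zt (v : R) : 0 <= v <= 1 -> both_cubes (Z + v *: w) by exact: both_cubes_convex.
  have D1 (v : R) : 0 <= v <= 1 ->
      is_derive v 1 (fun r : R => sigma * height_gap (Z + r *: w))
        (sigma * gap_derive (Z + v *: w) w).
    by move=> v01; apply: is_deriveZ; apply: is_derive_gap; exact: Zt.
  have D2 (v : R) : 0 <= v <= 1 ->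
      is_derive v 1 (fun r : R => sigma * gap_derive (Z + r *: w) w)
        (sigma * gap_derive2 (Z + v *: w) w).
    by move=> v01; apply: is_deriveZ; apply: is_derive_gap2; exact: Zt.
  have D3 (v : R) : 0 <= v <= 1 -> 2 * (c * dot w w) <= sigma * gap_derive2 (Z + v *: w) w.
    move=> v01; rewrite mulrA; apply: Hc; first exact: Zt.
    by move=> k ki kj; rewrite wE !mxE (negbTE ki) (negbTE kj) !mulr0 addr0.
  have := strongly_convex_of_derive2 D1 D2 D3 u01.
  rewrite scale0r addr0 scale1r (_ : Z + w = Z'); last by rewrite /w addrC subrK.
  rewrite ww => H; rewrite ler_pdivrMr//.
  apply: (le_trans H); rewrite le_eqVlt; apply/orP; left; apply/eqP.
  by rewrite -/Z -/Z'; field; rewrite gt_eqF.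
move=> /(_ scG); apply: le_trans; apply: ler_sum => v _; rewrite ler_nat.
apply: subset_leq_card; apply/fintype.subsetP => w /asboolP[].
rewrite lattice_in_plane// => Q1 Q2 Fh; apply/asboolP; split=> //.
by rewrite /G normrM normfV (gtr0_norm h0) normrM sigma1 mul1r ler_pdivrMr ?mul1r.
Qed.

End Counts.
End Pair.

(** * ** * Lower bounds for the first derivative of the gap *)

Lemma ler_dist_normD (R : realType) (x y a b : R) : a <= `|x| -> `|y| <= b ->
  a - b <= `|x + y|.
Proof.
move=> xa yb; have := ler_normB (x + y) y; rewrite addrK.
by move=> h; rewrite lerBlDr; apply: le_trans xa (le_trans h _); rewrite lerD2l.
Qed.

Section Cases.
Context {R : realType} {m : nat} (i1 : 'I_m) (tm r0 t0 t1 K K2 d rho cg : R)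
  (f f1 f2 g g1 g2 : R -> R).
Hypotheses (r0_gt0 : 0 < r0) (tm_r0 : 1 <= tm - r0)
  (t0_tm : t0 < tm - r0) (tm_t1 : tm + r0 + m%:R * r0 < t1) (t1_le2 : t1 <= 2).
Hypothesis reg : pair_regular t0 t1 K d f f1 f2 g g1 g2.
Variables (xi xi' : 'rV[R]_m).
Hypotheses (K_gt0 : 0 < K) (Hxi : forall i, `|xi' 0 i - xi 0 i| <= rho).
Hypothesis mu_small : m%:R * r0 <= 1 / 4.

Local Notation mu := (m%:R * r0).
Local Notation Q := (both_cubes i1 tm r0 xi xi').
Local Notation r X := (enorm (X - xi)).
Local Notation r' X := (enorm (X - xi')).
Local Notation x1 := (xi' 0 i1 - xi 0 i1).
Local Notation slope_gap X := (f1 (r X) - g1 (r' X)).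

Let m_ge1 : 1 <= m%:R :> R.
Proof. by rewrite ler1n; case: (m) i1 => // -[]. Qed.

Let rho_ge0 : 0 <= rho. Proof. exact: le_trans (normr_ge0 _) (Hxi i1). Qed.

Let shift X i : (X - xi) 0 i - (X - xi') 0 i = xi' 0 i - xi 0 i.
Proof. by rewrite !mxE; ring. Qed.

Let shift_le X i : `|(X - xi) 0 i - (X - xi') 0 i| <= rho.
Proof. by rewrite shift. Qed.

Let radius_itv X : Q X -> [/\ t0 < r X < t1, t0 < r' X < t1, 1 <= r X <= 2
  & 1 <= r' X <= 2].
Proof.
move=> [C1 C2]; have := cube_radius r0_gt0 tm_r0 t0_tm tm_t1 C1.
have := cube_radius r0_gt0 tm_r0 t0_tm tm_t1 C2.
have := cube_enorm_ge1 tm_r0 C1; have := cube_enorm_ge1 tm_r0 C2.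
have := t1_le2 => h *; split; lra.
Qed.

Let diff_le X : Q X -> `|r X - r' X| <= m%:R * rho.
Proof. by move=> [C1 C2]; exact: (enorm_diff_le (ltW r0_gt0) tm_r0 C1 C2 (shift_le X)). Qed.

Let diff_axis X : Q X -> `|r X - r' X - x1| <= 2 * mu * rho.
Proof.
move=> [C1 C2]; have := enorm_diff_axis (ltW r0_gt0) tm_r0 C1 C2 (shift_le X).
by rewrite shift.
Qed.

Let cos_axis X : Q X ->
  `|(X - xi) 0 i1 / r X - (X - xi') 0 i1 / r' X| <= 3 * mu * rho.
Proof.
by move=> [C1 C2]; exact: (cos_axis_diff (ltW r0_gt0) tm_r0 C1 C2 (shift_le X)).
Qed.

Let cos_ge X : Q X -> 1 / 2 <= (X - xi) 0 i1 / r X.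
Proof.
move=> QX; have [_ _ /andP[r1 r2] _] := radius_itv QX; case: QX => C1 _.
rewrite ler_pdivlMr; last by lra.
have := enorm_le_axis (ltW r0_gt0) tm_r0 C1; have := mu_small; lra.
Qed.

Let gap_derive_delta X i : gap_derive f1 g1 xi xi' X (delta_mx 0 i)
  = f1 (r X) * ((X - xi) 0 i / r X) - g1 (r' X) * ((X - xi') 0 i / r' X).
Proof. by rewrite /gap_derive !dot_delta. Qed.

(** The main term compares the two slopes at one radius, with a cosine of at least 1/2. The change
    of radius and the change of cosine cost at most [K m rho] each, together at most a sixth of
    [lambda d]. *)
Lemma gap_axis_ge_of_close (lambda : R) X :
  (forall t, t0 < t < t1 -> lambda * d <= `|f1 t - g1 t|) -> 0 <= lambda -> 0 <= d ->
  12 * K * m%:R * rho <= lambda * d -> Q X ->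
  lambda * d / 4 <= `|gap_derive f1 g1 xi xi' X (delta_mx 0 i1)|.
Proof.
move=> Hl l0 d0 close QX; rewrite gap_derive_delta.
have [J J' /andP[r1 r2] /andP[r1' r2']] := radius_itv QX.
set a := (X - xi) 0 i1 / r X; set a' := (X - xi') 0 i1 / r' X.
have -> : f1 (r X) * a - g1 (r' X) * a'
    = (f1 (r X) - g1 (r X)) * a + ((g1 (r X) - g1 (r' X)) * a + g1 (r' X) * (a - a')).
  by ring.
have a1 : 1 / 2 <= a by exact: cos_ge.
have a_le1 : a <= 1.
  rewrite ler_pdivrMr ?mul1r; last by lra.
  exact: le_trans (ler_norm _) (coord_le_enorm _ _).
have h1 : lambda * d / 2 <= `|(f1 (r X) - g1 (r X)) * a|.
  rewrite normrM (ger0_norm (_ : 0 <= a)); last by lra.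
  apply: (@le_trans _ _ (lambda * d * a)); last by rewrite ler_wpM2r ?Hl//; lra.
  by rewrite ler_wpM2l// ?mulr_ge0//; lra.
have h2 : `|(g1 (r X) - g1 (r' X)) * a| <= K * m%:R * rho.
  rewrite normrM (ger0_norm (_ : 0 <= a)); last by lra.
  apply: (@le_trans _ _ (`|g1 (r X) - g1 (r' X)| * 1)); first by rewrite ler_wpM2l.
  rewrite mulr1; apply: (le_trans (pair_g1_lip reg J J')).
  by rewrite -mulrA ler_wpM2l ?(ltW K_gt0)// diff_le.
have Kr : 0 <= K * rho by rewrite mulr_ge0// ltW.
have h3 : `|g1 (r' X) * (a - a')| <= K * m%:R * rho.
  rewrite normrM; apply: (@le_trans _ _ (K * (3 * mu * rho))).
    by rewrite ler_pM//; [exact: (pair_g1 reg)|exact: cos_axis].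
  have : K * rho * (3 * mu) <= K * rho * m%:R.
    by rewrite ler_wpM2l//; have := mu_small; have := m_ge1; lra.
  lra.
have h23 := le_trans (ler_normD _ _) (lerD h2 h3).
have ld : 0 <= lambda * d by rewrite mulr_ge0.
by apply: le_trans (ler_dist_normD h1 h23); lra.
Qed.

(** From here on [d] is at most a multiple of [rho], so differences between the two profiles are
    [O(rho)]. *)
Hypotheses (K_K2 : K <= K2) (far : K * (d + m%:R * rho) <= K2 * rho) (d_ge0 : 0 <= d).

Let slope_gap_le X : Q X -> `|slope_gap X| <= K2 * rho.
Proof.
move=> QX; have [J J' _ _] := radius_itv QX.
apply: le_trans far; apply: (le_trans (pair_fg1 reg J J')).
by rewrite ler_wpM2l ?(ltW K_gt0)// lerD2l diff_le.
Qed.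

Let Kmrho_le : K * (m%:R * rho) <= K2 * rho.
Proof.
by apply: le_trans far; rewrite ler_wpM2l ?(ltW K_gt0)// lerDr.
Qed.

(** Off the axis the coordinate [P] is at most [mu]. The [O(rho)] difference [w] of the factors
    slope over radius enters only through [P * w], and the shift [P - P'] dominates. *)
Lemma gap_off_axis_ge (c3 : R) i X : i != i1 ->
  (forall t, t0 < t < t1 -> cg <= `|g1 t|) -> 0 <= cg -> 0 <= c3 ->
  c3 * rho <= `|xi' 0 i - xi 0 i| ->
  8 * K2 * mu <= cg * c3 -> Q X ->
  cg * c3 * rho / 4 <= `|gap_derive f1 g1 xi xi' X (delta_mx 0 i)|.
Proof.
move=> ii1 Hcg cg0 c30 Hi small QX; rewrite gap_derive_delta.
have [J J' /andP[r1 r2] /andP[r1' r2']] := radius_itv QX.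
set P := (X - xi) 0 i; set P' := (X - xi') 0 i.
have PP' : P - P' = xi' 0 i - xi 0 i by exact: shift.
pose w := f1 (r X) / r X - g1 (r' X) / r' X.
have -> : f1 (r X) * (P / r X) - g1 (r' X) * (P' / r' X)
    = g1 (r' X) * (P - P') / r' X + P * w.
  by rewrite /w; ring.
have h1 : cg * c3 * rho / 2 <= `|g1 (r' X) * (P - P') / r' X|.
  rewrite normrM normfV normrM (ger0_norm (_ : 0 <= r' X)) ?enorm_ge0//.
  rewrite ler_pdivlMr; last by lra.
  have : cg * (c3 * rho) <= `|g1 (r' X)| * `|P - P'|.
    by rewrite ler_pM ?mulr_ge0// ?PP'// Hcg.
  have : cg * c3 * rho * r' X <= cg * c3 * rho * 2.
    by rewrite ler_wpM2l// !mulr_ge0.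
  lra.
have w_le : `|w| <= 2 * K2 * rho.
  have -> : w = slope_gap X / r X - g1 (r' X) * (r X - r' X) / (r X * r' X).
    by rewrite /w; field; lra.
  apply: (le_trans (ler_normB _ _)).
  have rr' : 1 <= r X * r' X by rewrite -[leLHS]mulr1 ler_pM.
  have a1 : `|slope_gap X / r X| <= K2 * rho.
    rewrite normrM normfV (ger0_norm (_ : 0 <= r X)) ?enorm_ge0//.
    rewrite ler_pdivrMr; last by lra.
    apply: (le_trans (slope_gap_le QX)); rewrite ler_peMr//.
    exact: le_trans (normr_ge0 _) (slope_gap_le QX).
  have a2 : `|g1 (r' X) * (r X - r' X) / (r X * r' X)| <= K2 * rho.
    rewrite normrM normfV (ger0_norm (_ : 0 <= r X * r' X)); last by lra.
    rewrite ler_pdivrMr; last by lra.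
    apply: (@le_trans _ _ (K2 * rho * 1)); last first.
      by rewrite ler_wpM2l// (le_trans (normr_ge0 _) (slope_gap_le QX)).
    rewrite mulr1; apply: le_trans Kmrho_le.
    by rewrite normrM ler_pM//; [exact: (pair_g1 reg)|exact: diff_le].
  lra.
have h2 : `|P * w| <= cg * c3 * rho / 4.
  have P_le : `|P| <= mu.
    case: QX => C1 _; apply: (le_trans (cube_off_axis C1 ii1)).
    by rewrite ler_peMl// ltW.
  rewrite normrM; apply: (@le_trans _ _ (mu * (2 * K2 * rho))).
    by rewrite ler_pM.
  have := ler_wpM2r rho_ge0 small; lra.
by apply: le_trans (ler_dist_normD h1 h2); lra.
Qed.

Let radius_range X Y : Q X -> Q Y -> `|r X - r Y| <= 4 * mu /\ `|r' X - r' Y| <= 4 * mu.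
Proof.
have r0mu : r0 <= mu by rewrite ler_peMl// ltW.
have := r0_gt0 => r00.
move=> [X1 X2] [Y1 Y2]; split.
  have := cube_axis X1; have := cube_axis Y1.
  have := enorm_le_axis (ltW r0_gt0) tm_r0 X1.
  have := enorm_le_axis (ltW r0_gt0) tm_r0 Y1.
  have := le_axis_enorm i1 (X - xi); have := le_axis_enorm i1 (Y - xi).
  by rewrite ler_norml; lra.
have := cube_axis X2; have := cube_axis Y2.
have := enorm_le_axis (ltW r0_gt0) tm_r0 X2.
have := enorm_le_axis (ltW r0_gt0) tm_r0 Y2.
have := le_axis_enorm i1 (X - xi'); have := le_axis_enorm i1 (Y - xi').
by rewrite ler_norml; lra.
Qed.

(** Both radii are interpolated linearly between their values at [Y] and at [X], and the mean value
    theorem is applied in the interpolation parameter. The increments [b] and [b'] are at most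
    [4 mu], and they differ by at most [4 mu rho] because [r - r'] stays within [2 mu rho] of the
    axis shift. A large slope gap at one point thus spreads to all others. *)
Lemma slope_gap_osc X Y : Q X -> Q Y ->
  `|slope_gap X - slope_gap Y| <= 8 * K2 * mu * rho.
Proof.
move=> QX QY; have [JX JX' _ _] := radius_itv QX; have [JY JY' _ _] := radius_itv QY.
have [XY XY'] := radius_range QX QY.
set b := r X - r Y in XY *; set b' := r' X - r' Y in XY' *.
pose L u : R := r Y + u * b; pose L' u : R := r' Y + u * b'.
have dL (u : R) : is_derive u 1 L b.
  by apply: is_derive_eq; rewrite /GRing.scale/=; ring.
have dL' (u : R) : is_derive u 1 L' b'.
  by apply: is_derive_eq; rewrite /GRing.scale/=; ring.
have inJ (a c u : R) : t0 < a < t1 -> t0 < c < t1 -> 0 <= u <= 1 ->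
    t0 < c + u * (a - c) < t1.
  move=> /andP[a0 a1] /andP[c0 c1] /andP[u0 u1].
  have -> : c + u * (a - c) = (1 - u) * c + u * a by ring.
  have [->|u_neq0] := eqVneq u 0; first by rewrite subr0 mul1r mul0r addr0 c0.
  have u_gt0 : 0 < u by rewrite lt_neqAle eq_sym u_neq0.
  have u1' : 0 <= 1 - u by lra.
  have := ler_wpM2l u1' (ltW c0); have := ler_wpM2l u1' (ltW c1).
  rewrite -(ltr_pM2l u_gt0) in a0; rewrite -(ltr_pM2l u_gt0) in a1.
  lra.
have Dv (u : R) : 0 <= u <= 1 -> is_derive u 1 (fun u => f1 (L u) - g1 (L' u))
    (f2 (L u) * b - g2 (L' u) * b').
  move=> u01; apply: is_deriveB.
    exact: (@is_derive1_comp R f1 L u _ _ (pair_Df1 reg (inJ _ _ _ JX JY u01)) (dL u)).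
  exact: (@is_derive1_comp R g1 L' u _ _ (pair_Dg1 reg (inJ _ _ _ JX' JY' u01)) (dL' u)).
have [u u01] := mean_value ler01 Dv.
rewrite {1 2}/L {1 2}/L' !mul1r !mul0r !addr0 /b /b' ![r Y + _]addrC ![r' Y + _]addrC !subrK.
rewrite -/b -/b' subr0 mulr1 => ->.
have JL := inJ _ _ _ JX JY u01; have JL' := inJ _ _ _ JX' JY' u01.
rewrite -/b in JL; rewrite -/b' in JL'; rewrite -/(L u) in JL; rewrite -/(L' u) in JL'.
have -> : f2 (L u) * b - g2 (L' u) * b' = (f2 (L u) - g2 (L' u)) * b + g2 (L' u) * (b - b').
  by ring.
apply: (le_trans (ler_normD _ _)); rewrite !normrM.
have mr : 0 <= m%:R * rho by rewrite mulr_ge0.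
have LL' : `|L u - L' u| <= m%:R * rho.
  have -> : L u - L' u = (1 - u) * (r Y - r' Y) + u * (r X - r' X).
    by rewrite /L /L' /b /b'; ring.
  case/andP: u01 => u0 u1; have u1' : 0 <= 1 - u by lra.
  apply: (le_trans (ler_normD _ _)); rewrite !normrM (ger0_norm u0) (ger0_norm u1').
  have := ler_wpM2l u1' (diff_le QY); have := ler_wpM2l u0 (diff_le QX); lra.
have h1 : `|f2 (L u) - g2 (L' u)| * `|b| <= K2 * rho * (4 * mu).
  rewrite ler_pM//; apply: le_trans far; apply: (le_trans (pair_fg2 reg JL JL')).
  by rewrite ler_wpM2l ?(ltW K_gt0)// lerD2l.
have h2 : `|g2 (L' u)| * `|b - b'| <= K2 * (4 * mu * rho).
  rewrite ler_pM//; first exact: le_trans (pair_g2 reg JL') K_K2.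
  have -> : b - b' = (r X - r' X - x1) - (r Y - r' Y - x1) by rewrite /b /b'; ring.
  apply: (le_trans (ler_normB _ _)).
  have := diff_axis QX; have := diff_axis QY; lra.
lra.
Qed.

(** The oscillation costs at most a third of [c4 rho], the cosine at most halves the rest, and the
    change of cosine costs an eighth. *)
Lemma gap_axis_ge_of_slope (c4 : R) X Y : Q X -> Q Y ->
  c4 * rho <= `|slope_gap Y| -> 24 * K2 * mu <= c4 ->
  c4 * rho / 8 <= `|gap_derive f1 g1 xi xi' X (delta_mx 0 i1)|.
Proof.
move=> QX QY HY small; rewrite gap_derive_delta.
have [J J' /andP[r1 r2] /andP[r1' r2']] := radius_itv QX.
set a := (X - xi) 0 i1 / r X; set a' := (X - xi') 0 i1 / r' X.
have -> : f1 (r X) * a - g1 (r' X) * a' = slope_gap X * a + g1 (r' X) * (a - a').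
  by ring.
have small' := ler_wpM2r rho_ge0 small.
have mr : 0 <= mu * rho by rewrite !mulr_ge0// ltW.
have gapX : c4 * rho * (2 / 3) <= `|slope_gap X|.
  have := ler_dist_normD HY (slope_gap_osc QX QY).
  rewrite [X in `|X|]addrC subrK; lra.
have a1 : 1 / 2 <= a by exact: cos_ge.
have h1 : c4 * rho / 3 <= `|slope_gap X * a|.
  rewrite normrM (ger0_norm (_ : 0 <= a)); last by lra.
  apply: (@le_trans _ _ (`|slope_gap X| * (1 / 2))); first by lra.
  by rewrite ler_wpM2l.
have h2 : `|g1 (r' X) * (a - a')| <= c4 * rho / 8.
  rewrite normrM; apply: (@le_trans _ _ (K2 * (3 * mu * rho))).
    rewrite ler_pM//; [exact: le_trans (pair_g1 reg J') K_K2|exact: cos_axis].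
  lra.
have c4r : 0 <= c4 * rho.
  apply: le_trans small'; rewrite mulr_ge0// !mulr_ge0//.
    exact: le_trans (ltW K_gt0) K_K2.
  exact: ltW.
by apply: le_trans (ler_dist_normD h1 h2); lra.
Qed.

End Cases.

(** * ** * Lower bound for the second derivative of the gap *)

Lemma dotZl (R : realType) (m : nat) (x y : 'rV[R]_m) (a : R) :
  dot (a *: x) y = a * dot x y.
Proof. by rewrite dotC dotZr dotC. Qed.

Lemma dot_diff_le (R : realType) (m : nat) (x y w : 'rV[R]_m) (e : R) :
  (forall i, `|x 0 i - y 0 i| <= e) ->
  `|dot x w - dot y w| <= m%:R * e * enorm w.
Proof.
move=> xy; rewrite /dot -sumrB; apply: (le_trans (ler_norm_sum _ _ _)).
apply: (@le_trans _ _ (\sum_(i < m) e * enorm w)).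
  apply: ler_sum => i _; rewrite -mulrBl normrM.
  by rewrite ler_pM// coord_le_enorm.
by rewrite sumr_const card_ord -[leLHS]mulr_natl mulrA.
Qed.

Section Hessian.
Context {R : realType} {m : nat} (i1 : 'I_m) (tm r0 t0 t1 K K2 d rho cg : R)
  (f f1 f2 g g1 g2 : R -> R).
Hypotheses (r0_gt0 : 0 < r0) (tm_r0 : 1 <= tm - r0)
  (t0_tm : t0 < tm - r0) (tm_t1 : tm + r0 + m%:R * r0 < t1) (t1_le2 : t1 <= 2).
Hypothesis reg : pair_regular t0 t1 K d f f1 f2 g g1 g2.
Variables (xi xi' : 'rV[R]_m).
Hypotheses (K_gt0 : 0 < K) (Hxi : forall i, `|xi' 0 i - xi 0 i| <= rho).
Hypothesis mu_small : m%:R * r0 <= 1 / 4.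

Local Notation mu := (m%:R * r0).
Local Notation Q := (both_cubes i1 tm r0 xi xi').
Local Notation r X := (enorm (X - xi)).
Local Notation r' X := (enorm (X - xi')).
Local Notation x1 := (xi' 0 i1 - xi 0 i1).

(* The three terms are the radial part, the tangential part, and the error due to the
   two radial directions being different. *)
Lemma gap_derive2E (X w : 'rV[R]_m) : Q X ->
  gap_derive2 f1 f2 g1 g2 xi xi' X w =
    (f2 (r X) - g2 (r' X)) * (dot (X - xi) w / r X) ^+ 2
    + ((f1 (r X) - g1 (r' X)) / r X - g1 (r' X) * (r X - r' X) / (r X * r' X))
      * (dot w w - (dot (X - xi) w / r X) ^+ 2)
    + (g2 (r' X) - g1 (r' X) / r' X)
      * ((dot (X - xi) w / r X) ^+ 2 - (dot (X - xi') w / r' X) ^+ 2).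
Proof.
move=> [C1 C2]; rewrite /gap_derive2 /radial_hess.
have h1 := cube_enorm_ge1 tm_r0 C1; have h2 := cube_enorm_ge1 tm_r0 C2.
set n := dot _ _ / r X; set n' := dot _ _ / r' X.
by field; rewrite !gt_eqF//; lra.
Qed.

(** In the tangential coefficient the term with [r - r'], close to the axis shift, contributes at
    least [cg rho / 8] with sign [sigma], and the slope gap takes away at most half of it. The
    radial term is small if [w] is orthogonal to the axis and has the right sign in the other
    alternative. The difference of the radial directions costs [c6 rho |w| ^ 2]. *)
Lemma gap_derive2_ge (c3 c4 c6 sigma : R) (X w : 'rV[R]_m) :
  K <= K2 -> `|f2 (r X) - g2 (r' X)| <= K2 * rho -> `|f1 (r X) - g1 (r' X)| <= c4 * rho ->
  (forall i, i != i1 -> `|xi' 0 i - xi 0 i| <= c3 * rho) ->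
  `|sigma| = 1 -> cg * rho <= - (sigma * g1 (r' X) * x1) ->
  0 <= c3 -> 0 < cg -> 0 < c6 -> c4 <= cg / 16 -> 4 * K * mu <= cg ->
  4 * K * m%:R * (c3 + 3 * mu) <= c6 -> K2 * mu <= c6 -> c6 <= cg / 96 ->
  w 0 i1 = 0 \/ 2 * c6 * rho <= sigma * (f2 (r X) - g2 (r' X)) -> Q X ->
  c6 * rho * dot w w <= sigma * gap_derive2 f1 f2 g1 g2 xi xi' X w.
Proof.
move=> KK2 curv slope off sigma1 sg c30 cg0 c60 c4cg mucg small1 small2 c6cg alt QX.
have rho0 : 0 <= rho := le_trans (normr_ge0 _) (Hxi i1).
have r00 := r0_gt0; have K0 := K_gt0.
have mu0 : 0 <= mu by rewrite mulr_ge0// ltW.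
rewrite gap_derive2E//; case: (QX) => C1 C2.
have J := cube_radius r0_gt0 tm_r0 t0_tm tm_t1 C1.
have J' := cube_radius r0_gt0 tm_r0 t0_tm tm_t1 C2.
have r1 := cube_enorm_ge1 tm_r0 C1; have r1' := cube_enorm_ge1 tm_r0 C2.
have [r_gt0 r_gt0'] : 0 < r X /\ 0 < r' X.
  by split; apply: lt_le_trans ltr01 _.
have [r2 r2'] : r X <= 2 /\ r' X <= 2.
  by have := t1_le2; split; lra.
have shift i : (X - xi) 0 i - (X - xi') 0 i = xi' 0 i - xi 0 i by rewrite !mxE; ring.
have shift_le i : `|(X - xi) 0 i - (X - xi') 0 i| <= rho by rewrite shift.
have n_le : (dot (X - xi) w / r X) ^+ 2 <= dot w w by apply: dot_sqr_le; lra.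
have n_le' : (dot (X - xi') w / r' X) ^+ 2 <= dot w w by apply: dot_sqr_le; lra.
have nn' : `|dot (X - xi) w / r X - dot (X - xi') w / r' X|
    <= m%:R * ((c3 + 3 * mu) * rho) * enorm w.
  rewrite (mulrC (dot (X - xi) w)) (mulrC (dot (X - xi') w)) -!dotZl.
  apply: dot_diff_le => i.
  rewrite [((_)^-1 *: (X - xi)) 0 i]mxE [((_)^-1 *: (X - xi')) 0 i]mxE.
  rewrite ![_^-1 * _ 0 i]mulrC.
  have c3r : 0 <= c3 * rho by rewrite mulr_ge0.
  have mur : 0 <= mu * rho by rewrite mulr_ge0.
  have [->|ii1] := eqVneq i i1.
    apply: (le_trans (cos_axis_diff (ltW r0_gt0) tm_r0 C1 C2 shift_le)); lra.
  apply: (le_trans (cos_off_axis_diff (ltW r0_gt0) tm_r0 C1 C2 shift_le ii1)).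
  by rewrite shift; have := off i ii1; lra.
have diff := enorm_diff_axis (ltW r0_gt0) tm_r0 C1 C2 shift_le.
rewrite shift in diff.
have wE := sqr_enorm w.
have w0 := enorm_ge0 w.
have g1K := pair_g1 reg J'; have g2K := pair_g2 reg J'.
have alt_n : w 0 i1 = 0 -> `|dot (X - xi) w / r X| <= mu * enorm w.
  move=> w1; rewrite normrM normfV (ger0_norm (_ : 0 <= r X)) ?enorm_ge0//.
  rewrite ler_pdivrMr//.
  apply: (@le_trans _ _ (mu * enorm w)); last first.
    by apply: ler_peMr => //; apply: mulr_ge0.
  apply: (le_trans (ler_norm_sum _ _ _)).
  apply: (@le_trans _ _ (\sum_(i < m) r0 * enorm w)).
    apply: ler_sum => i _; have [->|ii1] := eqVneq i i1.
      by rewrite w1 mulr0 normr0 mulr_ge0// ltW.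
    by rewrite normrM ler_pM ?coord_le_enorm// (cube_off_axis C1 ii1).
  by rewrite sumr_const card_ord -[leLHS]mulr_natl mulrA.
move: nn' n_le n_le' alt_n.
set n := dot (X - xi) w / r X; set n' := dot (X - xi') w / r' X.
move=> nn' n_le n_le' alt_n.
set W := dot w w in n_le n_le' wE *.
have W0 : 0 <= W by apply: le_trans n_le; exact: sqr_ge0.
have rW : 0 <= rho * W by rewrite mulr_ge0.
have sq_le (x : R) : x ^+ 2 <= W -> `|x| <= enorm w.
  by rewrite -wE -real_normK ?num_real// ler_sqr ?nnegrE.
have cross : `|sigma * ((g2 (r' X) - g1 (r' X) / r' X) * (n ^+ 2 - n' ^+ 2))|
    <= c6 * (rho * W).
  rewrite normrM sigma1 mul1r normrM.
  have a1 : `|g2 (r' X) - g1 (r' X) / r' X| <= 2 * K.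
    apply: (le_trans (ler_normB _ _)).
    have g1K' : `|g1 (r' X) / r' X| <= K.
      rewrite normrM normfV (ger0_norm (_ : 0 <= r' X)) ?enorm_ge0//.
      rewrite ler_pdivrMr//.
      by apply: (le_trans g1K); rewrite ler_peMr// ltW.
    lra.
  have a2 : `|n ^+ 2 - n' ^+ 2| <= (m%:R * ((c3 + 3 * mu) * rho) * enorm w) * (2 * enorm w).
    rewrite (_ : _ - _ = (n - n') * (n + n')); last by ring.
    rewrite normrM ler_pM//; apply: (le_trans (ler_normD _ _)).
    by have := sq_le _ n_le; have := sq_le _ n_le'; lra.
  apply: (@le_trans _ _ (2 * K * ((m%:R * ((c3 + 3 * mu) * rho) * enorm w) * (2 * enorm w)))).
    by rewrite ler_pM.
  have -> : 2 * K * (m%:R * ((c3 + 3 * mu) * rho) * enorm w * (2 * enorm w))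
    = (4 * K * m%:R * (c3 + 3 * mu)) * (rho * enorm w ^+ 2) by ring.
  by rewrite wE ler_wpM2r.
set A := f2 (r X) - g2 (r' X) in curv alt *.
set B := _ / r X - _.
have sB : cg / 16 * rho <= sigma * B.
  rewrite /B.
  have b1 : `|sigma * ((f1 (r X) - g1 (r' X)) / r X)| <= cg / 16 * rho.
    rewrite normrM sigma1 mul1r normrM normfV (ger0_norm (_ : 0 <= r X)) ?enorm_ge0//.
    rewrite ler_pdivrMr//.
    apply: (le_trans slope); apply: (@le_trans _ _ (cg / 16 * rho)).
      by rewrite ler_wpM2r.
    by rewrite ler_peMr// mulr_ge0// divr_ge0// ltW.
  have b2 : cg / 2 * rho <= - (sigma * g1 (r' X) * (r X - r' X)).
    have -> : sigma * g1 (r' X) * (r X - r' X)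
      = sigma * g1 (r' X) * x1 + sigma * g1 (r' X) * (r X - r' X - x1) by ring.
    have : `|sigma * g1 (r' X) * (r X - r' X - x1)| <= K * (2 * mu * rho).
      by rewrite normrM normrM sigma1 mul1r ler_pM.
    rewrite ler_norml => /andP[_ b3].
    have := ler_wpM2r rho0 mucg; lra.
  have b4 : cg / 8 * rho <= - (sigma * g1 (r' X) * (r X - r' X)) / (r X * r' X).
    have rr0 : 0 < r X * r' X by rewrite mulr_gt0.
    rewrite ler_pdivlMr//; apply: le_trans b2.
    have rr4 : r X * r' X <= 2 * 2 by rewrite ler_pM// enorm_ge0.
    have : cg / 8 * rho * (r X * r' X) <= cg / 8 * rho * (2 * 2).
      by rewrite ler_wpM2l// mulr_ge0// divr_ge0// ltW.
    lra.
  move: b1; rewrite ler_norml => /andP[b1 _].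
  have -> : sigma * ((f1 (r X) - g1 (r' X)) / r X - g1 (r' X) * (r X - r' X) / (r X * r' X))
    = sigma * ((f1 (r X) - g1 (r' X)) / r X)
      + - (sigma * g1 (r' X) * (r X - r' X)) / (r X * r' X).
    by ring.
  lra.
have Wn : 0 <= W - n ^+ 2 by rewrite subr_ge0.
have sBW := ler_wpM2r Wn sB.
clear slope sg small1 off mucg c4cg shift shift_le diff nn' n_le' sq_le g1K g2K sB.
clear r1 r1' r2 r2' r_gt0 r_gt0' J J' C1 C2.
move: cross; rewrite ler_norml => /andP[cross _].
have -> : sigma * (A * n ^+ 2 + B * (W - n ^+ 2)
    + (g2 (r' X) - g1 (r' X) / r' X) * (n ^+ 2 - n' ^+ 2))
  = sigma * A * n ^+ 2 + sigma * B * (W - n ^+ 2)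
    + sigma * ((g2 (r' X) - g1 (r' X) / r' X) * (n ^+ 2 - n' ^+ 2)) by ring.
have c6rW := ler_wpM2r rW c6cg.
have n0 : 0 <= n ^+ 2 := sqr_ge0 n.
case: alt => [w1|sA]; last first.
  have sAn := ler_wpM2r n0 sA.
  have : 2 * c6 * rho * (W - n ^+ 2) <= cg / 16 * rho * (W - n ^+ 2).
    rewrite ler_wpM2r// ler_wpM2r//; lra.
  lra.
have nmu : n ^+ 2 <= mu * (mu * W).
  have := alt_n w1; rewrite -[n ^+ 2]real_normK ?num_real// -wE => h.
  by have := ler_pM (normr_ge0 _) (normr_ge0 _) h h; rewrite -expr2; lra.
have muW : mu * W <= 1 / 4 * W by rewrite ler_wpM2r.
have muW0 : 0 <= mu * W by rewrite mulr_ge0.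
have nW : n ^+ 2 <= W / 16.
  apply: (le_trans nmu); apply: (@le_trans _ _ (1 / 4 * (mu * W))).
    by rewrite ler_wpM2r.
  lra.
have sAn : - (c6 * (rho * W)) <= sigma * A * n ^+ 2.
  have : `|sigma * A * n ^+ 2| <= c6 * (rho * W).
    rewrite normrM normrM sigma1 mul1r (ger0_norm n0).
    apply: (@le_trans _ _ (K2 * rho * (mu * (mu * W)))).
      by rewrite ler_pM.
    have K2r : 0 <= K2 * rho by rewrite mulr_ge0//; lra.
    apply: (@le_trans _ _ (K2 * rho * (mu * (1 / 4 * W)))).
      by rewrite ler_wpM2l// ler_wpM2l.
    have -> : K2 * rho * (mu * (1 / 4 * W)) = 1 / 4 * (K2 * mu * (rho * W)) by ring.
    have := ler_wpM2r rW small2.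
    have : 0 <= c6 * (rho * W) by rewrite mulr_ge0// ltW.
    lra.
  by rewrite ler_norml => /andP[].
(* The left side is at least [3 * c6 * rho * W], as [c6 <= cg / 96]; the radial term and the cross
   term take away [c6 * rho * W] each. *)
have : cg / 16 * rho * (W / 2) <= cg / 16 * rho * (W - n ^+ 2).
  by rewrite ler_wpM2l ?mulr_ge0//; lra.
lra.
Qed.

End Hessian.

(** * ** * Pair counts for a family, with uniform constants *)

Record family_regular {R : realType} (a0 a1 t0 t1 K lambda cg : R)
    (g g1 g2 : R -> R -> R) : Prop := FamilyRegular {
  family_Dg : forall a t, a0 <= a <= a1 -> t0 < t < t1 ->
    is_derive t 1 (g a) (g1 a t);
  family_Dg1 : forall a t, a0 <= a <= a1 -> t0 < t < t1 ->
    is_derive t 1 (g1 a) (g2 a t);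
  family_g1_bound : forall a t, a0 <= a <= a1 -> t0 < t < t1 -> `|g1 a t| <= K;
  family_g2_bound : forall a t, a0 <= a <= a1 -> t0 < t < t1 -> `|g2 a t| <= K;
  family_g1_lip : forall a a' t t', a0 <= a <= a1 -> a0 <= a' <= a1 ->
    t0 < t < t1 -> t0 < t' < t1 -> `|g1 a' t' - g1 a t| <= K * (`|a' - a| + `|t' - t|);
  family_g2_lip : forall a a' t t', a0 <= a <= a1 -> a0 <= a' <= a1 ->
    t0 < t < t1 -> t0 < t' < t1 -> `|g2 a' t' - g2 a t| <= K * (`|a' - a| + `|t' - t|);
  family_g1_ge : forall a t, a0 <= a <= a1 -> t0 < t < t1 -> cg <= `|g1 a t|;
  family_slope : forall a a' t, a0 <= a <= a1 -> a0 <= a' <= a1 -> t0 < t < t1 ->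
    lambda * `|a' - a| <= `|g1 a' t - g1 a t| }.

(* Where the slopes nearly agree, the second derivatives differ, with the sign that
   makes the radial and the tangential curvature of the gap agree. *)
Definition elliptic_gap {R : realType} (a0 a1 t0 t1 c5 kappa : R)
    (g1 g2 : R -> R -> R) : Prop :=
  forall a a' t t', a0 <= a <= a1 -> a0 <= a' <= a1 -> a' != a ->
    t0 < t < t1 -> t0 < t' < t1 -> t' != t ->
    `|g1 a' t' - g1 a t| <= c5 * (`|a' - a| + `|t' - t|) ->
    kappa / 2 * (`|a' - a| + `|t' - t|) <= `|g2 a' t' - g2 a t| /\
    (g2 a' t' - g2 a t) * g1 a t * (t' - t) <= 0.

Lemma pair_regular_of_family (R : realType) (a0 a1 t0 t1 K lambda cg a a' : R)
    (g g1 g2 : R -> R -> R) :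
  family_regular a0 a1 t0 t1 K lambda cg g g1 g2 ->
  a0 <= a <= a1 -> a0 <= a' <= a1 ->
  pair_regular t0 t1 K `|a - a'| (g a) (g1 a) (g2 a) (g a') (g1 a') (g2 a').
Proof.
move=> reg aA aA'; split=> *.
- exact: (family_Dg reg).
- exact: (family_Dg1 reg).
- exact: (family_Dg reg).
- exact: (family_Dg1 reg).
- exact: (family_g1_bound reg).
- exact: (family_g2_bound reg).
- by apply: le_trans (family_g1_lip reg _ _ _ _) _ => //; rewrite subrr normr0 add0r.
- exact: (family_g1_lip reg).
- exact: (family_g2_lip reg).
Qed.

(** Every smallness condition on the radius is linear in it, so a minimum over a finite list meets
    all of them. *)
Lemma small_radius (R : realType) (s : seq (R * R)) :
  (forall q, q \in s -> 0 < q.1 /\ 0 < q.2) ->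
  exists2 r : R, 0 < r & forall q, q \in s -> q.1 * r <= q.2.
Proof.
elim: s => [_|q s IH Hs]; first by exists 1.
have [|r r0 Hr] := IH; first by move=> q' qs; apply: Hs; rewrite inE qs orbT.
have [q1 q2] := Hs q (mem_head _ _).
exists (Num.min r (q.2 / q.1)); first by rewrite lt_min r0 divr_gt0.
move=> q'; rewrite inE => /predU1P[->|qs].
  by rewrite mulrC -ler_pdivlMr// ge_min lexx orbT.
have [|q1' _] := Hs q'; first by rewrite inE qs orbT.
by apply: le_trans (Hr _ qs); rewrite ler_pM2l// ge_min lexx.
Qed.

Lemma exists_max_abs (R : realType) (m : nat) (i1 : 'I_m) (x : 'I_m -> R) :
  exists i0, forall i, `|x i| <= `|x i0|.
Proof.
by case: (Order.TotalTheory.arg_maxP (fun i => `|x i|) (isT : xpredT i1)) => i0 _ H;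
  exists i0 => i; exact: H.
Qed.

(** [v] has the sign of [u], so the sign chosen at one point of a cube serves at all of them. *)
Lemma sign_stable (R : realFieldType) (u v y c : R) : 0 < c -> c <= `|u| -> c <= `|v| ->
  `|v - u| <= c / 2 -> - ((if 0 <= u * y then -1 else 1) * v * y) = `|v| * `|y|.
Proof.
move=> c0 cu cv uv.
have vu : 0 <= v * u.
  move: cu cv uv; have [u0|u0] := lerP 0 u; have [v0|v0] := lerP 0 v => //.
  - by rewrite mulr_ge0.
  - by rewrite (ger0_norm u0) (ltr0_norm v0) ler_norml; lra.
  - by rewrite (ltr0_norm u0) (ger0_norm v0) ler_norml; lra.
  - by move=> _ _ _; rewrite nmulr_rge0 ?ltW.
have u0 : u != 0 by rewrite -normr_gt0 (lt_le_trans c0).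
rewrite -normrM; have -> : v * y = v * u * (u * y) / u ^+ 2 by field.
have [uy|uy] := lerP 0 (u * y).
  rewrite ger0_norm; first by field.
  by rewrite divr_ge0 ?sqr_ge0// mulr_ge0.
rewrite ler0_norm; first by field.
rewrite pmulr_lle0; last by rewrite invr_gt0 exprn_even_gt0.
by apply: mulr_ge0_le0 => //; exact: ltW.
Qed.

Lemma signed_eq_norm (R : realFieldType) (sigma a b : R) : sigma = 1 \/ sigma = -1 ->
  sigma * b < 0 -> a * b <= 0 -> sigma * a = `|a|.
Proof.
move=> [->|->]; rewrite ?mul1r ?mulN1r ?oppr_lt0 => b0.
  by rewrite nmulr_lle0// => a0; rewrite ger0_norm.
by rewrite pmulr_lle0// => a0; rewrite ler0_norm.
Qed.

(** In the constant, [20 * l] covers the parts of the counts that do not grow as [d] or [rho]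
    decreases; the other four terms belong to the four cases: close translations, an off-axis shift,
    a slope gap, and convexity. The directions [i] and [j] span the plane used in the last case. *)
Lemma close_points_bound (R : realType) (m p : nat) (i1 i j : 'I_m)
    (tm r0 t0 t1 K K2 d e1 lambda cg c3 c4 c6 kappa l : R)
    (f f1 f2 g g1 g2 : R -> R) (xi xi' : 'rV[R]_m) (s s' : R) (z : 'rV[int]_m) :
  (0 < p)%N -> i != j -> 0 < r0 -> 1 <= tm - r0 -> t0 < tm - r0 ->
  tm + r0 + m%:R * r0 < t1 -> t1 <= 2 -> 0 < K -> 0 < d -> d <= l ->
  pair_regular t0 t1 K d f f1 f2 g g1 g2 ->
  (forall t, t0 < t < t1 -> lambda * d <= `|f1 t - g1 t|) ->
  (forall t, t0 < t < t1 -> cg <= `|g1 t|) ->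
  0 < lambda -> 0 < cg -> 0 < c3 -> c3 <= 1 -> 0 < c4 -> 0 < c6 ->
  e1 = 12 * K * m%:R / lambda -> K2 = K * (1 + e1 + m%:R) ->
  c4 <= cg / 16 -> c6 <= cg / 96 -> 4 * K * m%:R * (c3 + 3 * (m%:R * r0)) <= c6 ->
  m%:R * r0 <= 1 / 4 -> 8 * K2 * (m%:R * r0) <= cg * c3 ->
  24 * K2 * (m%:R * r0) <= c4 -> 8 * K * (m%:R * r0) <= cg -> K2 * (m%:R * r0) <= c6 ->
  (i != i1 /\ j != i1) \/
    (c6 <= kappa / 8 /\ forall t t', t0 < t < t1 -> t0 < t' < t1 -> t' != t ->
      `|f1 t' - g1 t| <= 2 * c4 * (d + `|t' - t|) ->
      kappa / 2 * (d + `|t' - t|) <= `|f2 t' - g2 t| /\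
      (f2 t' - g2 t) * g1 t * (t' - t) <= 0) ->
  #|@close_points R m i1 tm r0 f g xi xi' s s' p (r0 / p%:R) z|%:R * p%:R * d
    <= (20 * l + 8 / lambda + 8 * e1 / (cg * c3) + 16 * e1 / c4 + 80 * e1 / (c6 * r0))
       * p%:R ^+ m.
Proof.
move=> p0 ij r00 tm_r0 t0_tm tm_t1 t1_le2 K0 d0 dl reg Hl Hcg l0 cg0 c30 c31 c40 c60.
move=> e1E K2E c4cg c6cg small1 mu_small small2 small3 small4 small5 alt.
set mu := m%:R * r0 in small1 mu_small small2 small3 small4 small5 tm_t1.
set h := r0 / p%:R.
have pR : 0 < p%:R :> R by rewrite ltr0n.
have h0 : 0 < h by rewrite divr_gt0.
have m1 : 1 <= m%:R :> R by rewrite ler1n (leq_ltn_trans (leq0n i1) (ltn_ord i1)).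
have mu0 : 0 < mu by rewrite mulr_gt0//; lra.
have e10 : 0 < e1 by rewrite e1E divr_gt0// !mulr_gt0//; lra.
have K_K2 : K <= K2 by rewrite K2E ler_peMr ?ltW//; lra.
have [T1 T2 T3 T4] : [/\ 0 < 8 / lambda, 0 < 8 * e1 / (cg * c3), 0 < 16 * e1 / c4
    & 0 < 80 * e1 / (c6 * r0)] by split; rewrite !(divr_gt0, mulr_gt0).
set N := #|_|%:R.
have finish (B C : R) : N * p%:R <= B * p%:R ^+ m -> B * d <= C -> 
    C <= 20 * l + 8 / lambda + 8 * e1 / (cg * c3) + 16 * e1 / c4 + 80 * e1 / (c6 * r0) ->
    N * p%:R * d <= (20 * l + 8 / lambda + 8 * e1 / (cg * c3) + 16 * e1 / c4
      + 80 * e1 / (c6 * r0)) * p%:R ^+ m.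
  move=> NB BC CT; apply: (@le_trans _ _ (B * p%:R ^+ m * d)).
    by rewrite ler_wpM2r// ltW.
  by rewrite mulrAC ler_wpM2r ?exprn_ge0// (le_trans BC).
pose x k := xi' 0 k - xi 0 k.
have [i0 xmax] := exists_max_abs i1 x.
set rho := `|x i0| in xmax.
have rho_ge0 : 0 <= rho by exact: normr_ge0.
have line k D : 0 < D ->
    (forall Z, both_cubes i1 tm r0 xi xi' Z ->
       D <= `|gap_derive f1 g1 xi xi' Z (delta_mx 0 k)|) ->
    N * p%:R <= (1 + 2 / D) * p%:R ^+ m.
  by move=> D0 HD; exact: (count_line r00 tm_r0 t0_tm tm_t1 reg s s' z h0 D0 HD).
(* The threshold that defines [e1]. Beyond it [d <= e1 * rho], so a count of order [1 / rho] is also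
   one of order [1 / d]. *)
have [near|/ltW far'] := leP (12 * K * m%:R * rho) (lambda * d).
  apply: (finish _ (d + 8 / lambda) (line i1 (lambda * d / 4) _ _)).
  - by rewrite divr_gt0// mulr_gt0.
  - move=> Z QZ; exact: (gap_axis_ge_of_close r00 tm_r0 t0_tm tm_t1 t1_le2 reg K0 xmax
      mu_small Hl (ltW l0) (ltW d0) near QZ).
  - by rewrite le_eqVlt; apply/orP; left; apply/eqP; field; rewrite !gt_eqF.
  - by clear -d0 dl T1 T2 T3 T4; lra.
have d_rho : d <= e1 * rho.
  by rewrite e1E mulrAC ler_pdivlMr// mulrC.
have rho0 : 0 < rho.
  rewrite lt_neqAle rho_ge0 andbT eq_sym; apply/eqP => rhoE.
  by move: d_rho; rewrite rhoE mulr0 leNgt d0.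
have far : K * (d + m%:R * rho) <= K2 * rho.
  by rewrite K2E -mulrA ler_pM2l//; clear -d_rho rho_ge0; lra.
have [[k [ki1 kc3]]|/forallNP off'] := pselect (exists k, k != i1 /\ c3 * rho <= `|x k|).
  apply: (finish _ (d + 8 * e1 / (cg * c3)) (line k (cg * c3 * rho / 4) _ _)).
  - by rewrite divr_gt0// !mulr_gt0.
  - move=> Z QZ; exact: (gap_off_axis_ge r00 tm_r0 t0_tm tm_t1 t1_le2 reg K0 xmax
      far (ltW d0) ki1 Hcg (ltW cg0) (ltW c30) kc3 small2 QZ).
  - rewrite mulrDl mul1r lerD2l.
    have -> : 2 / (cg * c3 * rho / 4) * d = (8 / (cg * c3)) * (d / rho).
      by field; rewrite !gt_eqF.
    rewrite (_ : 8 * e1 / _ = (8 / (cg * c3)) * e1); last by ring.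
    by rewrite ler_wpM2l ?ler_pdivrMr// ltW// divr_gt0// mulr_gt0.
  - by clear -d0 dl T1 T2 T3 T4; lra.
have off k : k != i1 -> `|x k| <= c3 * rho.
  by move=> ki1; rewrite leNgt; apply/negP => /ltW h1; apply: (off' k).
(* Off the axis every shift is below [c3 * rho] and [c3 <= 1], so the maximum [rho] is attained on
   the axis. *)
have x1E : `|x i1| = rho.
  apply/eqP; rewrite eq_le xmax/=; have [<-//|i0i1] := eqVneq i0 i1.
  exfalso; apply: (off' i0); split => //.
  by rewrite -/rho ler_piMl.
have [[Y [QY HY]]|/forallNP flat'] := pselect (exists Y, both_cubes i1 tm r0 xi xi' Y /\
    c4 * rho <= `|f1 (enorm (Y - xi)) - g1 (enorm (Y - xi'))|).
  apply: (finish _ (d + 16 * e1 / c4) (line i1 (c4 * rho / 8) _ _)).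
  - by rewrite divr_gt0// mulr_gt0.
  - move=> Z QZ; exact: (gap_axis_ge_of_slope r00 tm_r0 t0_tm tm_t1 t1_le2 reg K0 xmax
      mu_small K_K2 far QZ QY HY small3).
  - rewrite mulrDl mul1r lerD2l.
    have -> : 2 / (c4 * rho / 8) * d = (16 / c4) * (d / rho).
      by field; rewrite !gt_eqF.
    rewrite (_ : 16 * e1 / _ = (16 / c4) * e1); last by ring.
    by rewrite ler_wpM2l ?ler_pdivrMr// ltW// divr_gt0.
  - by clear -d0 dl T1 T2 T3 T4; lra.
have flat Z : both_cubes i1 tm r0 xi xi' Z ->
    `|f1 (enorm (Z - xi)) - g1 (enorm (Z - xi'))| <= c4 * rho.
  by move=> QZ; rewrite leNgt; apply/negP => /ltW h1; apply: (flat' Z).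
(* [sigma] is opposite to the sign of [g1 * x i1]. It does not depend on the point, since [g1]
   varies over the cube by at most half of its lower bound [cg]. *)
have [sigma sigma1 Hsigma] : exists2 sigma : R, sigma = 1 \/ sigma = -1 &
    forall Z, both_cubes i1 tm r0 xi xi' Z ->
      cg * rho <= - (sigma * g1 (enorm (Z - xi')) * x i1).
  have [[Y QY]|noQ] := pselect (exists Y, both_cubes i1 tm r0 xi xi' Y); last first.
    by exists 1; [left|move=> Z QZ; case: noQ; exists Z].
  have same Z : both_cubes i1 tm r0 xi xi' Z ->
      `|g1 (enorm (Z - xi')) - g1 (enorm (Y - xi'))| <= cg / 2.
    move=> QZ; case: (QZ) (QY) => _ Z2 [_ Y2].
    have JZ := cube_radius r00 tm_r0 t0_tm tm_t1 Z2.
    have JY := cube_radius r00 tm_r0 t0_tm tm_t1 Y2.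
    apply: (le_trans (pair_g1_lip reg JZ JY)).
    apply: (@le_trans _ _ (K * (4 * mu))); last by clear -small4; lra.
    rewrite ler_wpM2l ?(ltW K0)//.
    have r0mu : r0 <= mu by rewrite ler_peMl// ltW.
    have := cube_axis Z2; have := cube_axis Y2.
    have := enorm_le_axis (ltW r00) tm_r0 Z2; have := enorm_le_axis (ltW r00) tm_r0 Y2.
    have := le_axis_enorm i1 (Z - xi'); have := le_axis_enorm i1 (Y - xi').
    by rewrite -/mu ler_norml; clear -r0mu r00; lra.
  have gY : cg <= `|g1 (enorm (Y - xi'))|.
    by apply: Hcg; case: (QY) => _; exact: cube_radius.
  have gZ Z : both_cubes i1 tm r0 xi xi' Z -> cg <= `|g1 (enorm (Z - xi'))|.
    by move=> -[_ Z2]; apply: Hcg; exact: cube_radius Z2.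
  exists (if 0 <= g1 (enorm (Y - xi')) * x i1 then -1 else 1); first by case: ifP; [right|left].
  move=> Z QZ; rewrite (sign_stable _ cg0 gY (gZ Z QZ) (same Z QZ)).
  by apply: ler_pM; [exact: ltW|by []|exact: gZ|rewrite x1E].
have sigma1' : `|sigma| = 1 by case: sigma1 => ->; rewrite ?normrN normr1.
have hess Z (w : 'rV[R]_m) : both_cubes i1 tm r0 xi xi' Z ->
    (forall k, k != i -> k != j -> w 0 k = 0) ->
    2 * (c6 * rho / 2) * dot w w <= sigma * gap_derive2 f1 f2 g1 g2 xi xi' Z w.
  move=> QZ w0; case: (QZ) => Z1 Z2.
  have J := cube_radius r00 tm_r0 t0_tm tm_t1 Z1.
  have J' := cube_radius r00 tm_r0 t0_tm tm_t1 Z2.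
  have shift k : (Z - xi) 0 k - (Z - xi') 0 k = x k by rewrite !mxE /x; ring.
  have shift_le k : `|(Z - xi) 0 k - (Z - xi') 0 k| <= rho by rewrite shift.
  have rr' : `|enorm (Z - xi) - enorm (Z - xi')| <= m%:R * rho.
    exact: (enorm_diff_le (ltW r00) tm_r0 Z1 Z2 shift_le).
  have curv : `|f2 (enorm (Z - xi)) - g2 (enorm (Z - xi'))| <= K2 * rho.
    apply: le_trans far; apply: (le_trans (pair_fg2 reg J J')).
    by rewrite ler_wpM2l ?(ltW K0)// lerD2l.
  rewrite (_ : 2 * (c6 * rho / 2) = c6 * rho); last by field.
  apply: (gap_derive2_ge r00 tm_r0 t0_tm tm_t1 t1_le2 reg K0 xmax mu_small K_K2 curv
    (flat Z QZ) off sigma1' (Hsigma Z QZ) (ltW c30) cg0 c60 c4cg _ small1 small5 c6cg _ QZ).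
    by rewrite -/mu; have : 0 < K * mu; [rewrite mulr_gt0|clear -small4; lra].
  case: alt => [[ii1 ji1]|[c6k ell]]; first by left; apply: w0; rewrite eq_sym.
  right.
  clear finish line T1 T2 T3 T4 Hl Hcg small1 small2 small3 off' flat' xmax dl curv rr'.
  clear e1E K2E K_K2 e10 far far' h0 pR p0 c4cg c6cg c30 c31 w0.
  have axis := enorm_diff_axis (ltW r00) tm_r0 Z1 Z2 shift_le.
  rewrite -/mu shift in axis.
  have mur : 2 * mu * rho <= rho / 2.
    by have := ler_wpM2r rho_ge0 mu_small; lra.
  (* The axis shift has size [rho] and the radii follow it up to [rho / 2]. This turns the bound
     [c4 * rho] on the slope gap into the hypothesis of [ell], whence its factor 2. *)
  have rr'_ge : rho / 2 <= `|enorm (Z - xi) - enorm (Z - xi')|.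
    have x1le : rho <= `|x i1| by rewrite x1E.
    have := ler_dist_normD x1le axis.
    by rewrite [X in `|X|]addrC subrK; lra.
  have tt' : enorm (Z - xi) != enorm (Z - xi').
    by rewrite -subr_eq0 -normr_gt0; lra.
  have [|k1 k2] := ell _ _ J' J tt'.
    apply: (le_trans (flat Z QZ)).
    have : c4 * (rho / 2) <= c4 * (d + `|enorm (Z - xi) - enorm (Z - xi')|).
      by rewrite ler_wpM2l ?ltW//; lra.
    lra.
  have Age : 2 * c6 * rho <= `|f2 (enorm (Z - xi)) - g2 (enorm (Z - xi'))|.
    apply: le_trans k1.
    have := ler_wpM2r rho_ge0 c6k.
    have k0 : 0 <= kappa / 2 by lra.
    have : kappa / 2 * (rho / 2)
        <= kappa / 2 * (d + `|enorm (Z - xi) - enorm (Z - xi')|).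
      by rewrite ler_wpM2l//; lra.
    lra.
  move: k2 Age; set A := f2 _ - g2 _.
  have sgap : 0 < - (sigma * g1 (enorm (Z - xi')) * (enorm (Z - xi) - enorm (Z - xi'))).
    have := Hsigma Z QZ; set u := g1 _; set y := _ - _ => Hs.
    have -> : sigma * u * y = sigma * u * x i1 + sigma * u * (y - x i1) by ring.
    have : `|sigma * u * (y - x i1)| <= K * (2 * mu * rho).
      by rewrite normrM normrM sigma1' mul1r ler_pM//; exact: (pair_g1 reg).
    rewrite ler_norml => /andP[_ b3].
    have := ler_wpM2r rho_ge0 small4.
    have : 0 < cg * rho by rewrite mulr_gt0.
    lra.
  rewrite -oppr_lt0 opprK -mulrA in sgap.
  by rewrite -mulrA => Aub Age; rewrite (signed_eq_norm sigma1 sgap Aub).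
have c6r : 0 < c6 * rho / 2 by rewrite divr_gt0// mulr_gt0.
have := @count_plane _ _ _ _ _ _ _ _ _ _ _ _ _ _ _ r00 tm_r0 t0_tm tm_t1 reg
  _ _ s s' p _ z h0 i j _ _ ij sigma1' c6r hess.
rewrite -/N expr2 mulrA => Hcount.
apply: (finish (20 + 80 / (c6 * rho * r0)) (20 * l + 80 * e1 / (c6 * r0))).
- rewrite -(ler_pM2r pR); apply: (le_trans Hcount).
  rewrite [leRHS]mulrAC ler_wpM2r ?exprn_ge0//.
  have -> : 40 / (c6 * rho / 2 * h) = 80 / (c6 * rho * r0) * p%:R.
    by rewrite /h; field; rewrite !gt_eqF.
  have p1 : 1 <= p%:R :> R by rewrite ler1n.
  by clear -p1; lra.
- rewrite mulrDl lerD ?ler_wpM2l//.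
  have -> : 80 / (c6 * rho * r0) * d = (80 / (c6 * r0)) * (d / rho).
    by field; rewrite !gt_eqF.
  rewrite (_ : 80 * e1 / _ = (80 / (c6 * r0)) * e1); last by ring.
  by rewrite ler_wpM2l ?ler_pdivrMr// ltW// divr_gt0// mulr_gt0.
- by clear -d0 dl T1 T2 T3 T4; lra.
Qed.

Lemma dist_le_itv (R : realDomainType) (a b x y : R) :
  a <= x <= b -> a <= y <= b -> `|x - y| <= b - a.
Proof.
by move=> /andP[? ?] /andP[? ?]; rewrite ler_norml; apply/andP; split; lra.
Qed.

Lemma pair_bound_family (R : realType) (m : nat) (len K lambda cg kappa c5 l : R) :
  (2 <= m)%N -> 0 < len -> 0 < K -> 0 < lambda -> 0 < cg -> 0 < kappa -> 0 < c5 ->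
  0 < l ->
  exists r0 C : R, [/\ 0 < r0, 0 <= C &
    forall (a0 a1 t0 t1 : R) (g g1 g2 : R -> R -> R),
      a1 - a0 = l -> t1 - t0 = len -> 1 <= t0 -> t1 <= 2 ->
      family_regular a0 a1 t0 t1 K lambda cg g g1 g2 ->
      (3 <= m)%N \/ elliptic_gap a0 a1 t0 t1 c5 kappa g1 g2 ->
      exists2 p0 : 'rV[R]_m,
        (forall P, cube p0 r0 P -> t1 - len / 2 <= enorm P <= t1) &
        forall delta, pair_bound a0 a1 p0 r0 C delta (fun a X => g a (enorm X))].
Proof.
move=> m2 len0 K0 l0 cg0 k0 c50 ll0.
have mR : 0 < m%:R :> R by rewrite ltr0n; case: (m) m2.
pose e1 := 12 * K * m%:R / lambda.
have e10 : 0 < e1 by rewrite divr_gt0// !mulr_gt0.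
pose K2 := K * (1 + e1 + m%:R).
have K20 : 0 < K2 by rewrite mulr_gt0// !addr_gt0.
pose c4 := Num.min (cg / 16) (c5 / 2).
have c40 : 0 < c4 by rewrite lt_min !divr_gt0.
pose c6 := Num.min (cg / 96) (kappa / 8).
have c60 : 0 < c6 by rewrite lt_min !divr_gt0.
(* The error from the different radial directions may amount to [c6]: [c3] uses one half of it, and
   the condition on [24 * K * m%:R * m%:R] below reserves the other half for [r0]. *)
pose c3 := Num.min 1 (c6 / (8 * K * m%:R)).
have c30 : 0 < c3 by rewrite lt_min ltr01 divr_gt0// !mulr_gt0.
have [|r0 r00 Hr] := @small_radius R [:: (m%:R, 1 / 4); (8 * K2 * m%:R, cg * c3);
  (24 * K2 * m%:R, c4); (8 * K * m%:R, cg); (K2 * m%:R, c6);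
  (24 * K * m%:R * m%:R, c6); (m%:R + 1, len / 8)].
  move=> q; rewrite !inE => /or4P[/eqP->|/eqP->|/eqP->|/or4P[/eqP->|/eqP->|/eqP->|/eqP->]];
    by split; rewrite ?(divr_gt0, mulr_gt0, addr_gt0).
have b1 : m%:R * r0 <= 1 / 4.
  by apply: (Hr (m%:R, 1 / 4)); rewrite !inE eqxx ?orbT.
have b2 : (8 * K2 * m%:R) * r0 <= cg * c3.
  by apply: (Hr (8 * K2 * m%:R, cg * c3)); rewrite !inE eqxx ?orbT.
have b3 : (24 * K2 * m%:R) * r0 <= c4.
  by apply: (Hr (24 * K2 * m%:R, c4)); rewrite !inE eqxx ?orbT.
have b4 : (8 * K * m%:R) * r0 <= cg.
  by apply: (Hr (8 * K * m%:R, cg)); rewrite !inE eqxx ?orbT.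
have b5 : (K2 * m%:R) * r0 <= c6.
  by apply: (Hr (K2 * m%:R, c6)); rewrite !inE eqxx ?orbT.
have b6 : (24 * K * m%:R * m%:R) * r0 <= c6.
  by apply: (Hr (24 * K * m%:R * m%:R, c6)); rewrite !inE eqxx ?orbT.
have b7 : (m%:R + 1) * r0 <= len / 8.
  by apply: (Hr (m%:R + 1, len / 8)); rewrite !inE eqxx ?orbT.
pose C := 20 * l + 8 / lambda + 8 * e1 / (cg * c3) + 16 * e1 / c4 + 80 * e1 / (c6 * r0).
exists r0, C; split => //.
  by rewrite !addr_ge0// ltW// ?(divr_gt0, mulr_gt0).
move=> a0 a1 t0 t1 g g1 g2 al tl t01 t12 reg alt.
have mp : (0 < m)%N by case: (m) m2.
pose i1 : 'I_m := Ordinal mp.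
pose i2 : 'I_m := Ordinal m2.
(* The midpoint of the right half of the interval; [b7] keeps all radii over the cube inside this
   half. *)
pose tm := t1 - len / 4.
have mr0 : 0 < m%:R * r0 by rewrite mulr_gt0.
have [w1 w2 w3 w4] : [/\ 1 <= tm - r0, t0 < tm - r0, tm + r0 + m%:R * r0 < t1
    & t1 - len / 2 <= tm - r0] by rewrite /tm; clear -b7 mr0 tl r00 t01; split; lra.
exists (axis_point i1 tm).
  move=> P HP; have := enorm_le_axis (ltW r00) w1 HP; have := le_axis_enorm i1 P.
  have := cube_axis HP; move=> /andP[h1 h2] h3 h4.
  by clear -w3 w4 h1 h2 h3 h4 mr0; apply/andP; split; lra.
move=> delta p a a' xi xi' s s' z p0 aA aA' aa' _ _.
have d0 : 0 < `|a - a'| by rewrite normr_gt0 subr_eq0.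
have dl : `|a - a'| <= l.
  by rewrite -al; exact: dist_le_itv.
have regp := pair_regular_of_family reg aA aA'.
have Hl t : t0 < t < t1 -> lambda * `|a - a'| <= `|g1 a t - g1 a' t|.
  by move=> tI; exact: (family_slope reg).
have Hcg t : t0 < t < t1 -> cg <= `|g1 a' t| by move=> tI; exact: (family_g1_ge reg).
have c4cg : c4 <= cg / 16 by rewrite ge_min lexx.
have c6cg : c6 <= cg / 96 by rewrite ge_min lexx.
have c31 : c3 <= 1 by rewrite ge_min lexx.
have small1 : 4 * K * m%:R * (c3 + 3 * (m%:R * r0)) <= c6.
  have : c3 <= c6 / (8 * K * m%:R) by rewrite ge_min lexx orbT.
  rewrite ler_pdivlMr ?mulr_gt0// => c3c6.
  by clear -c3c6 b6; lra.
have bound i j : i != j -> (i != i1 /\ j != i1) \/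
    (c6 <= kappa / 8 /\ forall t t', t0 < t < t1 -> t0 < t' < t1 -> t' != t ->
      `|g1 a t' - g1 a' t| <= 2 * c4 * (`|a - a'| + `|t' - t|) ->
      kappa / 2 * (`|a - a'| + `|t' - t|) <= `|g2 a t' - g2 a' t| /\
      (g2 a t' - g2 a' t) * g1 a' t * (t' - t) <= 0) ->
    #|@close_points R m i1 tm r0 (g a) (g a') xi xi' s s' p (r0 / p%:R) z|%:R
      * p%:R * `|a - a'| <= C * p%:R ^+ m.
  move=> ij al'.
  apply: (close_points_bound xi xi' s s' z p0 ij r00 w1 w2 w3 t12 K0 d0 dl regp Hl Hcg
    l0 cg0 c30 c31 c40 c60 erefl erefl c4cg c6cg small1 b1 _ _ _ _ al');
  by rewrite (mulrA _ m%:R r0).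
(* For [m >= 3] there is a coordinate plane orthogonal to the axis [i1]. Otherwise the plane
   contains the axis, and ellipticity controls the radial curvature. *)
case: alt => [m3|ell].
  by apply: (bound i2 (Ordinal m3)) => //; left.
apply: (bound i1 i2) => //; right; split; first by rewrite ge_min lexx orbT.
move=> t t' tI tI' tt' H; apply: ell => //.
apply: (le_trans H); rewrite ler_wpM2r ?addr_ge0//.
have : c4 <= c5 / 2 by rewrite ge_min lexx orbT.
by clear; lra.
Qed.

(** * One-sided derivatives, norms and infima *)

Lemma is_derive_within (R : realType) (t0 t1 : R) (f : R -> R) (t : R) :
  t0 < t < t1 -> derivable_within `[t0, t1]%classic f t ->
  is_derive t 1 f (derive_within `[t0, t1]%classic f t).
Proof.
move=> /andP[t0t tt1] df; set l := derive_within _ _ _.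
have fl : diff_quotient f t @ within `[t0, t1]%classic t^' --> l by [].
have lim0 : (fun h : R => h^-1 *: ((f \o shift t) (h *: 1) - f t)) @ 0^' --> l.
  apply/cvgrPdist_lt => e e0.
  have /cvgrPdist_lt/(_ e e0) := fl.
  rewrite near_withinE near_withinE => -[/= d d0 Hd].
  pose d' := Num.min d (Num.min (t - t0) (t1 - t)).
  have d'0 : 0 < d' by rewrite !lt_min d0 !subr_gt0 t0t.
  rewrite near_withinE; exists d' => //= h; rewrite /ball/= sub0r normrN.
  rewrite !lt_min => /and3P[hd h0 h1] hneq.
  have := Hd (h + t); rewrite /ball/= opprD addrC subrK normrN => /(_ hd).
  rewrite -subr_eq0 addrK => /(_ hneq).
  move: h0 h1; rewrite !ltr_norml => /andP[h0 h0'] /andP[h1 h1'] H.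
  have /H : `[t0, t1]%classic (h + t) by rewrite /= in_itv/=; apply/andP; split; lra.
  by rewrite /diff_quotient addrK /= [h *: 1]mulr1 [h^-1 *: _]mulrC.
apply: DeriveDef; first by apply/cvg_ex; exists l.
exact: (cvg_lim (@Rhausdorff R) lim0).
Qed.

Lemma sup_norm_ge (R : realType) (A I : set R) (h : R -> R -> R) (a t : R) :
  A a -> I t -> (`|h a t|%:E <= sup_norm A I h)%E.
Proof. by move=> Aa It; apply: ereal_sup_ubound; exists a => //; exists t. Qed.

Lemma lip_seminorm_ge (R : realType) (A I : set R) (h : R -> R -> R) (a a' t t' : R) :
  A a -> I t -> A a' -> I t' -> (a', t') <> (a, t) ->
  ((`|h a' t' - h a t| / (`|a' - a| + `|t' - t|))%:E <= lip_seminorm A I h)%E.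
Proof.
by move=> Aa It Aa' It' neq; apply: ereal_sup_ubound; exists a, a', t, t'.
Qed.

Lemma pair_dist_gt0 (R : realType) (a a' t t' : R) : (a', t') <> (a, t) ->
  0 < `|a' - a| + `|t' - t|.
Proof.
move=> neq; rewrite lt_neqAle addr_ge0// andbT eq_sym paddr_eq0// !normr_eq0.
rewrite !subr_eq0; apply/negP => /andP[/eqP aa' /eqP tt'].
by apply: neq; rewrite aa' tt'.
Qed.

Lemma reg_norm_bounds (R : realType) (a0 a1 t0 t1 : R) (g : R -> R -> R) :
  let A : set R := `[a0, a1]%classic in let I : set R := `[t0, t1]%classic in
  let K := fine (reg_norm A I g) in
  a0 < a1 -> t0 < t1 -> (reg_norm A I g < +oo)%E ->
  [/\ forall a t, A a -> I t -> `|dt I g a t| <= K,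
      forall a a' t t', A a -> I t -> A a' -> I t' ->
        `|dt I g a' t' - dt I g a t| <= K * (`|a' - a| + `|t' - t|)
    & forall a a' t t', A a -> I t -> A a' -> I t' ->
        `|dt I (dt I g) a' t' - dt I (dt I g) a t| <= K * (`|a' - a| + `|t' - t|)].
Proof.
move=> A I K a01 t01; rewrite /K /reg_norm.
have Aa0 : A a0 by rewrite /A/= in_itv/= lexx ltW.
have Aa1 : A a1 by rewrite /A/= in_itv/= lexx ltW.
have It0 : I t0 by rewrite /I/= in_itv/= lexx ltW.
(* Two distinct points make the Lipschitz suprema nonempty, hence nonnegative; a supremum over the
   empty set would be [-oo]. Each summand of the norm is then below the sum. *)
have neq : (a1, t0) <> (a0, t0) by move=> [aE]; move: a01; rewrite aE ltxx.
set S1 := sup_norm _ _ _; set S2 := lip_seminorm _ _ _; set S3 := lip_seminorm _ _ _.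
have S1ge a t : A a -> I t -> (`|dt I g a t|%:E <= S1)%E := @sup_norm_ge R A I _ a t.
have S2ge := @lip_seminorm_ge R A I (dt I g).
have S3ge := @lip_seminorm_ge R A I (dt I (dt I g)).
have S10 : (0 <= S1)%E by apply: le_trans (S1ge _ _ Aa0 It0); rewrite lee_fin.
have S20 : (0 <= S2)%E.
  by apply: le_trans (S2ge _ _ _ _ Aa0 It0 Aa1 It0 neq); rewrite lee_fin divr_ge0// addr_ge0.
have S30 : (0 <= S3)%E.
  by apply: le_trans (S3ge _ _ _ _ Aa0 It0 Aa1 It0 neq); rewrite lee_fin divr_ge0// addr_ge0.
move=> Sfin.
have S_num : (S1 + S2 + S3)%E \is a fin_num.
  by rewrite ge0_fin_numE// !adde_ge0.
have le1 : (S1 <= S1 + S2 + S3)%E by rewrite -addeA leeDl// adde_ge0.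
have le2 : (S2 <= S1 + S2 + S3)%E by rewrite addeAC leeDr// adde_ge0.
have le3 : (S3 <= S1 + S2 + S3)%E by rewrite leeDr// adde_ge0.
set S := (S1 + S2 + S3)%E in S_num le1 le2 le3 *.
have lip (h : R -> R -> R) (T : \bar R) : (T <= S)%E ->
    (forall a a' t t', A a -> I t -> A a' -> I t' -> (a', t') <> (a, t) ->
      ((`|h a' t' - h a t| / (`|a' - a| + `|t' - t|))%:E <= T)%E) ->
    forall a a' t t', A a -> I t -> A a' -> I t' ->
      `|h a' t' - h a t| <= fine S * (`|a' - a| + `|t' - t|).
  move=> TS HT a a' t t' Aa It Aa' It'.
  have [[-> ->]|neq'] := pselect ((a', t') = (a, t)).
    by rewrite !subrr normr0 addr0 mulr0.
  have := le_trans (HT _ _ _ _ Aa It Aa' It' neq') TS.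
  by rewrite -(fineK S_num) lee_fin ler_pdivrMr// pair_dist_gt0.
split; last 2 first.
- exact: lip le2 S2ge.
- exact: lip le3 S3ge.
by move=> a t Aa It; rewrite -lee_fin fineK// (le_trans (S1ge _ _ Aa It)).
Qed.

(** Bounds [g_tt] through the Lipschitz constant of [g_t], since the regularity norm contains no
    supremum of [|g_tt|]. *)
Lemma norm_le_of_is_derive (R : realType) (f : R -> R) (t0 t1 t l K : R) :
  t0 < t < t1 -> is_derive t 1 f l ->
  (forall s, t0 < s < t1 -> `|f s - f t| <= K * `|s - t|) -> `|l| <= K.
Proof.
move=> /andP[t0t tt1] Df HK.
have : (fun h : R => h^-1 *: ((f \o shift t) (h *: 1) - f t)) @ 0^' --> l.
  have [/cvg_ex[l' fl'] <-] := Df.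
  by rewrite /derive (cvg_lim (@Rhausdorff R) fl').
move=> /cvgrPdist_lt fl; apply/ler_addgt0Pr => e e0.
have := fl e e0; rewrite near_withinE => -[/= d d0 Hd].
pose h := Num.min (d / 2) ((t1 - t) / 2).
have h0 : 0 < h by rewrite lt_min !divr_gt0// subr_gt0.
have hd : h <= d / 2 by rewrite ge_min lexx.
have ht : h <= (t1 - t) / 2 by rewrite ge_min lexx orbT.
have := Hd h; rewrite /ball/= sub0r normrN gtr0_norm// => /(_ ltac:(lra) (lt0r_neq0 h0)).
rewrite [h *: 1]mulr1 => lh.
have qK : `|h^-1 *: (f (h + t) - f t)| <= K.
  rewrite normrM normfV (gtr0_norm h0) mulrC ler_pdivrMr//.
  have := HK (h + t); rewrite addrK (gtr0_norm h0); apply; apply/andP; split; lra.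
have := ler_normD (l - h^-1 *: (f (h + t) - f t)) (h^-1 *: (f (h + t) - f t)).
rewrite subrK => /le_trans; apply; rewrite addrC; apply: lerD => //; exact: ltW.
Qed.

Lemma inf_abs_le (R : realType) (A I : set R) (h : R -> R -> R) (a t : R) :
  A a -> I t -> inf_abs A I h <= `|h a t|.
Proof.
move=> Aa It; apply: ge_inf; last by exists a => //; exists t.
by exists 0 => _ [a' _ [t' _ <-]].
Qed.

Lemma inf_slope_le (R : realType) (A I : set R) (h : R -> R -> R) (a a' t : R) :
  A a -> A a' -> I t -> inf_slope A I h * `|a' - a| <= `|h a' t - h a t|.
Proof.
move=> Aa Aa' It; have [->|aa'] := eqVneq a' a; first by rewrite !subrr normr0 mulr0.
rewrite -ler_pdivlMr; last by rewrite normr_gt0 subr_eq0.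
pose B s : set R := [set r | exists b b', [/\ A b, A b', b' <> b
  & r = `|h b' s - h b s| / `|b' - b|]].
have B0 s : lbound (B s) 0 by move=> _ [b [b' [_ _ _ ->]]]; rewrite divr_ge0.
have Bne s : B s !=set0.
  by exists (`|h a' s - h a s| / `|a' - a|), a, a'; split=> //; exact/eqP.
apply: (@le_trans _ _ (inf (B t))).
  apply: ge_inf; last by exists t.
  by exists 0 => _ [s _ <-]; exact: lb_le_inf (Bne s) (B0 s).
apply: ge_inf; first by exists 0; exact: B0.
by exists a, a'; split=> //; exact/eqP.
Qed.

Lemma cinematic_curvature_le (R : realType) (A I : set R) (g : R -> R -> R)
    (a a' t t' : R) : A a -> I t -> A a' -> I t' ->
  cinematic_curvature A I g * (`|a' - a| + `|t' - t|)
    <= `|dt I g a' t' - dt I g a t| + `|dt I (dt I g) a' t' - dt I (dt I g) a t|.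
Proof.
move=> Aa It Aa' It'; have [[-> ->]|neq] := pselect ((a', t') = (a, t)).
  by rewrite !subrr normr0 !addr0 mulr0.
rewrite -ler_pdivlMr ?pair_dist_gt0//; apply: ge_inf.
  exists 0 => _ [b [b' [s [s' [_ _ _ ->]]]]]; rewrite divr_ge0// addr_ge0//.
by exists a, a', t, t'.
Qed.

Lemma lipschitz_attains_min (R : realType) (a b K : R) (f : R -> R) : a <= b ->
  (forall s t, a <= s <= b -> a <= t <= b -> `|f s - f t| <= K * `|s - t|) ->
  exists2 c, a <= c <= b & forall t, a <= t <= b -> f c <= f t.
Proof.
move=> ab HK; have cf : {within `[a, b], continuous f}; last first.
  have [c cab Hc] := EVT_min ab cf; exists c; first by rewrite in_itv/= in cab.
  by move=> t tab; apply: Hc; rewrite in_itv.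
apply/subspace_continuousP => x; rewrite /= in_itv/= => xab.
apply/cvgrPdist_lt => e e0; rewrite near_withinE; near=> y => /=.
rewrite in_itv/= => yab.
have K1 : 0 < `|K| + 1 by rewrite ltr_wpDl.
apply: (le_lt_trans (HK _ _ xab yab)).
apply: (@le_lt_trans _ _ ((`|K| + 1) * `|x - y|)).
  by rewrite ler_wpM2r// (le_trans (ler_norm _))// lerDl.
rewrite mulrC -ltr_pdivlMr//; near: y.
by apply/nbhs_ballP; exists (e / (`|K| + 1)) => /=; [rewrite divr_gt0|].
Unshelve. all: by end_near. Qed.

(** By compactness the infimum is attained. For each [a] the minimum over [t] is attained at some
    [c a]; as a function of [a] this minimum is again Lipschitz with constant [K], so it attains its
    own minimum. *)
Lemma lipschitz_pos_inf (R : realType) (a0 a1 t0 t1 K : R) (h : R -> R -> R) :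
  let A : set R := `[a0, a1]%classic in let I : set R := `[t0, t1]%classic in
  a0 <= a1 -> t0 <= t1 -> 0 <= K ->
  (forall a a' t t', A a -> I t -> A a' -> I t' ->
     `|h a' t' - h a t| <= K * (`|a' - a| + `|t' - t|)) ->
  (forall a t, A a -> I t -> h a t != 0) -> 0 < inf_abs A I h.
Proof.
move=> A I a01 t01 K0 HK h_neq0.
have AE a : A a <-> a0 <= a <= a1 by rewrite /A/= in_itv.
have IE t : I t <-> t0 <= t <= t1 by rewrite /I/= in_itv.
have dist (a a' t t' : R) : A a -> I t -> A a' -> I t' ->
    `| `|h a' t'| - `|h a t| | <= K * (`|a' - a| + `|t' - t|).
  by move=> *; apply: le_trans (ler_dist_dist _ _) _; exact: HK.
have /choice[c Hc] : forall a, exists c, A a -> I c /\ forall t, I t -> `|h a c| <= `|h a t|.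
  move=> a; have [Aa|nAa] := pselect (A a); last by exists 0.
  have [s t /IE Is /IE It|c /IE Ic Hc] :=
      @lipschitz_attains_min R t0 t1 K (fun t => `|h a t|) t01.
    by have := dist a a t s Aa It Aa Is; rewrite subrr normr0 add0r.
  by exists c => _; split=> // t /IE; exact: Hc.
have [s t /AE As /AE At|b /AE Ab Hb] :=
    @lipschitz_attains_min R a0 a1 K (fun a => `|h a (c a)|) a01.
  have half (x y : R) : A x -> A y -> `|h x (c x)| - `|h y (c y)| <= K * `|x - y|.
    move=> Ax Ay; have [Icx mx] := Hc x Ax; have [Icy my] := Hc y Ay.
    have := dist y x (c y) (c y) Ay Icy Ax Icy; rewrite subrr normr0 addr0.
    by rewrite ler_norml => /andP[_ h2]; have h1 := mx _ Icy; lra.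
  have h1 := half s t As At; have := half t s At As; rewrite (distrC t) => h2.
  by rewrite ler_norml; apply/andP; split; lra.
have [Ic mc] := Hc b Ab.
apply: (@lt_le_trans _ _ `|h b (c b)|); first by rewrite normr_gt0 h_neq0.
apply: lb_le_inf; first by exists `|h b (c b)|, b => //; exists (c b).
move=> _ [a Aa [t It <-]]; apply: le_trans (Hb a _) _; first exact/AE.
by have [_] := Hc a Aa; apply.
Qed.

(** Adding the second column of the determinant to the first replaces the differences in [t] alone
    by those between [(a, t)] and [(a', t')]. When the difference [x - z] of the slopes is small,
    the last term decides the sign. *)
Lemma det2_triangle (R : comNzRingType) (x y z x' y' z' c : R) :
  ((x - y) * (y' - z') - (y - z) * (x' - y')) * (y - z) * c
  = (x - z) * (y' - z') * (y - z) * c - (y - z) ^+ 2 * ((x' - z') * c).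
Proof. by ring. Qed.

Section Nondegenerate.
Context {R : realType} (a0 a1 t0 t1 : R) (g : R -> R -> R).
Let A : set R := `[a0, a1]%classic.
Let I : set R := `[t0, t1]%classic.
Local Notation g1 := (dt I g).
Local Notation g2 := (dt I (dt I g)).
Local Notation K := (fine (reg_norm A I g) + 1).
Hypotheses (a01 : a0 < a1) (t01 : t0 < t1) (nd : nondegenerate_away A I g).

Let AE a : A a <-> a0 <= a <= a1. Proof. by rewrite /A/= in_itv. Qed.
Let IE t : I t <-> t0 <= t <= t1. Proof. by rewrite /I/= in_itv. Qed.
Let Ioo t : t0 < t < t1 -> I t.
Proof. by move=> /andP[? ?]; apply/IE; rewrite !ltW. Qed.

Let bounds := let: And3 (And3 _ _ fin) _ _ := nd in reg_norm_bounds a01 t01 fin.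

Lemma reg_norm_ge0 : 0 <= fine (reg_norm A I g).
Proof.
have [b1 _ _] := bounds; apply: le_trans (b1 a0 t0 _ _); first exact: normr_ge0.
  by apply/AE; rewrite lexx ltW.
by apply/IE; rewrite lexx ltW.
Qed.

Lemma inf_slope_gt0 : 0 < inf_slope A I g1. Proof. by case: nd. Qed.

Lemma inf_abs_gt0 : 0 < inf_abs A I g1.
Proof.
have [_ b2 _] := bounds; have [_ g_neq0 _] := nd.
exact: lipschitz_pos_inf (ltW a01) (ltW t01) reg_norm_ge0 b2 g_neq0.
Qed.

Lemma family_regular_of_nondegenerate :
  family_regular a0 a1 t0 t1 K (inf_slope A I g1) (inf_abs A I g1) g g1 g2.
Proof.
have [b1 b2 b3] := bounds; have [[d1 d2 _] _ _] := nd.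
have Dg1 a t : a0 <= a <= a1 -> t0 < t < t1 -> is_derive t 1 (g1 a) (g2 a t).
  by move=> /AE Aa tI; apply: is_derive_within => //; apply: d2 => //; exact: Ioo.
have KK (x S : R) : x <= fine (reg_norm A I g) * S -> 0 <= S -> x <= K * S.
  by move=> xS S0; apply: (le_trans xS); rewrite ler_wpM2r// lerDl.
split.
- by move=> a t /AE Aa tI; apply: is_derive_within => //; apply: d1 => //; exact: Ioo.
- exact: Dg1.
- by move=> a t /AE Aa /Ioo It; apply: (le_trans (b1 a t Aa It)); rewrite lerDl.
- move=> a t aA tI; apply: (@le_trans _ _ (fine (reg_norm A I g))); last by rewrite lerDl.
  apply: (norm_le_of_is_derive tI (Dg1 a t aA tI)) => s sI.
  have Aa : A a by exact/AE.
  by have := b2 a a t s Aa (Ioo tI) Aa (Ioo sI); rewrite subrr normr0 add0r.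
- move=> a a' t t' /AE Aa /AE Aa' /Ioo It /Ioo It'.
  by apply: KK; [exact: b2|rewrite addr_ge0].
- move=> a a' t t' /AE Aa /AE Aa' /Ioo It /Ioo It'.
  by apply: KK; [exact: b3|rewrite addr_ge0].
- by move=> a t /AE Aa /Ioo It; exact: inf_abs_le.
- by move=> a a' t /AE Aa /AE Aa' /Ioo It; exact: inf_slope_le.
Qed.

(** Where the values of [g_t] nearly agree, [kappa] must be carried by [g_tt]. In the determinant
    the term with the difference of [g_t] is then dominated, so a difference of [g_tt] with the
    wrong sign would contradict ellipticity. *)
Lemma elliptic_gap_of_elliptic (c5 : R) : elliptic_cinematic A I g ->
  t1 - t0 <= 1 -> 0 < c5 -> c5 <= cinematic_curvature A I g / 2 ->
  2 * K ^+ 2 * c5 <= inf_slope A I g1 * cinematic_curvature A I g * inf_abs A I g1 ->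
  2 * (a1 - a0 + 1) * c5 <= inf_abs A I g1 ->
  elliptic_gap a0 a1 t0 t1 c5 (cinematic_curvature A I g) g1 g2.
Proof.
move=> [kappa0 ell] len1 c50 c5k c5K c5l.
have reg := family_regular_of_nondegenerate.
set kappa := cinematic_curvature A I g in kappa0 c5k c5K *.
set lambda := inf_slope A I g1 in reg c5K *; set cg := inf_abs A I g1 in reg c5K c5l *.
have l0 : 0 < lambda by exact: inf_slope_gt0.
have cg0 : 0 < cg by exact: inf_abs_gt0.
have K0 : 0 < K by rewrite ltr_wpDl// reg_norm_ge0.
have size a a' t t' : a0 <= a <= a1 -> a0 <= a' <= a1 -> t0 < t < t1 -> t0 < t' < t1 ->
    `|g1 a' t' - g1 a t| <= c5 * (`|a' - a| + `|t' - t|) ->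
    kappa / 2 * (`|a' - a| + `|t' - t|) <= `|g2 a' t' - g2 a t|.
  move=> aA aA' tI tI' H.
  have [Aa Aa'] : A a /\ A a' by split; exact/AE.
  have := cinematic_curvature_le g Aa (Ioo tI) Aa' (Ioo tI'); rewrite -/kappa -/A -/I.
  set S := `|a' - a| + `|t' - t| in H *.
  have S0 : 0 <= S by rewrite addr_ge0.
  have := ler_wpM2r S0 c5k; lra.
have forward a a' t t' : a0 <= a <= a1 -> a0 <= a' <= a1 -> a' != a ->
    t0 < t < t1 -> t0 < t' < t1 -> t < t' ->
    `|g1 a' t' - g1 a t| <= c5 * (`|a' - a| + `|t' - t|) ->
    (g2 a' t' - g2 a t) * g1 a t <= 0.
  move=> aA aA' aa' tI tI' tt' H; rewrite leNgt; apply/negP => TG.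
  have curv := size a a' t t' aA aA' tI tI' H.
  have [Aa Aa'] : A a /\ A a' by split; exact/AE.
  have := ell a a' t t' Aa Aa' (elimN eqP aa') (Ioo tI) (Ioo tI') tt'.
  rewrite /det2 det2_triangle.
  have qd := family_slope reg aA aA' tI.
  have Q_le := family_g2_lip reg aA aA' tI tI; rewrite subrr normr0 addr0 in Q_le.
  have G_le := family_g1_bound reg aA tI; have G_ge := family_g1_ge reg aA tI.
  set x := g1 a' t' - g1 a t in H; set T := g2 a' t' - g2 a t in curv TG.
  move: qd Q_le G_le G_ge TG.
  set q := g1 a' t - g1 a t; set Q := g2 a' t - g2 a t; set G := g1 a t.
  set S := `|a' - a| + `|t' - t| in H curv *; set d := `|a' - a|.
  move=> qd Q_le G_le G_ge TG.
  have d0 : 0 <= d by exact: normr_ge0.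
  have S0 : 0 <= S by rewrite addr_ge0.
  apply/negP; rewrite -leNgt subr_le0.
  apply: (le_trans (ler_norm _)); rewrite !normrM.
  have -> : q ^+ 2 * (T * G) = `|q| * (`|q| * (`|T| * `|G|)).
    by rewrite -[`|T| * _]normrM (gtr0_norm TG) -[q ^+ 2]real_normK ?num_real//; ring.
  apply: (@le_trans _ _ (`|q| * ((lambda * d) * ((kappa / 2 * S) * cg)))); last first.
    rewrite ler_wpM2l//; apply: ler_pM => //.
    - by rewrite mulr_ge0// ltW.
    - by rewrite !mulr_ge0 ?invr_ge0// ltW.
    by apply: ler_pM => //; rewrite ?mulr_ge0 ?invr_ge0// ltW.
  apply: (@le_trans _ _ (`|q| * ((c5 * S) * (K * d) * K))).
    rewrite (_ : `|x| * `|Q| * `|q| * `|G| = `|q| * (`|x| * `|Q| * `|G|)); last by ring.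
    by rewrite ler_wpM2l//; apply: ler_pM; rewrite ?mulr_ge0//; apply: ler_pM.
  rewrite ler_wpM2l//.
  have -> : c5 * S * (K * d) * K = (2 * K ^+ 2 * c5) * (S * d / 2) by field.
  have -> : lambda * d * (kappa / 2 * S * cg) = (lambda * kappa * cg) * (S * d / 2) by field.
  by rewrite ler_wpM2r// divr_ge0// mulr_ge0.
move=> a a' t t' aA aA' aa' tI tI' tt' H; split; first exact: size.
have [t_lt|t_gt|tE] := ltgtP t t'; last by rewrite tE eqxx in tt'.
  rewrite mulr_le0_ge0 ?subr_ge0 ?(ltW t_lt)//; exact: (forward a a' t t').
(* For [t' < t] the two points exchange roles, which gives the sign relative to [g1 a' t']; as this
   is within [cg / 2] of [g1 a t], both have the same sign. *)
have H' : `|g1 a t - g1 a' t'| <= c5 * (`|a - a'| + `|t - t'|).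
  by rewrite distrC (distrC a) (distrC t).
have a'a : a != a' by rewrite eq_sym.
have := forward a' a t' t aA' aA a'a tI' tI t_gt H'.
have gt := family_g1_ge reg aA tI; have gt' := family_g1_ge reg aA' tI'.
have close : `|g1 a' t' - g1 a t| <= cg / 2.
  apply: (le_trans H); apply: (@le_trans _ _ (c5 * (a1 - a0 + 1))); last by lra.
  rewrite ler_wpM2l ?(ltW c50)//; apply: lerD.
    exact: dist_le_itv.
  apply: (le_trans (@dist_le_itv _ t0 t1 t' t _ _)) => //; exact/IE/Ioo.
move: gt gt' close.
set u := g1 a t; set v := g1 a' t'; set T := g2 a' t' - g2 a t => gt gt' close.
rewrite -opprB -/T mulNr oppr_le0 => Tv.
rewrite mulr_ge0_le0 ?subr_le0 ?(ltW t_gt)//.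
have := sign_stable 1 cg0 gt gt' close; rewrite normr1 mulr1.
have v0 : v != 0 by rewrite -normr_gt0 (lt_le_trans cg0).
rewrite !mulr1; case: ifPn => [u0|u0].
  rewrite mulN1r opprK => vE; have v_gt0 : 0 < v by rewrite vE normr_gt0.
  by rewrite mulr_ge0//; move: Tv; rewrite pmulr_lge0.
rewrite mul1r => vE; have v_lt0 : v < 0 by rewrite -oppr_gt0 vE normr_gt0.
by move: Tv; rewrite nmulr_lge0// => T0; apply: mulr_le0 => //; apply: ltW; rewrite ltNge.
Qed.

End Nondegenerate.

(** * The three types of families *)

Lemma translate_radial_graph (R : realType) (m : nat) (h : R -> R) (J : set R)
    (tau : 'rV[R]_(m + 1)) (E : set 'rV[R]_(m + 1)) (X : 'rV[R]_m) :
  translate (radial_graph h J) tau `<=` E -> J (enorm (X - lsubmx tau)) ->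
  E (row_mx X (h (enorm (X - lsubmx tau)) + tau 0 (rshift m 0))%:M).
Proof.
move=> sub JX; apply: sub.
exists (row_mx (X - lsubmx tau) (h (enorm (X - lsubmx tau)))%:M).
  by exists (X - lsubmx tau).
apply/rowP => i; rewrite !mxE; case: splitP => k ik; rewrite !mxE.
  by rewrite (_ : lshift 1 k = i) ?subrK//; exact: val_inj.
by rewrite ord1 !eqxx !mulr1n; congr (_ + tau 0 _); apply: val_inj; rewrite /= ik ord1.
Qed.

Lemma kakeya_log_translates (R : realType) (m : nat) (a0 a1 r0 C : R) (p0 : 'rV[R]_m)
    (h : R -> R -> R) (J : set R) (E : set 'rV[R]_(m + 1)) :
  a0 < a1 -> 0 < r0 -> 0 <= C -> (forall X, cube p0 r0 X -> J (enorm X)) ->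
  (forall delta, 0 < delta < 1 / 2 ->
    pair_bound a0 a1 p0 r0 C delta (fun a X => h a (enorm X))) ->
  (forall a, a0 <= a <= a1 ->
    exists tau, translate (radial_graph (h a) J) tau `<=` E) ->
  forall delta, 0 < delta < 1 / 2 ->
  ((r0 ^+ (m + 1) / (2 + 2 * (C / (a1 - a0)) * (2 * ((m + 5)%:R * (r0 + 1)) + 1))
    * `|ln delta|^-1)%:E <= lebesgue_rV (neighborhood E delta))%E.
Proof.
move=> a01 r00 C0 JX pb HE delta d01.
apply: (kakeya_log a01 r00 C0 d01 (pb _ d01)) => a aA.
have [tau Htau] := HE a aA; exists (lsubmx tau), (tau 0 (rshift m 0)) => X cX.
exact: translate_radial_graph Htau (JX _ cX).
Qed.

Definition log_bound {R : realType} (c : R) (m : nat) (a0 a1 : R)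
    (Gamma : R -> set 'rV[R]_(m + 1)) : Prop :=
  forall E : set 'rV[R]_(m + 1),
    (forall a, a0 <= a <= a1 -> exists tau, translate (Gamma a) tau `<=` E) ->
    forall delta : R, 0 < delta < 1 / 2 ->
      ((c * `|ln delta|^-1)%:E <= lebesgue_rV (neighborhood E delta))%E.

Lemma log_constant_gt0 (R : realType) (m : nat) (r0 C l : R) : 0 < r0 -> 0 <= C -> 0 < l ->
  0 < r0 ^+ (m + 1) / (2 + 2 * (C / l) * (2 * ((m + 5)%:R * (r0 + 1)) + 1)).
Proof.
move=> r00 C0 l0; rewrite divr_gt0 ?exprn_gt0//.
have D0 : 0 <= C / l by rewrite divr_ge0// ltW.
have M0 : 0 <= (m + 5)%:R * (r0 + 1) by rewrite mulr_ge0// addr_ge0// ltW.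
set M := _ * (r0 + 1) in M0 *.
by have : 0 <= C / l * (2 * M + 1); [rewrite mulr_ge0//; lra|lra].
Qed.

(** The dimension [n] is part of the data and is quantified before [m], so that one constant serves
    every family with the same data. *)
Lemma log_bound_away (R : realType) (n : nat) (len K lambda cg kappa c5 l : R) :
  (3 <= n)%N -> 0 < len -> 0 < K -> 0 < lambda -> 0 < cg -> 0 < kappa -> 0 < c5 ->
  0 < l ->
  exists2 c : R, 0 < c & forall (m : nat) (a0 a1 t0 t1 : R) (g g1 g2 : R -> R -> R),
    (m + 1)%N = n -> a1 - a0 = l -> t1 - t0 = len -> 1 <= t0 -> t1 <= 2 ->
    family_regular a0 a1 t0 t1 K lambda cg g g1 g2 ->
    (3 <= m)%N \/ elliptic_gap a0 a1 t0 t1 c5 kappa g1 g2 ->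
    @log_bound R c m a0 a1 (fun a => radial_graph (g a) (right_half t0 t1)).
Proof.
case: n => // n n3 len0 K0 l0 cg0 k0 c50 ll0.
have [r0 [C [r00 C0 H]]] := pair_bound_family n3 len0 K0 l0 cg0 k0 c50 ll0.
exists (r0 ^+ (n + 1) / (2 + 2 * (C / l) * (2 * ((n + 5)%:R * (r0 + 1)) + 1))).
  exact: log_constant_gt0.
move=> m a0 a1 t0 t1 g g1 g2; rewrite addn1 => -[->] al tl t01 t12 reg alt E HE delta d01.
have [p0 Hp0 pb] := H a0 a1 t0 t1 g g1 g2 al tl t01 t12 reg alt.
rewrite -al; apply: (kakeya_log_translates _ r00 C0 _ (fun delta _ => pb delta) HE d01).
  by rewrite -subr_gt0 al.
by move=> X /Hp0; rewrite /right_half/= in_itv/= tl.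
Qed.

Lemma log_bound_near (R : realType) (n : nat) (K l : R) : 0 < K -> 0 < l ->
  exists2 c : R, 0 < c &
    forall (m : nat) (a0 a1 b eps C0 : R) (g : R -> R -> R),
      (m + 1)%N = n -> a1 - a0 = l -> 0 < eps -> eps <= b -> eps^-1 <= K -> C0 <= K ->
      @intersection_bound R m `[a0, a1]%classic g b eps C0 ->
      @log_bound R c m a0 a1 (fun a => graph_cap g eps a).
Proof.
case: n => [|n] K0 l0; first by exists 1 => // m; rewrite addn1.
(* [K] bounds [eps^-1], so [n * r0 <= K^-1 <= eps] and the cube lies below the cap. *)
pose r0 := (K * n.+1%:R)^-1.
have r00 : 0 < r0 by rewrite invr_gt0 mulr_gt0.
pose C := K * ((n + 3)%:R + r0^-1) ^+ 2 * r0 ^+ 2 / r0 ^+ (n + 1).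
have C0' : 0 <= C.
  apply: divr_ge0; last by apply: exprn_ge0; exact: ltW.
  by apply: mulr_ge0; [apply: mulr_ge0 => //; [exact: ltW|exact: sqr_ge0]|exact: sqr_ge0].
exists (r0 ^+ (n + 1) / (2 + 2 * (C / l) * (2 * ((n + 5)%:R * (r0 + 1)) + 1))).
  exact: log_constant_gt0.
move=> m a0 a1 b eps C0 g; rewrite addn1 => -[->] al eps0 epsb epsK CK inter E HE delta d01.
have nr0 : n%:R * r0 <= eps.
  have Ke : K^-1 <= eps by rewrite -[leRHS]invrK lef_pV2 ?posrE ?invr_gt0.
  apply: le_trans Ke; rewrite /r0 invfM mulrCA ler_piMr ?invr_ge0 ?(ltW K0)//.
  by rewrite ler_pdivrMr// mul1r ler_nat.
rewrite -al; apply: (kakeya_log_translates (p0 := 0) _ r00 C0' _ _ HE d01).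
- by rewrite -subr_gt0 al.
- move=> X cX /=; apply: le_trans nr0; apply: enorm_le_sup => i.
  by have := cX i; rewrite mxE subr0.
move=> delta' /andP[d0 d1]; apply: (pair_bound_of_intersection (ltW K0) CK epsb r00 nr0 _ inter).
by rewrite d0/=; lra.
Qed.

(** Inversion that keeps the entries of the data as equations, so that families with different [g]
    and different intervals but equal data can be treated together. *)
Lemma hypersurface_familyP (R : realType) (K : family_data R -> R) (m : nat) (A : set R)
    (Gamma : R -> set 'rV[R]_(m + 1)) (d : family_data R) :
  hypersurface_family K A Gamma d ->
  match d with
  | DataI n len reg cg lambda => exists g t0 t1,
      [/\ (4 <= m + 1)%N, 1 <= t0, t0 < t1, t1 <= 2 & nondegenerate_away A `[t0, t1]%classic g]
      /\ Gamma = (fun a => radial_graph (g a) (right_half t0 t1)) /\ (m + 1)%N = n /\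
      [/\ t1 - t0 = len, fine (reg_norm A `[t0, t1]%classic g) = reg,
          inf_abs A `[t0, t1]%classic (dt `[t0, t1]%classic g) = cg
        & inf_slope A `[t0, t1]%classic (dt `[t0, t1]%classic g) = lambda]
  | DataII n len reg cg lambda kappa => exists g t0 t1,
      [/\ (m + 1 = 3)%N, 1 <= t0, t0 < t1, t1 <= 2 & nondegenerate_away A `[t0, t1]%classic g]
      /\ elliptic_cinematic A `[t0, t1]%classic g /\
      Gamma = (fun a => radial_graph (g a) (right_half t0 t1)) /\ (m + 1)%N = n /\
      cinematic_curvature A `[t0, t1]%classic g = kappa /\
      [/\ t1 - t0 = len, fine (reg_norm A `[t0, t1]%classic g) = reg,
          inf_abs A `[t0, t1]%classic (dt `[t0, t1]%classic g) = cg
        & inf_slope A `[t0, t1]%classic (dt `[t0, t1]%classic g) = lambda]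
  | DataIII n _ _ _ _ _ => exists g b eps C0,
      [/\ 0 < eps, eps <= b, eps^-1 <= K d, C0 <= K d & intersection_bound m A g b eps C0]
      /\ Gamma = (fun a => graph_cap g eps a) /\ (m + 1)%N = n
  end.
Proof.
case=> [g t0 t1 ? ? ? ? ?|g t0 t1 ? ? ? ? ? ?|g b L eps C0 ? ? ? ? ? ? ? ? ?].
- by exists g, t0, t1.
- by exists g, t0, t1.
- by exists g, b, eps, C0.
Qed.

(** The constant is chosen from [l] and [d] before any family is given, but the entries of [d] are
    known to be positive only through a family that has them. If there is none, any constant will
    do; otherwise one such family yields the signs and is then forgotten. *)
Lemma log_bound_of_data (R : realType) (K : family_data R -> R) (l : R)
    (d : family_data R) : 0 < l ->
  exists2 c : R, 0 < c &
    forall (m : nat) (a0 a1 : R) (Gamma : R -> set 'rV[R]_(m + 1)),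
      a1 - a0 = l -> hypersurface_family K `[a0, a1]%classic Gamma d ->
      log_bound c a0 a1 Gamma.
Proof.
move=> l0.
have vacuous :
    ~ (exists m a0 a1 (Gamma : R -> set 'rV[R]_(m + 1)), a1 - a0 = l /\
       hypersurface_family K `[a0, a1]%classic Gamma d) ->
    exists2 c : R, 0 < c &
      forall (m : nat) (a0 a1 : R) (Gamma : R -> set 'rV[R]_(m + 1)),
        a1 - a0 = l -> hypersurface_family K `[a0, a1]%classic Gamma d ->
        log_bound c a0 a1 Gamma.
  move=> none; exists 1 => // m a0 a1 Gamma al fam.
  by case: none; exists m, a0, a1, Gamma.
have [[m [a0 [a1 [Gamma [al fam]]]]]|] := pselect (exists m a0 a1
    (Gamma : R -> set 'rV[R]_(m + 1)), a1 - a0 = l /\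
    hypersurface_family K `[a0, a1]%classic Gamma d); last exact: vacuous.
have a01 : a0 < a1 by rewrite -subr_gt0 al.
clear vacuous; case: d fam => [n len reg cg lambda|n len reg cg lambda kappa|n b reg L cg lambda]
    /hypersurface_familyP.
- move=> [g [t0 [t1 [[m4 _ t01 _ nd] [_ [mn [lenE regE cgE lambdaE]]]]]]].
  have reg0 := reg_norm_ge0 a01 t01 nd; rewrite regE in reg0.
  have cg0 := inf_abs_gt0 a01 t01 nd; rewrite cgE in cg0.
  have lambda0 := inf_slope_gt0 nd; rewrite lambdaE in lambda0.
  have len0 : 0 < len by rewrite -lenE subr_gt0.
  have K0 : 0 < reg + 1 by rewrite ltr_wpDl.
  have n3 : (3 <= n)%N by rewrite -mn; apply: leq_trans m4.
  (* The value 1 is a placeholder for [kappa] and [c5]: in type (i) the alternative [3 <= m]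
     holds. *)
  have [c c0 H] := log_bound_away n3 len0 K0 lambda0 cg0 ltr01 ltr01 l0.
  exists c => // {m4 nd mn lenE regE cgE lambdaE a01 t01 a0 a1 al Gamma g t0 t1}.
  move=> m' a0 a1 Gamma al /hypersurface_familyP.
  move=> [g [t0 [t1 [[m4 t1_ge t01 t1_le nd] [-> [mn [lenE regE cgE lambdaE]]]]]]].
  have a01 : a0 < a1 by rewrite -subr_gt0 al.
  have fr := family_regular_of_nondegenerate a01 t01 nd.
  rewrite regE cgE lambdaE in fr.
  apply: (H m' a0 a1 t0 t1 g _ _ mn al lenE t1_ge t1_le fr); left.
  by move: m4; rewrite addn1.
- move=> [g [t0 [t1 [[m4 _ t01 _ nd] [ell [_ [mn [kappaE [lenE regE cgE lambdaE]]]]]]]]].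
  have reg0 := reg_norm_ge0 a01 t01 nd; rewrite regE in reg0.
  have cg0 := inf_abs_gt0 a01 t01 nd; rewrite cgE in cg0.
  have lambda0 := inf_slope_gt0 nd; rewrite lambdaE in lambda0.
  have kappa0 : 0 < kappa by rewrite -kappaE; case: ell.
  have len0 : 0 < len by rewrite -lenE subr_gt0.
  have K0 : 0 < reg + 1 by rewrite ltr_wpDl.
  have n3 : (3 <= n)%N by rewrite -mn m4.
  have KK0 : 0 < 2 * (reg + 1) ^+ 2 by rewrite mulr_gt0// exprn_gt0.
  have ll0 : 0 < 2 * (l + 1) by rewrite mulr_gt0// addr_gt0.
  (* In this order, the bounds leave half of [kappa] to [g_tt], make the last term of the
     determinant dominate, and preserve the sign of [g_t] between the two points. *)
  pose c5 := Num.min (kappa / 2) (Num.min (lambda * kappa * cg / (2 * (reg + 1) ^+ 2))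
    (cg / (2 * (l + 1)))).
  have c50 : 0 < c5 by rewrite !lt_min !divr_gt0// !mulr_gt0.
  have c5k : c5 <= kappa / 2 by rewrite ge_min lexx.
  have c5K : 2 * (reg + 1) ^+ 2 * c5 <= lambda * kappa * cg.
    by rewrite mulrC -ler_pdivlMr// !ge_min lexx !orbT.
  have c5l : 2 * (l + 1) * c5 <= cg by rewrite mulrC -ler_pdivlMr// !ge_min lexx !orbT.
  have [c c0 H] := log_bound_away n3 len0 K0 lambda0 cg0 kappa0 c50 l0.
  exists c => // {m4 nd mn lenE regE cgE lambdaE kappaE ell a01 t01 a0 a1 al Gamma g t0 t1}.
  move=> m' a0 a1 Gamma al /hypersurface_familyP.
  move=> [g [t0 [t1 [[m4 t1_ge t01 t1_le nd]
    [ell [-> [mn [kappaE [lenE regE cgE lambdaE]]]]]]]]].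
  have a01 : a0 < a1 by rewrite -subr_gt0 al.
  have fr := family_regular_of_nondegenerate a01 t01 nd.
  rewrite regE cgE lambdaE in fr.
  apply: (H m' a0 a1 t0 t1 g _ _ mn al lenE t1_ge t1_le fr); right.
  by rewrite -kappaE; apply: elliptic_gap_of_elliptic => //;
    rewrite ?kappaE ?regE ?cgE ?lambdaE ?al//; lra.
- move=> [g [b' [eps [C0 [[eps0 _ epsK _ _] _]]]]].
  set k := K _ in epsK *.
  have k0 : 0 < k by apply: lt_le_trans epsK; rewrite invr_gt0.
  have [c c0 H] := log_bound_near n k0 l0.
  exists c => // m' a0' a1' Gamma' al' /hypersurface_familyP.
  move=> [g' [b1 [eps' [C1 [[eps0' epsb' epsK' CK' inter'] [-> mn']]]]]].
  exact: H inter'.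
Qed.

Theorem corollary1p13 (R : realType) (K : family_data R -> R) :
  exists c : R -> family_data R -> R,
    (forall l d, 0 < c l d) /\
    forall (m : nat) (a0 a1 : R) (Gamma : R -> set 'rV[R]_(m + 1))
           (d : family_data R),
      a0 < a1 -> hypersurface_family K `[a0, a1]%classic Gamma d ->
    forall E : set 'rV[R]_(m + 1),
      lebesgue_measurable E ->
      (forall a, a0 <= a <= a1 -> exists tau, translate (Gamma a) tau `<=` E) ->
      (forall delta : R, 0 < delta < 1 / 2 ->
         ((c (a1 - a0) d * `|ln delta|^-1)%:E
            <= lebesgue_rV (neighborhood E delta))%E) /\
      full_minkowski_dimension E.
Proof.
have /choice[c Hc] : forall ld : R * family_data R, exists c : R, 0 < c /\
    forall (m : nat) (a0 a1 : R) (Gamma : R -> set 'rV[R]_(m + 1)),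
      a0 < a1 -> a1 - a0 = ld.1 -> hypersurface_family K `[a0, a1]%classic Gamma ld.2 ->
      log_bound c a0 a1 Gamma.
  move=> [l d]; have [l0|l0] := ltP 0 l; last first.
    (* For [l <= 0] there is no interval of length [l], and 1 is a default value. *)
    by exists 1; split=> // m a0 a1 Gamma; rewrite -subr_gt0 => + al; rewrite al ltNge l0.
  have [c c0 H] := log_bound_of_data K d l0.
  by exists c; split=> // m a0 a1 Gamma _; exact: H.
exists (fun l d => c (l, d)); split; first by move=> l d; have [] := Hc (l, d).
move=> m a0 a1 Gamma d a01 fam E _ HE.
have [c0 H] := Hc (a1 - a0, d).
have HEd := H m a0 a1 Gamma a01 erefl fam E HE.
by split=> //; exact: minkowski_of_log c0 HEd.
Qed.
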